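(* Let $\mu$ be a finite positive Borel measure on $[0,1)$. (i) The operator $\mathcal{H}_\mu$ is a bounded operator from $H^1$ into itself if and only if $\mu$ is a $1$-logarithmic $1$-Carleson measure. (ii) If $1<p<\infty$, then the operator $\mathcal{H}_\mu$ is a bounded operator from $H^p$ into itself if and only if $\mu$ is a Carleson measure.
   Context: $\mathbb{D}$ is the open unit disc in $\mathbb{C}$, and $H^p$ denotes the classical Hardy space of analytic functions in $\mathbb{D}$. For a finite positive Borel measure $\mu$ on $[0,1)$ and $n=0,1,2,\dots$, let $\mu_n=\int_{[0,1)}t^n\,d\mu(t)$. For $f(z)=\sum_{k=0}^\infty a_kz^k$ analytic in $\mathbb{D}$, define $$\mathcal{H}_\mu(f)(z)=\sum_{n=0}^\infty\left(\sum_{k=0}^\infty \mu_{n+k}a_k\right)z^n$$ whenever the right hand side makes sense (i.e. the inner series converge for all $n$) and defines an analytic function in $\mathbb{D}$. Saying that $\mathcal{H}_\mu$ is a bounded operator from $X$ into itself includes that $\mathcal{H}_\mu(f)$ is well defined for every $f\in X$. A positive Borel measure $\mu$ on $[0,1)$ is a Carleson measure if there is $C>0$ with $\mu([t,1))\le C(1-t)$ for all $0\le t<1$. For $\alpha\ge 0$ and $s>0$, it is an $\alpha$-logarithmic $s$-Carleson measure if there is $C>0$ with $\mu([t,1))\left(\log\frac{1}{1-t}\right)^\alpha\le C(1-t)^s$ for all $0\le t<1$. *)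

(* Defs.v *)
From HB Require Import structures.
From mathcomp Require Import all_boot all_order all_algebra.
From mathcomp Require Import complex.
From mathcomp Require Import all_classical all_reals all_analysis.

Set Implicit Arguments.
Unset Strict Implicit.
Unset Printing Implicit Defensive.

Import Order.TTheory GRing.Theory Num.Theory.
Import numFieldNormedType.Exports.

Local Open Scope classical_set_scope.
Local Open Scope ring_scope.
Local Open Scope complex_scope.

Section HardySpaces.
Variable R : realType.

Definition unit_disc : set R[i] := [set z | Normc.normc z < 1].

(* Functions on the disc are total functions on R[i] of which only the values
   in [unit_disc] matter. The regular module R[i]^o makes this the complex
   derivative. *)
Definition analytic_in_disc (f : R[i] -> R[i]) : Prop :=
  forall z, unit_disc z -> derivable (f : R[i]^o -> R[i]^o) z 1.

Definition power_series_in_disc (a : nat -> R[i]) (f : R[i] -> R[i]) : Prop :=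
  forall z, unit_disc z ->
    series (fun k => a k * z ^+ k) @ \oo --> (f z : R[i]^o).

Definition circle_point (r theta : R) : R[i] :=
  (r * cos theta) +i* (r * sin theta).

Definition integral_mean (p r : R) (f : R[i] -> R[i]) : \bar R :=
  (((2 * pi)^-1%:E *
    \int[lebesgue_measure]_(theta in `[0%R, (2 * pi)%R])
      (Normc.normc (f (circle_point r theta)) `^ p)%:E) `^ p^-1)%E.

Definition hardy_norm (p : R) (f : R[i] -> R[i]) : \bar R :=
  ereal_sup [set integral_mean p r f | r in `]0%R, 1%R[].

Definition hardy (p : R) : set (R[i] -> R[i]) :=
  [set f | analytic_in_disc f /\ (hardy_norm p f < +oo)%E].

End HardySpaces.

Section HankelOperator.
Variable R : realType.
Variable mu : {finite_measure set (measurableTypeR R) -> \bar R}.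

Definition moment (n : nat) : R := \int[mu]_(t in `[0%R, 1%R[) (t ^+ n).

(* The Hankel matrix (mu_{n+k}) applied to a coefficient sequence:
   every row series converges, with sum [b n]. *)
Definition hankel_coefficients (a b : nat -> R[i]) : Prop :=
  forall n, series (fun k => (moment (n + k))%:C * a k) @ \oo -->
    (b n : R[i]^o).

(* [g] is the image under the operator of f(z) = \sum_k a_k z^k. *)
Definition hankel_image (a : nat -> R[i]) (g : R[i] -> R[i]) : Prop :=
  analytic_in_disc g /\
  exists2 b, hankel_coefficients a b & power_series_in_disc b g.

(* The coefficient sequence [a] of an analytic [f] exists and is unique, so
   quantifying over it universally is the same as naming it. *)
Definition hankel_bounded_on_hardy (p : R) : Prop :=
  exists C : R, forall f a, hardy p f -> power_series_in_disc a f ->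
    exists g, [/\ hankel_image a g, hardy p g &
                  (hardy_norm p g <= C%:E * hardy_norm p f)%E].

Definition carleson_measure : Prop :=
  exists2 C : R, 0 < C & forall t : R, 0 <= t < 1 ->
    (mu `[t, 1%R[%classic <= (C * (1 - t))%:E)%E.

Definition log_carleson_measure (alpha s : R) : Prop :=
  exists2 C : R, 0 < C & forall t : R, 0 <= t < 1 ->
    (mu `[t, 1%R[%classic * (ln (1 - t)^-1 `^ alpha)%:E <= (C * (1 - t) `^ s)%:E)%E.

End HankelOperator.

(* Main.v *)
Require Import Defs.
From mathcomp Require Import all_boot all_order all_algebra.
From mathcomp Require Import complex ring lra.
From mathcomp Require Import all_classical all_reals all_analysis.
From mathcomp Require Import measurable_realfun.

(** Write [g] for the image of [f]. Formally [g z] is the integral of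
    [f t / (1 - t z)] over [mu], so the operator is governed by the size of the
    kernel [1 / (1 - t z)], which at the point of angle [x] of the circle is
    comparable to [1 / ((1 - t) + |1 - e^(ix)|)] (lemma [kernel_dist_ge]). This
    kernel depends on two distances to the point 1, one along the radius and one
    along the circle, and the arguments use the two measures only through the
    mass of the points at distance at most [s]: Lebesgue measure on the circle
    is bounded by a multiple of [s] there ([arc_small]), and [mu] is so exactly
    when it is a Carleson measure.

    Sufficiency for [1 < p]. Cauchy's formula bounds the values of [f] on the
    radius by the same kernel applied to the boundary values of [f]. Schur's test
    with power weights ([schur_test]) therefore applies twice: from the circle to
    the radius, which gives the Carleson embedding [radial_embedding], and from
    the radius back to the circle, which bounds [g] ([carleson_hankel_bounded]).

    Sufficiency for [p = 1]. Schur's test fails at the endpoint. Instead, the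
    integral of [|g|] over a circle is at most the integral of [|f t|] against
    the potential of the kernel, which is of size [log (1 / (1 - t))]. Bounding
    [|f t|] by [\sum_k |a_k| t ^ k] leaves the moments of [mu] weighted by that
    logarithm; the logarithmic Carleson condition makes them O(1/(k + 1))
    ([log_carleson_moment_le]), and Hardy's inequality
    [\sum_k |a_k| / (k + 1) <= 5 ||f||] closes the estimate. In both cases Hardy's
    inequality also gives the convergence of the rows of the Hankel matrix.

    Hardy's inequality ([hardy_inequality]) is usually derived from the
    factorization of a function of exponent one into two square integrable ones.
    For polynomials an approximate factorization on the circle is enough
    ([balanced_poly]): a polynomial is a product of linear factors, a zero inside
    the disc is reflected outside, and [1 - v z] with [|v| <= 1] has a uniformly
    convergent square root. Hilbert's inequality then bounds the coefficients of
    the product, and dilation extends the result from polynomials to power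
    series.

    Necessity. The operator is tested on [1 / (1 - r z) ^ 2], whose norm is of
    order [(1 - r) ^ (1 / p - 2)] ([peak_norm]). The coefficients of its image
    are at least [r ^ n mu([r, 1)) (1 - r) ^ (-2) / 4] ([hankel_peak_coef_ge]). For
    [1 < p] they force the image to be large at a point of the radius near [r],
    against the growth estimate [hardy_growth]; for [p = 1] Hardy's inequality
    turns them into a partial sum of the logarithmic series. *)

Set Implicit Arguments.
Unset Strict Implicit.
Unset Printing Implicit Defensive.

Import Order.TTheory GRing.Theory Num.Theory.
Import numFieldNormedType.Exports.

Local Open Scope classical_set_scope.
Local Open Scope ring_scope.
Local Open Scope complex_scope.

Local Notation nc := Normc.normc.
Local Notation Re := complex.Re.
Local Notation Im := complex.Im.

(** * Moduli and convergence of complex sequences *)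

Section complex_convergence.
Variable R : realType.
Implicit Types (z w : R[i]) (u : nat -> R[i]).

Lemma normcE_def z : `|z| = (nc z)%:C.
Proof. by case: z => a b; rewrite normc_def. Qed.

Lemma nc_ge0 z : 0 <= nc z.
Proof. by rewrite -lecR -normcE_def normr_ge0. Qed.

Lemma nc_real (x : R) : nc x%:C = `|x|.
Proof. by rewrite /= expr0n /= addr0 sqrtr_sqr. Qed.

Lemma ncD z w : nc (z + w) <= nc z + nc w.
Proof. exact: le_normcD. Qed.

Lemma ncN z : nc (- z) = nc z.
Proof. exact: normcN. Qed.

Lemma ncB z w : nc (z - w) = nc (w - z).
Proof. by rewrite -opprB normcN. Qed.

Lemma nc_nat n : nc (n%:R : R[i]) = n%:R.
Proof.
elim: n => [|n IH]; first exact: Normc.normc0.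
have -> : n.+1%:R = (n.+1%:R : R)%:C :> R[i] by rewrite rmorph_nat.
by rewrite nc_real ger0_norm.
Qed.

Lemma ncX z n : nc (z ^+ n) = nc z ^+ n.
Proof. by elim: n => [|n IH]; rewrite ?Normc.normc1// !exprS Normc.normcM IH. Qed.

Lemma nc_conj z : nc (conjc z) = nc z.
Proof. by apply: complexI; rewrite -!normcE_def normcJ. Qed.

Lemma nc_distD z w v : nc (z - v) <= nc (z - w) + nc (w - v).
Proof. by rewrite (_ : z - v = (z - w) + (w - v)) ?ncD//; ring. Qed.

Lemma nc_sub_le z w : nc z - nc w <= nc (z - w).
Proof. by rewrite lerBlDr; apply: le_trans (ncD _ _); rewrite subrK. Qed.

Lemma nc_dist_le z w : `|nc z - nc w| <= nc (z - w).
Proof. by rewrite ler_norml lerNl opprB nc_sub_le andbT ncB nc_sub_le. Qed.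

Lemma nc_sum (I : Type) (r : seq I) (P : pred I) (F : I -> R[i]) :
  nc (\sum_(i <- r | P i) F i) <= \sum_(i <- r | P i) nc (F i).
Proof.
elim/big_ind2 : _ => [|x1 x2 y1 y2 h1 h2|//]; first by rewrite Normc.normc0.
by apply: le_trans (ncD _ _) _; exact: lerD.
Qed.

Lemma Re_le_nc z : Re z <= nc z.
Proof.
case: z => a b /=; apply: le_trans (ler_norm _) _.
by rewrite -sqrtr_sqr ler_wsqrtr// lerDl sqr_ge0.
Qed.

Lemma absRe_le_nc z : `|Re z| <= nc z.
Proof. by case: z => a b /=; rewrite -sqrtr_sqr ler_wsqrtr// lerDl sqr_ge0. Qed.

Lemma absIm_le_nc z : `|Im z| <= nc z.
Proof. by case: z => a b /=; rewrite -sqrtr_sqr ler_wsqrtr// lerDr sqr_ge0. Qed.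

Lemma nc_le_ReIm z : nc z <= `|Re z| + `|Im z|.
Proof.
case: z => a b /=; rewrite -(@ler_sqr R) ?nnegrE ?sqrtr_ge0 ?addr_ge0//.
rewrite sqr_sqrtr ?addr_ge0 ?sqr_ge0// sqrrD !real_normK ?num_real//.
by rewrite lerD2r lerDl mulrn_wge0// mulr_ge0.
Qed.

Lemma nc_sqr z : nc z ^+ 2 = Re z ^+ 2 + Im z ^+ 2.
Proof. by case: z => a b /=; rewrite sqr_sqrtr// addr_ge0// sqr_ge0. Qed.

(** Reduces a bound on the modulus of a linear expression to a bound on its real
    part, which the linear functionals below preserve. *)
Lemma unimodular_rotation z : exists2 u : R[i], nc u = 1 & u * z = (nc z)%:C.
Proof.
have [->|z0] := eqVneq z 0.
  by exists 1; rewrite ?Normc.normc1// mulr0 Normc.normc0.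
have nz : nc z != 0 by apply: contra z0 => /eqP/Normc.eq0_normc ->.
exists ((nc z)%:C / z).
  by rewrite Normc.normcM Normc.normcV nc_real ger0_norm ?nc_ge0// divff.
by rewrite divfK.
Qed.

Lemma cvgn_near (v : nat -> R) (l : R) : v @ \oo --> l <->
  (forall e, 0 < e -> \forall n \near \oo, `|v n - l| < e).
Proof.
have [H1 H2] := @cvgrPdist_lt R R^o nat \oo _ v l.
split => [/H1 h e e0|h]; first by apply: filterS (h e e0) => n; rewrite distrC.
by apply: H2 => e e0; apply: filterS (h e e0) => n; rewrite distrC.
Qed.

Lemma cvgC_near u (l : R[i]) : u @ \oo --> (l : R[i]^o) <->
  (forall e : R, 0 < e -> \forall n \near \oo, nc (u n - l) < e).
Proof.
have [H1 H2] := @cvgrPdist_lt R[i] R[i]^o nat \oo _ u l.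
split => [/H1 h e e0|h].
  have e0C : 0 < e%:C :> R[i] by rewrite ltcR.
  by apply: filterS (h _ e0C) => n; rewrite normcE_def ltcR ncB.
apply: H2 => e e0.
have eE : e = (Re e)%:C by case: e e0 => a b; rewrite ltcE /= => /andP[/eqP ->].
have e0' : 0 < Re e by rewrite -ltcR -eE.
by apply: filterS (h _ e0') => n; rewrite normcE_def eE ltcR ncB.
Qed.

Lemma cvg_nc u (l : R[i]) : u @ \oo --> (l : R[i]^o) ->
  (fun n => nc (u n)) @ \oo --> nc l.
Proof.
move=> /cvgC_near h; apply/cvgn_near => e e0; apply: filterS (h e e0) => n.
by apply: le_lt_trans; exact: nc_dist_le.
Qed.

Lemma cvg_nc_le u (l : R[i]) (B : R) : u @ \oo --> (l : R[i]^o) ->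
  (forall n, nc (u n) <= B) -> nc l <= B.
Proof.
move=> /cvg_nc h uB; rewrite -(cvg_lim (@Rhausdorff R) h).
by apply: limr_le; [apply/cvg_ex; exists (nc l)|near=> n; exact: uB].
Unshelve. all: by end_near. Qed.

Lemma cvg_Re u (l : R[i]) : u @ \oo --> (l : R[i]^o) ->
  (fun n => Re (u n)) @ \oo --> Re l.
Proof.
move=> /cvgC_near h; apply/cvgn_near => e e0; apply: filterS (h e e0) => n.
by apply: le_lt_trans; rewrite -raddfB absRe_le_nc.
Qed.

Lemma cvg_ReIm u (x y : R) : (fun n => Re (u n)) @ \oo --> x ->
  (fun n => Im (u n)) @ \oo --> y -> u @ \oo --> (x +i* y : R[i]^o).
Proof.
move=> /cvgn_near hx /cvgn_near hy; apply/cvgC_near => e e0.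
have e2 : 0 < e / 2 by rewrite divr_gt0.
apply: filterS2 (hx _ e2) (hy _ e2) => n h1 h2.
apply: le_lt_trans (nc_le_ReIm _) _; rewrite !raddfB /= (splitr e).
exact: ltrD.
Qed.

Lemma series_Re u n : Re (series u n) = series (fun k => Re (u k)) n.
Proof. by rewrite /series /= raddf_sum. Qed.

Lemma series_Im u n : Im (series u n) = series (fun k => Im (u k)) n.
Proof. by rewrite /series /= raddf_sum. Qed.

Lemma bounded_series_cvg (v : nat -> R) (M : R) : (forall n, 0 <= v n) ->
  (forall n, \sum_(k < n) v k <= M) -> cvgn (series v).
Proof.
move=> v0 vM; apply: (@nondecreasing_is_cvgn R).
  by apply: nondecreasing_series => n _ _; exact: v0.
by exists M => _ [n _ <-]; rewrite /series /= big_mkord; exact: vM.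
Qed.

Lemma abs_series_cvg u (M : R) : (forall n, \sum_(k < n) nc (u k) <= M) ->
  exists l : R[i], series u @ \oo --> (l : R[i]^o).
Proof.
move=> uM.
have cv (v : nat -> R) : (forall n, `|v n| <= nc (u n)) -> cvgn (series v).
  move=> vu; apply: (@normed_cvg R R v).
  apply: (@bounded_series_cvg _ M) => [n|n]; first exact: normr_ge0.
  by apply: le_trans (uM n); apply: ler_sum => i _; exact: vu.
have c1 := cv _ (fun n => absRe_le_nc (u n)).
have c2 := cv _ (fun n => absIm_le_nc (u n)).
exists (limn (series (fun k => Re (u k))) +i* limn (series (fun k => Im (u k)))).
apply: cvg_ReIm.
  by rewrite (_ : (fun n => _) = series (fun k => Re (u k)))//;
     apply/funext => n; exact: series_Re.
by rewrite (_ : (fun n => _) = series (fun k => Im (u k)))//;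
   apply/funext => n; exact: series_Im.
Qed.

End complex_convergence.

(** * Power series are analytic *)

Section power_series.
Variable R : realType.
Implicit Types (z w h : R[i]) (a : nat -> R[i]) (f : R[i] -> R[i]).

Lemma derivable_of_quadratic_error f z (L : R[i]) (K d : R) : 0 < K -> 0 < d ->
  (forall h, nc h < d -> nc (f (h + z) - f z - h * L) <= K * nc h ^+ 2) ->
  derivable (f : R[i]^o -> R[i]^o) z 1.
Proof.
move=> K0 d0 fK; apply/cvg_ex; exists (L : R[i]^o).
have [_ H] := @cvgrPdist_lt R[i] R[i]^o R[i]^o (0^')
  _ (fun h : R[i]^o => h^-1 *: ((f (h *: (1:R[i]^o) + z) - f z) : R[i]^o)) (L : R[i]^o).
apply: H => e e0.
have eE : e = (Re e)%:C by case: e e0 => x y; rewrite ltcE /= => /andP[/eqP ->].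
have e0' : 0 < Re e by rewrite -ltcR -eE.
pose d' := Num.min d (Re e / K).
have d'0 : 0 < d' by rewrite /d' lt_min d0 divr_gt0.
have d'0C : 0 < d'%:C :> R[i] by rewrite ltcR.
exists d'%:C => //= h; rewrite /ball_ /mkset sub0r normrN normcE_def ltcR /d' lt_min.
move=> /andP[hd he] h0.
rewrite normcE_def eE ltcR.
have nh0 : nc h != 0 by apply: contra h0 => /eqP/Normc.eq0_normc ->.
have nh : 0 < nc h by rewrite lt_neqAle eq_sym nh0 nc_ge0.
rewrite (_ : L - _ = - (h^-1 * (f (h + z) - f z - h * L))); last first.
  by rewrite /GRing.scale /= mulr1 [in RHS]mulrBr mulKf// opprB.
rewrite ncN Normc.normcM Normc.normcV.
rewrite mulrC ltr_pdivrMr//; apply: le_lt_trans (fK _ hd) _.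
by rewrite expr2 mulrA ltr_pM2r// mulrC -ltr_pdivlMr.
Qed.

(** Applied twice, this bounds the partial sums of [\sum n * q ^ (n - 1)] and of
    [\sum 'C(n, 2) * q ^ (n - 2)] without a limit: the last term is nonnegative. *)
Lemma linear_recursion_sum (q : R) (v w : nat -> R) N :
  v 0%N = 0 -> (forall n, v n.+1 = q * v n + w n) ->
  (1 - q) * (\sum_(n < N) v n) + v N = \sum_(n < N) w n.
Proof.
move=> v0 vS; elim: N => [|N IH]; first by rewrite !big_ord0 v0 mulr0 addr0.
by rewrite !big_ord_recr /= -IH vS; ring.
Qed.

Definition geom_deriv (q : R) n : R := n%:R * q ^+ n.-1.

(** This is ['C(n, 2) * q ^ (n - 2)]; the recursion is the one obeyed by the
    second order error of [z ^ n] in [pow_quadratic_error]. *)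
Fixpoint geom_deriv2 (q : R) n : R :=
  if n is m.+1 then q * geom_deriv2 q m + geom_deriv q m else 0.

Lemma geom_derivS q n : geom_deriv q n.+1 = q * geom_deriv q n + q ^+ n.
Proof.
rewrite /geom_deriv; case: n => [|n] /=; first by ring.
by rewrite -[n.+2%:R]natr1 exprS; ring.
Qed.

Lemma geom_deriv_ge0 q n : 0 <= q -> 0 <= geom_deriv q n.
Proof. by move=> q0; rewrite mulr_ge0 ?exprn_ge0. Qed.

Lemma geom_deriv2_ge0 q n : 0 <= q -> 0 <= geom_deriv2 q n.
Proof.
move=> q0; elim: n => [|n IH] /=; first exact: lexx.
by apply: addr_ge0; [exact: mulr_ge0|exact: geom_deriv_ge0].
Qed.

Lemma geom_sum_le (q : R) N : 0 <= q < 1 -> \sum_(n < N) q ^+ n <= (1 - q)^-1.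
Proof.
move=> /andP[q0 q1]; rewrite -[leRHS]mul1r ler_pdivlMr ?subr_gt0//.
by rewrite mulrC -(opprB q) mulNr -subrX1 opprB gerBl exprn_ge0.
Qed.

Lemma bernoulli_le (d : R) n : 0 <= d <= 1 -> 1 - n%:R * d <= (1 - d) ^+ n.
Proof.
move=> /andP[d0 d1]; elim: n => [|n IH]; first by rewrite mul0r subr0.
have e0 : 0 <= 1 - d by rewrite subr_ge0.
have n0 := ler0n R n; have := ler_wpM2l e0 IH.
by rewrite exprS -natr1; nra.
Qed.

Lemma geom_deriv_sum_le (q : R) N : 0 <= q < 1 ->
  \sum_(n < N) geom_deriv q n <= (1 - q)^-1 ^+ 2.
Proof.
move=> qq; have /andP[q0 q1] := qq.
have := @linear_recursion_sum q (geom_deriv q) (fun n => q ^+ n) N.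
rewrite /geom_deriv mul0r -/(geom_deriv q) => /(_ erefl (geom_derivS q)) H.
rewrite expr2 ler_pdivlMr ?subr_gt0// mulrC.
apply: le_trans (geom_sum_le N qq); rewrite -H lerDl.
exact: geom_deriv_ge0.
Qed.

Lemma geom_deriv2_sum_le (q : R) N : 0 <= q < 1 ->
  \sum_(n < N) geom_deriv2 q n <= (1 - q)^-1 ^+ 3.
Proof.
move=> qq; have /andP[q0 q1] := qq.
have H := @linear_recursion_sum q (geom_deriv2 q) (geom_deriv q) N erefl
  (fun=> erefl).
rewrite exprSr ler_pdivlMr ?subr_gt0// mulrC.
apply: le_trans (geom_deriv_sum_le N qq); rewrite -H lerDl.
exact: geom_deriv2_ge0.
Qed.

Lemma pow_quadratic_error z h (q : R) n : nc z <= q -> nc (h + z) <= q ->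
  nc ((h + z) ^+ n - z ^+ n - h * (n%:R * z ^+ n.-1))
    <= nc h ^+ 2 * geom_deriv2 q n.
Proof.
move=> zq hq; have q0 : 0 <= q by apply: le_trans zq; exact: nc_ge0.
elim: n => [|n IH] /=.
  by rewrite !expr0 subrr mul0r mulr0 subrr Normc.normc0 mulr0.
rewrite (_ : _ - _ - _ = (h + z) * ((h + z) ^+ n - z ^+ n - h * (n%:R * z ^+ n.-1))
   + h ^+ 2 * (n%:R * z ^+ n.-1)); last first.
  case: n {IH} => [|n] /=; first by rewrite !expr1 !expr0; ring.
  by rewrite -[n.+2%:R]natr1 !exprS; ring.
apply: le_trans (ncD _ _) _; rewrite [leRHS]mulrDr; apply: lerD.
  rewrite Normc.normcM [leRHS]mulrCA; apply: ler_pM => //; exact: nc_ge0.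
rewrite !Normc.normcM !ncX /geom_deriv ler_wpM2l ?sqr_ge0//.
rewrite nc_nat.
by rewrite ler_wpM2l// lerXn2r// nnegrE nc_ge0.
Qed.

Lemma power_series_terms_bounded a f (s : R) : power_series_in_disc a f ->
  0 <= s < 1 -> exists2 B : R, 0 < B & forall n, nc (a n) * s ^+ n <= B.
Proof.
move=> af /andP[s0 s1].
have sd : unit_disc s%:C by rewrite /unit_disc /mkset nc_real ger0_norm.
have cv : cvgn (series (fun k => a k * s%:C ^+ k) : nat -> R[i]^o).
  by apply/cvg_ex; exists (f s%:C : R[i]^o); exact: af.
have /cvgC_near/(_ _ ltr01) [N _ hN] := @cvg_series_cvg_0 _ R[i]^o _ cv.
exists (1 + \sum_(n < N) nc (a n) * s ^+ n).
  by rewrite ltr_pwDl// sumr_ge0// => i _; rewrite mulr_ge0 ?nc_ge0 ?exprn_ge0.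
move=> n; have [nN|nN] := ltnP n N.
  rewrite (bigD1 (Ordinal nN))//= addrCA lerDl addr_ge0// sumr_ge0// => i _.
  by rewrite mulr_ge0 ?nc_ge0 ?exprn_ge0.
have := hN _ nN; rewrite /= subr0 Normc.normcM ncX nc_real ger0_norm// => /ltW h.
apply: (le_trans h); rewrite lerDl sumr_ge0// => i _.
by rewrite mulr_ge0 ?nc_ge0 ?exprn_ge0.
Qed.

Lemma cvgC_series_lin (u v : nat -> R[i]) (c l m : R[i]) :
  series u @ \oo --> (l : R[i]^o) -> series v @ \oo --> (m : R[i]^o) ->
  series (fun n => u n + c * v n) @ \oo --> (l + c * m : R[i]^o).
Proof.
move=> /cvgC_near hu /cvgC_near hv; apply/cvgC_near => e e0.
have c1 : 0 < 1 + nc c by rewrite ltr_pwDl// nc_ge0.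
have e1 : 0 < e / (1 + nc c) by rewrite divr_gt0.
apply: filterS2 (hu _ e1) (hv _ e1) => n h1 h2.
rewrite (_ : series _ n - _ = (series u n - l) + c * (series v n - m)); last first.
  by rewrite /series /= big_split /= -mulr_sumr; ring.
apply: le_lt_trans (ncD _ _) _; rewrite Normc.normcM.
rewrite (_ : e = e / (1 + nc c) + nc c * (e / (1 + nc c))); last first.
  by field; rewrite gt_eqF.
by apply: ltr_leD => //; rewrite ler_wpM2l ?nc_ge0// ltW.
Qed.

(** A power series can be differentiated term by term: the error of the
    derived series is quadratic in the increment. *)
Lemma power_series_analytic a f : power_series_in_disc a f -> analytic_in_disc f.
Proof.
move=> af z zd.
have zd' : nc z < 1 := zd.
have z0 := nc_ge0 z.
pose r := (1 + nc z) / 2; pose s := (1 + r) / 2; pose q := r / s.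
have r0 : 0 < r by rewrite /r; lra.
have r1 : r < 1 by rewrite /r; lra.
have s0 : 0 < s by rewrite /s; lra.
have s1 : s < 1 by rewrite /s; lra.
have rs : r < s by rewrite /s; lra.
have q0 : 0 < q by rewrite divr_gt0.
have q1 : q < 1 by rewrite ltr_pdivrMr// mul1r.
have qq : 0 <= q < 1 by rewrite (ltW q0).
have sr : 0 <= s < 1 by rewrite (ltW s0).
have sC : s%:C != 0 :> R[i] by rewrite -(rmorph0 (real_complex R)) (inj_eq (@complexI _)) gt_eqF.
have [B B0 aB] := power_series_terms_bounded af sr.
have zs : nc (z / s%:C) <= q.
  rewrite Normc.normcM Normc.normcV nc_real ger0_norm ?(ltW s0)// ler_pM2r ?invr_gt0//.
  by rewrite /r; lra.
have dcv : exists l : R[i], series (fun n => a n * (n%:R * z ^+ n.-1)) @ \oo --> (l : R[i]^o).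
  apply: (@abs_series_cvg _ _ (B / s * (1 - q)^-1 ^+ 2)) => N.
  apply: (@le_trans _ _ (B / s * \sum_(n < N) geom_deriv q n)); last first.
    by rewrite ler_wpM2l ?geom_deriv_sum_le// divr_ge0// ltW.
  rewrite mulr_sumr; apply: ler_sum => -[n _] _ /=.
  case: n => [|n] /=; first by rewrite /geom_deriv !mul0r !mulr0 Normc.normc0.
  rewrite /geom_deriv /= !Normc.normcM nc_nat ncX (_ : nc z = s * nc (z / s%:C)); last first.
    by rewrite Normc.normcM Normc.normcV nc_real ger0_norm ?(ltW s0)//; field; rewrite gt_eqF.
  rewrite exprMn; set t := nc (z / _).
  rewrite (_ : _ * (_ * _) = nc (a n.+1) * s ^+ n.+1 * (n.+1%:R * t ^+ n) / s); last first.
    by rewrite exprS; field; rewrite gt_eqF.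
  rewrite mulrAC; apply: ler_pM.
  - by apply: divr_ge0 (ltW s0); rewrite mulr_ge0 ?nc_ge0// exprn_ge0// ltW.
  - by rewrite mulr_ge0// exprn_ge0// nc_ge0.
  - by rewrite ler_pM2r ?invr_gt0.
  by rewrite ler_wpM2l// lerXn2r// nnegrE ?nc_ge0 ?(ltW q0).
have [L hL] := dcv.
pose K := B * ((1 - q)^-1 ^+ 3) / s ^+ 2.
apply: (@derivable_of_quadratic_error _ _ L K (r - nc z)).
- by rewrite divr_gt0 ?exprn_gt0// mulr_gt0// exprn_gt0// invr_gt0 subr_gt0.
- by rewrite /r; lra.
move=> h hd.
have hz : nc (h + z) <= r by apply: le_trans (ncD _ _) _; lra.
have hzd : unit_disc (h + z) by rewrite /unit_disc /mkset; lra.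
have c1 := cvgC_series_lin (c := -1) (af _ hzd) (af _ zd).
have c2 := cvgC_series_lin (c := - h) c1 hL.
rewrite (_ : f (h + z) - f z - h * L = f (h + z) + -1 * f z + - h * L); last by ring.
apply: (cvg_nc_le c2) => N; rewrite /series /= big_mkord.
apply: le_trans (nc_sum _ _ _) _.
apply: (@le_trans _ _ (B * nc (h / s%:C) ^+ 2 * \sum_(n < N) geom_deriv2 q n)).
  rewrite mulr_sumr; apply: ler_sum => -[n _] _ /=.
  rewrite (_ : _ + _ = a n * s%:C ^+ n * ((h / s%:C + z / s%:C) ^+ n - (z / s%:C) ^+ n
     - h / s%:C * (n%:R * (z / s%:C) ^+ n.-1))); last first.
    rewrite -mulrDl !exprMn !exprVn; case: n => [|n] /=; first by rewrite !expr0; ring.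
    by rewrite !exprS; field; rewrite ?expf_neq0 sC.
  rewrite Normc.normcM -[leRHS]mulrA; apply: ler_pM; rewrite ?nc_ge0//.
    by rewrite Normc.normcM ncX nc_real ger0_norm// ltW.
  apply: pow_quadratic_error => //.
  by rewrite -mulrDl Normc.normcM Normc.normcV nc_real ger0_norm ?(ltW s0)// ler_pM2r ?invr_gt0.
rewrite Normc.normcM Normc.normcV nc_real ger0_norm ?(ltW s0)// /K.
rewrite (_ : B * _ / _ * _ = B * (nc h / s) ^+ 2 * (1 - q)^-1 ^+ 3); last first.
  by field; rewrite subr_eq0 eq_sym lt_eqF// gt_eqF.
rewrite ler_wpM2l ?geom_deriv2_sum_le// mulr_ge0 ?(ltW B0) ?exprn_ge0//.
by rewrite divr_ge0 ?nc_ge0 ?(ltW s0).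
Qed.

End power_series.

(** * Continuity along circles, and means over the circle *)

Section circle.
Variable R : realType.
Implicit Types (G H : R -> R[i]) (x y : R) (F : R -> R).

(** By components, which suits limits of integrands; [ccont_at_near] is the
    equivalent condition on moduli. *)
Definition ccont_at G x :=
  {for x, continuous (fun y => Re (G y))} /\
  {for x, continuous (fun y => Im (G y))}.

Lemma ccont_cst (c : R[i]) x : ccont_at (fun=> c) x.
Proof. by split; exact: cvg_cst. Qed.

Lemma ccontD G H x : ccont_at G x -> ccont_at H x ->
  ccont_at (fun y => G y + H y) x.
Proof.
case=> g1 g2 [h1 h2]; split.
  rewrite (_ : (fun y => _) = (fun y => Re (G y) + Re (H y))); last first.
    by apply/funext => y; rewrite raddfD.
  exact: (continuousD g1 h1).
rewrite (_ : (fun y => _) = (fun y => Im (G y) + Im (H y))); last first.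
  by apply/funext => y; rewrite raddfD.
exact: (continuousD g2 h2).
Qed.

Lemma ReM (z w : R[i]) : Re (z * w) = Re z * Re w - Im z * Im w.
Proof. by case: z => a b; case: w => c d. Qed.

Lemma ImM (z w : R[i]) : Im (z * w) = Re z * Im w + Im z * Re w.
Proof. by case: z => a b; case: w => c d. Qed.

Lemma ccontM G H x : ccont_at G x -> ccont_at H x ->
  ccont_at (fun y => G y * H y) x.
Proof.
case=> g1 g2 [h1 h2]; split.
  rewrite (_ : (fun y => _) = (fun y => Re (G y) * Re (H y) - Im (G y) * Im (H y))); last first.
    by apply/funext => y; rewrite ReM.
  exact: (continuousB (continuousM g1 h1) (continuousM g2 h2)).
rewrite (_ : (fun y => _) = (fun y => Re (G y) * Im (H y) + Im (G y) * Re (H y))); last first.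
  by apply/funext => y; rewrite ImM.
exact: (continuousD (continuousM g1 h2) (continuousM g2 h1)).
Qed.

Lemma ccont_conj G x : ccont_at G x -> ccont_at (fun y => conjc (G y)) x.
Proof.
case=> g1 g2; split.
  rewrite (_ : (fun y => _) = (fun y => Re (G y))) //.
  by apply/funext => y; case: (G y).
rewrite (_ : (fun y => _) = (fun y => - Im (G y))); first exact: continuousN.
by apply/funext => y; case: (G y).
Qed.

Lemma ccont_sum (I : Type) (r : seq I) (g : I -> R -> R[i]) x :
  (forall i, ccont_at (g i) x) -> ccont_at (fun y => \sum_(i <- r) g i y) x.
Proof.
move=> gc; elim: r => [|i r IH].
  rewrite (_ : (fun y => _) = fun=> 0); first exact: ccont_cst.
  by apply/funext => y; rewrite big_nil.
rewrite (_ : (fun y => _) = fun y => g i y + \sum_(j <- r) g j y); first exact: ccontD.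
by apply/funext => y; rewrite big_cons.
Qed.

Lemma ccontX G n x : ccont_at G x -> ccont_at (fun y => G y ^+ n) x.
Proof.
move=> gc; elim: n => [|n IH]; first exact: ccont_cst.
rewrite (_ : (fun y => _) = fun y => G y * G y ^+ n); first exact: ccontM.
by apply/funext => y; rewrite exprS.
Qed.

Lemma ccont_poly G (p : {poly R[i]}) x : ccont_at G x ->
  ccont_at (fun y => p.[G y]) x.
Proof.
move=> gc; rewrite (_ : (fun y => _) = fun y => \sum_(i < size p) p`_i * G y ^+ i).
  by apply: ccont_sum => i; apply: ccontM; [exact: ccont_cst|exact: ccontX].
by apply/funext => y; rewrite horner_coef.
Qed.

Lemma ccont_nc G x : ccont_at G x -> {for x, continuous (fun y => nc (G y))}.
Proof.
case=> g1 g2.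
rewrite (_ : (fun y => _) = (fun y => Num.sqrt (Re (G y) * Re (G y) + Im (G y) * Im (G y)))); last first.
  by apply/funext => y; case: (G y).
apply: continuous_comp; last exact: sqrt_continuous.
exact: (continuousD (continuousM g1 g1) (continuousM g2 g2)).
Qed.

Lemma ccont_at_near G x : ccont_at G x <->
  (forall e, 0 < e -> \forall y \near x, nc (G y - G x) < e).
Proof.
split=> [[g1 g2] e e0|h]; last first.
  split; apply/cvgrPdist_lt => e e0; apply: filterS (h e e0) => y;
  by apply: le_lt_trans; rewrite ncB -raddfB ?absRe_le_nc ?absIm_le_nc.
have e2 : 0 < e / 2 by rewrite divr_gt0.
move/cvgrPdist_lt : g1 => g1; move/cvgrPdist_lt : g2 => g2.
apply: filterS2 (g1 _ e2) (g2 _ e2) => y h1 h2.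
rewrite ncB; apply: le_lt_trans (nc_le_ReIm _) _; rewrite (splitr e) !raddfB.
exact: ltrD.
Qed.

Lemma ccont_real x : ccont_at (fun y => y%:C) x.
Proof. by split; [exact: cvg_id|exact: cvg_cst]. Qed.

Lemma ccont_circle_point (r : R) x : ccont_at (circle_point r) x.
Proof.
by split; apply: continuousM;
  [exact: cvg_cst|exact: continuous_cos|exact: cvg_cst|exact: continuous_sin].
Qed.

Lemma analytic_near f z e : analytic_in_disc f -> unit_disc z -> 0 < e ->
  exists2 d : R, 0 < d & forall w, nc (w - z) < d -> nc (f w - f z) < e.
Proof.
move=> fa zd e0.
have /derivable1_diffP/differentiable_continuous fc := fa z zd.
have e0C : 0 < e%:C :> R[i] by rewrite ltcR.
have [H _] := @cvgrPdist_lt R[i] R[i]^o R[i]^o (nbhs (z : R[i]^o)) _ f (f z : R[i]^o).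
have [d /= d0 hd] := H fc _ e0C.
have dE : d = (Re d)%:C by case: d d0 {hd} => a b; rewrite ltcE /= => /andP[/eqP ->].
exists (Re d); first by rewrite -ltcR -dE.
move=> w wz; have := hd w; rewrite /ball_ /mkset /= !normcE_def dE !ltcR.
by rewrite (ncB (f w)) => h; apply: h; rewrite ncB.
Qed.

Lemma ccont_analytic f G x : analytic_in_disc f -> unit_disc (G x) ->
  ccont_at G x -> ccont_at (fun y => f (G y)) x.
Proof.
move=> fa Gd /ccont_at_near gc; apply/ccont_at_near => e e0.
have [d d0 hd] := analytic_near fa Gd e0.
by apply: filterS (gc _ d0) => y; exact: hd.
Qed.

Lemma nc_circle_point r x : nc (circle_point r x) = `|r|.
Proof.
rewrite /circle_point /= !exprMn -mulrDr cos2Dsin2 mulr1 sqrtr_sqr//.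
Qed.

Lemma circle_point_disc r x : 0 <= r < 1 -> unit_disc (circle_point r x).
Proof. by case/andP=> r0 r1; rewrite /unit_disc /mkset nc_circle_point ger0_norm. Qed.

Lemma circle_pointE r x : circle_point r x = r%:C * circle_point 1 x.
Proof. by rewrite /circle_point; simpc. Qed.

Lemma circle_pointD x y : circle_point 1 (x + y) = circle_point 1 x * circle_point 1 y.
Proof.
rewrite /circle_point; simpc; rewrite cosD sinD; apply/eqP.
by rewrite eq_complex /= eqxx addrC eqxx.
Qed.

Lemma circle_pointX x n : circle_point 1 x ^+ n = circle_point 1 (n%:R * x).
Proof.
elim: n => [|n IH]; first by rewrite expr0 mul0r /circle_point cos0 sin0 !mulr1 mulr0.
by rewrite exprS IH -circle_pointD -[n.+1%:R]natr1 mulrDl mul1r addrC.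
Qed.

Lemma conj_circle_point x : conjc (circle_point 1 x) = circle_point 1 (- x).
Proof. by rewrite /circle_point /= cosN sinN mulrN. Qed.

End circle.

Section circle_mean.
Variable R : realType.
Implicit Types (F : R -> R).

Local Notation circ := (`[0%R, (2 * pi)%R]%classic : set (measurableTypeR R)).

Definition cmean (F : R -> R) : R :=
  (2 * pi)^-1 * \int[lebesgue_measure]_(x in circ) F x.

Lemma pi2_gt0 : 0 < 2 * pi :> R. Proof. by rewrite mulr_gt0// pi_gt0. Qed.

Lemma circ_integrable F : continuous F ->
  lebesgue_measure.-integrable circ (EFin \o F).
Proof.
move=> Fc; apply: continuous_compact_integrable; first exact: segment_compact.
exact: continuous_subspaceT.
Qed.

Lemma cmeanE F : continuous F -> (cmean F)%:E =
  ((2 * pi)^-1%:E * \int[lebesgue_measure]_(x in circ) (F x)%:E)%E.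
Proof.
move=> Fc; rewrite /cmean EFinM /Rintegral fineK//.
exact: (integrable_fin_num _ (circ_integrable Fc)).
Qed.

Lemma cmeanD F1 F2 : continuous F1 -> continuous F2 ->
  cmean (fun x => F1 x + F2 x) = cmean F1 + cmean F2.
Proof.
move=> c1 c2; have i1 := circ_integrable c1; have i2 := circ_integrable c2.
by rewrite /cmean -mulrDr RintegralD. Qed.

Lemma cmeanZ (c : R) F : continuous F -> cmean (fun x => c * F x) = c * cmean F.
Proof.
move=> c1; have i1 := circ_integrable c1.
by rewrite /cmean [RHS]mulrCA RintegralZl.
Qed.

Lemma cmean_cst (c : R) : cmean (fun=> c) = c.
Proof.
rewrite /cmean Rintegral_cst//= lebesgue_measure_itv /= lte_fin pi2_gt0 sube0.
by rewrite mulrCA mulVf ?mulr1// gt_eqF// pi2_gt0.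
Qed.

Lemma cmean_le F1 F2 : continuous F1 -> continuous F2 ->
  (forall x, F1 x <= F2 x) -> cmean F1 <= cmean F2.
Proof.
move=> c1 c2 h; rewrite /cmean ler_pM2l ?invr_gt0 ?pi2_gt0//.
have i1 := circ_integrable c1; have i2 := circ_integrable c2.
by apply: le_Rintegral.
Qed.

Lemma cmean_sum (I : Type) (r : seq I) (F : I -> R -> R) :
  (forall i, continuous (F i)) ->
  continuous (fun x => \sum_(i <- r) F i x) /\
  cmean (fun x => \sum_(i <- r) F i x) = \sum_(i <- r) cmean (F i).
Proof.
move=> Fc; elim: r => [|i r [IH1 IH2]].
  rewrite big_nil (_ : (fun x => _) = fun=> 0); last first.
    by apply/funext => x; rewrite big_nil.
  by split; [move=> x; exact: cvg_cst|rewrite cmean_cst].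
rewrite big_cons (_ : (fun x => _) = fun x => F i x + \sum_(j <- r) F j x); last first.
  by apply/funext => x; rewrite big_cons.
split; last by rewrite cmeanD// IH2.
by move=> x; apply: continuousD; [exact: Fc|exact: IH1].
Qed.

End circle_mean.

(** * Orthogonality of the characters *)

Section orthogonality.
Variable R : realType.
Implicit Types (P Q : {poly R[i]}) (c : R[i]).

Local Notation e := (circle_point (1 : R)).

Lemma cmean_derivative (F f : R -> R) : continuous f ->
  (forall x : R, is_derive x 1 F (f x)) ->
  cmean f = (2 * pi)^-1 * (F (2 * pi) - F 0).
Proof.
move=> fc Ff; apply: EFin_inj; rewrite cmeanE// (@continuous_FTC2 _ _ F) ?pi2_gt0//.
- exact: continuous_subspaceT.
- have Fc x : {for x, continuous F}.
    by apply: differentiable_continuous; apply/derivable1_diffP; case: (Ff x).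
  split=> [x _||]; first by case: (Ff x).
    exact/cvg_at_right_filter/Fc.
  exact/cvg_at_left_filter/Fc.
- by move=> x _; rewrite derive1E; case: (Ff x).
Qed.

Lemma circle_point_period n : e (n%:R * (2 * pi)) = 1.
Proof.
rewrite -circle_pointX (_ : 2 * pi = pi + pi :> R); last by rewrite mulr_natl mulr2n.
by rewrite circle_pointD /circle_point sinpi cospi; simpc; rewrite expr1n.
Qed.

Lemma cmean_character c (k l : nat) :
  cmean (fun x => Re (c * (e x ^+ k * conjc (e x) ^+ l))) = if k == l then Re c else 0.
Proof.
pose m : R := k%:R - l%:R.
have E x : e x ^+ k * conjc (e x) ^+ l = e (m * x).
  by rewrite conj_circle_point !circle_pointX -circle_pointD mulrN -mulrBl.
have [kl|kl] := eqVneq k l.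
  rewrite (_ : (fun x => _) = fun=> Re c) ?cmean_cst//.
  by apply/funext => x; rewrite E /m kl subrr mul0r /circle_point cos0 sin0 !mul1r mulr1.
have m0 : m != 0 by rewrite subr_eq0 eqr_nat.
pose f x := Re c * cos (m * x) - Im c * sin (m * x).
pose F x := m^-1 * (Re c * sin (m * x) + Im c * cos (m * x)).
have -> : (fun x => Re (c * (e x ^+ k * conjc (e x) ^+ l))) = f.
  by apply/funext => x; rewrite E ReM /circle_point /= !mul1r.
have dm x : is_derive x (1:R) (fun x => m * x) m.
  have := @is_deriveZ R R^o R^o id m x 1 1 (is_derive_id _ _).
  by rewrite /GRing.scale /= mulr1.
have dF (x : R) : is_derive x (1 : R) F (f x).
  have h1 := @is_derive1_comp R sin (fun x => m * x) x _ _ (is_derive_sin _) (dm x).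
  have h2 := @is_derive1_comp R cos (fun x => m * x) x _ _ (is_derive_cos _) (dm x).
  have h3 := is_deriveD (is_deriveZ (Re c) h1) (is_deriveZ (Im c) h2).
  have := is_deriveZ m^-1 h3.
  rewrite (_ : m^-1 *: _ = f x); last by rewrite /GRing.scale /= /f; field.
  exact.
have fc : continuous f.
  move=> x; have cm : {for x, continuous (fun x => m * x)}.
    by apply: continuousM; [exact: cvg_cst|exact: cvg_id].
  have h1 := continuous_comp cm (@continuous_cos _ _).
  have h2 := continuous_comp cm (@continuous_sin _ _).
  have k1 : {for x, continuous (fun=> Re c)} by exact: cvg_cst.
  have k2 : {for x, continuous (fun=> Im c)} by exact: cvg_cst.
  exact: (continuousB (continuousM k1 h1) (continuousM k2 h2)).
rewrite (cmean_derivative fc dF).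
have [c1 s1] : cos (m * (2 * pi)) = 1 /\ sin (m * (2 * pi)) = 0.
  have : e (m * (2 * pi)) = 1.
    rewrite mulrBl circle_pointD -conj_circle_point !circle_point_period.
    by rewrite conjc1 mulr1.
  by rewrite /circle_point !mul1r => -[].
by rewrite /F c1 s1 (mulr0 m) cos0 sin0 subrr mulr0.
Qed.

Lemma ccont_e x : ccont_at e x. Proof. exact: ccont_circle_point. Qed.

Lemma poly_pairing P Q :
  cmean (fun x => Re (P.[e x] * conjc Q.[e x])) =
  Re (\sum_(i < size P) P`_i * conjc Q`_i).
Proof.
pose G i j x := Re (P`_i * conjc Q`_j * (e x ^+ i * conjc (e x) ^+ j)).
have Gc i j : continuous (G i j).
  move=> x; have [] := ccontM (@ccont_cst R (P`_i * conjc Q`_j) x)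
    (ccontM (ccontX i (ccont_e x)) (ccontX j (ccont_conj (ccont_e x)))).
  by [].
have H1 i := cmean_sum (index_enum 'I_(size Q)) (fun j : 'I_(size Q) => Gc i j).
have [_ H2] := cmean_sum (index_enum 'I_(size P)) (fun i : 'I_(size P) => (H1 i).1).
rewrite (_ : (fun x => _) = fun x => \sum_(i < size P) \sum_(j < size Q) G i j x); last first.
  apply/funext => x; rewrite !horner_coef rmorph_sum /= mulr_suml raddf_sum.
  apply: eq_bigr => i _; rewrite mulr_sumr raddf_sum; apply: eq_bigr => j _.
  by rewrite /G rmorphM rmorphXn /=; congr Re; ring.
rewrite H2 raddf_sum; apply: eq_bigr => i _; rewrite (H1 i).2.
under eq_bigr => j _ do rewrite /G cmean_character.
have [iQ|iQ] := ltnP i (size Q).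
  rewrite (bigD1 (Ordinal iQ))//= eqxx big1 ?addr0// => j /negbTE ji.
  by rewrite eq_sym; case: ifP => // /eqP ij; move: ji; rewrite -val_eqE /= ij eqxx.
rewrite big1 => [|j _]; last first.
  by case: eqP => // ij; move: iQ; rewrite ij leqNgt ltn_ord.
by rewrite (nth_default 0 iQ) conjc0 mulr0.
Qed.

Lemma nc_sqrE (z : R[i]) : Re (z * conjc z) = nc z ^+ 2.
Proof. by rewrite nc_sqr; case: z => a b /=; ring. Qed.

Lemma poly_parseval P :
  cmean (fun x => nc P.[e x] ^+ 2) = \sum_(i < size P) nc P`_i ^+ 2.
Proof.
have := poly_pairing P P.
rewrite raddf_sum /=; under [RHS]eq_bigr do rewrite nc_sqrE.
by move=> <-; congr cmean; apply/funext => x; rewrite nc_sqrE.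
Qed.

Lemma continuous_nc_poly P : continuous (fun x => nc P.[e x]).
Proof. by move=> x; apply: ccont_nc; apply: ccont_poly; exact: ccont_e. Qed.

Lemma continuous_ncM (F G : R -> R) : continuous F -> continuous G ->
  continuous (fun x => F x * G x).
Proof. by move=> Fc Gc x; apply: continuousM; [exact: Fc|exact: Gc]. Qed.

(** The linear functionals of a polynomial given by the coefficients of another
    one are means over the circle; truncated Cauchy kernels and monomials are
    tested in this way. *)
Lemma poly_pairing_bound P Q :
  nc (\sum_(i < size P) P`_i * conjc Q`_i) <=
  cmean (fun x => nc P.[e x] * nc Q.[e x]).
Proof.
set S := \sum_(i < size P) _.
have [u u1 uS] := unimodular_rotation S.
have -> : nc S = Re (u * S) by rewrite uS.
have [->|u0] := eqVneq u 0.
  rewrite mul0r /=; apply: (@le_trans _ _ (cmean (fun=> 0))); first by rewrite cmean_cst.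
  apply: cmean_le => [x|x|x]; first exact: cvg_cst.
    by apply: continuous_ncM; exact: continuous_nc_poly.
  by rewrite mulr_ge0 ?nc_ge0.
have -> : u * S = \sum_(i < size (u *: P)) (u *: P)`_i * conjc Q`_i.
  by rewrite size_scale// mulr_sumr; apply: eq_bigr => i _; rewrite coefZ mulrA.
rewrite -poly_pairing; apply: cmean_le => [x|x|x].
- have [+ _] := ccontM (ccont_poly (u *: P) (ccont_e x)) (ccont_conj (ccont_poly Q (ccont_e x))).
  exact.
- by apply: continuous_ncM; exact: continuous_nc_poly.
apply: le_trans (Re_le_nc _) _.
by rewrite Normc.normcM nc_conj hornerZ Normc.normcM u1 mul1r.
Qed.

End orthogonality.

(** * Cauchy's kernel *)

Section cauchy.
Variable R : realType.
Implicit Types (P Q : {poly R[i]}) (a : nat -> R[i]) (f : R[i] -> R[i]).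

Local Notation e := (circle_point (1 : R)).

Lemma continuous_scale (c : R) (F : R -> R) : continuous F ->
  continuous (fun x => c * F x).
Proof. by move=> Fc; apply: continuous_ncM => // x; exact: cvg_cst. Qed.

Lemma continuous_add (F G : R -> R) : continuous F -> continuous G ->
  continuous (fun x => F x + G x).
Proof. by move=> Fc Gc x; apply: continuousD; [exact: Fc|exact: Gc]. Qed.

(** Comparable to the distance of the angle to the multiples of [2 * pi]. *)
Definition chord (x : R) : R := nc (1 - e x).

Lemma nc_e x : nc (e x) = 1.
Proof. by rewrite nc_circle_point normr1. Qed.

Lemma chord_ge0 x : 0 <= chord x. Proof. exact: nc_ge0. Qed.

Lemma kernel_dist_ge1 (s x : R) : 0 <= s <= 1 -> 1 - s <= nc (1 - s%:C * e x).
Proof.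
move=> /andP[s0 s1]; apply: le_trans (nc_sub_le _ _).
by rewrite Normc.normc1 Normc.normcM nc_e mulr1 nc_real ger0_norm.
Qed.

(** The gap to the circle and the chord on it are the two distances that describe
    the size of the kernel. *)
Lemma kernel_dist_ge (s x : R) : 0 <= s <= 1 ->
  (1 - s) + chord x <= 3 * nc (1 - s%:C * e x).
Proof.
move=> ss; have h1 := kernel_dist_ge1 x ss; case/andP: ss => s0 s1.
have : chord x <= nc (1 - s%:C * e x) + (1 - s).
  rewrite /chord (_ : 1 - e x = (1 - s%:C * e x) + (s - 1)%:C * e x); last first.
    by rewrite rmorphB /= rmorph1; ring.
  apply: le_trans (ncD _ _) _; rewrite lerD2l Normc.normcM nc_e mulr1 nc_real.
  by rewrite distrC ger0_norm ?subr_ge0.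
by lra.
Qed.

Lemma continuous_kernel (t : R) : 0 <= t < 1 ->
  continuous (fun x => (nc (1 - t%:C * e x))^-1).
Proof.
move=> /andP[t0 t1] x; have t01 : 0 <= t <= 1 by rewrite t0 ltW.
have n0 : nc (1 - t%:C * e x) != 0.
  by rewrite gt_eqF// (lt_le_trans _ (kernel_dist_ge1 x t01)) ?subr_gt0.
have h : {for x, continuous (fun x => nc (1 - t%:C * e x))}.
  apply: ccont_nc; apply: ccontD; first exact: ccont_cst.
  rewrite (_ : (fun y => _) = fun y => (- t%:C) * e y); last by apply/funext => y; ring.
  by apply: ccontM; [exact: ccont_cst|exact: ccont_e].
exact: (@cvgV R R _ _ _ _ n0 h).
Qed.

Lemma geom_kernel_le (w : R[i]) N : nc w <= 1 -> w != 1 ->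
  nc (\sum_(k < N) w ^+ k) <= 2 / nc (1 - w).
Proof.
move=> w1 wn1; have d0 : 0 < nc (1 - w).
  rewrite lt_neqAle nc_ge0 andbT eq_sym; apply: contra wn1 => /eqP/Normc.eq0_normc/eqP.
  by rewrite subr_eq0 eq_sym.
rewrite ler_pdivlMr// -Normc.normcM mulrC.
rewrite (_ : (1 - w) * _ = 1 - w ^+ N); last by rewrite -opprB mulNr -subrX1 opprB.
apply: le_trans (ncD _ _) _; rewrite Normc.normc1 ncN ncX.
by have := exprn_ile1 N (nc_ge0 w) w1; lra.
Qed.

(** Cauchy's formula for a polynomial is the pairing with a truncated geometric
    series, so that only polynomials occur; the truncation costs a factor 2. *)
Lemma poly_cauchy_bound P (t : R) : 0 <= t < 1 ->
  nc P.[t%:C] <= cmean (fun x => nc P.[e x] * (2 * (nc (1 - t%:C * e x))^-1)).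
Proof.
move=> tt; have /andP[t0 t1] := tt.
pose Q : {poly R[i]} := \poly_(m < size P) (t%:C ^+ m).
have := poly_pairing_bound P Q.
rewrite (_ : \sum_(i < _) _ = P.[t%:C]); last first.
  rewrite horner_coef; apply: eq_bigr => i _.
  by rewrite coef_poly ltn_ord rmorphXn /= oppr0.
move/le_trans; apply; apply: cmean_le => [||x].
- by apply: continuous_ncM; exact: continuous_nc_poly.
- apply: continuous_ncM; first exact: continuous_nc_poly.
  by apply: continuous_scale; exact: continuous_kernel.
rewrite ler_wpM2l ?nc_ge0//.
rewrite horner_poly; under eq_bigr do rewrite -exprMn.
have tn : nc (t%:C * e x) = t by rewrite Normc.normcM nc_e mulr1 nc_real ger0_norm.
apply: geom_kernel_le; first by rewrite tn ltW.
apply/eqP => h; move: tn; rewrite h Normc.normc1 => h1.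
by move: t1; rewrite -h1 ltxx.
Qed.

Definition dilated_sum a (r : R) n : {poly R[i]} := \poly_(k < n) (a k * r%:C ^+ k).

(** Uniformity on the closed disc is what lets polynomial inequalities on the
    circle pass to dilated power series. *)
Lemma dilated_sum_cvg a f (r d : R) : power_series_in_disc a f -> 0 <= r < 1 ->
  0 < d -> \forall n \near \oo, forall z, nc z <= 1 ->
  nc ((dilated_sum a r n).[z] - f (r%:C * z)) <= d.
Proof.
move=> af /andP[r0 r1] d0.
pose s := (1 + r) / 2; pose q := r / s.
have s0 : 0 < s by rewrite /s; lra.
have s1 : s < 1 by rewrite /s; lra.
have rs : r < s by rewrite /s; lra.
have q0 : 0 <= q by rewrite divr_ge0// ltW.
have q1 : q < 1 by rewrite ltr_pdivrMr// mul1r.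
have [|B B0 aB] := power_series_terms_bounded (s := s) af; first by rewrite ltW.
have aq k : nc (a k) * r ^+ k <= B * q ^+ k.
  rewrite (_ : _ * _ = nc (a k) * s ^+ k * q ^+ k); last first.
    by rewrite -mulrA -exprMn (mulrC s) /q divfK// gt_eqF.
  by rewrite ler_wpM2r// exprn_ge0.
have := @cvg_expr R q; rewrite ger0_norm// => /(_ q1) /cvgn_near.
move=> /(_ (d * (1 - q) / B)); rewrite divr_gt0 ?mulr_gt0 ?subr_gt0// => /(_ isT).
apply: filterS => n; rewrite subr0 ger0_norm ?exprn_ge0// => qn z z1.
have rz : unit_disc (r%:C * z).
  rewrite /unit_disc /mkset Normc.normcM nc_real ger0_norm//.
  by apply: le_lt_trans r1; rewrite ler_piMr.
have /cvgC_near fz := af _ rz.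
apply/ler_addgt0Pr => e' e0.
have [N _ hN] := fz _ e0.
pose m := maxn n N.
apply: le_trans (nc_distD _ (series (fun k => a k * (r%:C * z) ^+ k) m) _) _.
apply: lerD; last by apply/ltW; apply: hN; rewrite /= leq_maxr.
rewrite horner_poly /series /= big_mkord.
have -> : \sum_(i < m) a i * (r%:C * z) ^+ i = \sum_(i < n) a i * (r%:C * z) ^+ i
   + \sum_(n <= i < m) a i * (r%:C * z) ^+ i.
  by rewrite -!(big_mkord xpredT (fun i => a i * (r%:C * z) ^+ i)) -big_cat_nat//= leq_maxl.
rewrite (_ : \sum_(i < n) a i * r%:C ^+ i * z ^+ i = \sum_(i < n) a i * (r%:C * z) ^+ i); last first.
  by apply: eq_bigr => i _; rewrite exprMn mulrA.
rewrite opprD addNKr ncN.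
apply: le_trans (nc_sum _ _ _) _.
apply: (@le_trans _ _ (\sum_(n <= i < m) B * q ^+ i)).
  apply: ler_sum => i _; apply: le_trans (aq i).
  rewrite Normc.normcM ncX Normc.normcM nc_real ger0_norm//.
  rewrite ler_wpM2l ?nc_ge0// lerXn2r// ?nnegrE ?mulr_ge0 ?nc_ge0//.
  by rewrite ler_piMr.
rewrite -mulr_sumr -{1}(add0n n) big_addn.
under eq_bigr do rewrite exprD.
rewrite -mulr_suml big_mkord.
have qq : 0 <= q < 1 by rewrite q0.
have := geom_sum_le (m - n) qq => h.
apply: (@le_trans _ _ (B * ((1 - q)^-1 * (d * (1 - q) / B)))); last first.
  by rewrite (_ : B * _ = d)//; field; rewrite gt_eqF//= subr_eq0 gt_eqF.
rewrite ler_pM2l//; apply: ler_pM => //; rewrite ?exprn_ge0 ?(ltW qn)//.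
by apply: sumr_ge0 => i _; rewrite exprn_ge0.
Qed.

Lemma continuous_nc_analytic f (r : R) : analytic_in_disc f -> 0 <= r < 1 ->
  continuous (fun x => nc (f (circle_point r x))).
Proof.
move=> fa rr x; apply: ccont_nc; apply: ccont_analytic => //.
  exact: circle_point_disc.
exact: ccont_circle_point.
Qed.

Lemma cauchy_bound a f (r t : R) : power_series_in_disc a f -> 0 <= r < 1 ->
  0 <= t < 1 -> nc (f (r * t)%:C) <=
    cmean (fun x => nc (f (circle_point r x)) * (2 * (nc (1 - t%:C * e x))^-1)).
Proof.
move=> af rr tt; have /andP[t0 t1] := tt.
have Kc : continuous (fun x => 2 * (nc (1 - t%:C * e x))^-1).
  by apply: continuous_scale; exact: continuous_kernel.
have fc := continuous_nc_analytic (power_series_analytic af) rr.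
set K := fun x => 2 * _ in Kc *.
have K0 x : 0 <= K x by rewrite mulr_ge0// invr_ge0 nc_ge0.
have cK0 : 0 <= cmean K.
  rewrite -[leLHS](@cmean_cst R 0); apply: cmean_le => //; exact: (fun x => @cvg_cst _ _ _ _ _).
apply/ler_addgt0Pr => d d0.
pose d' := d / (1 + cmean K).
have d'0 : 0 < d' by rewrite divr_gt0// ltr_pwDl.
have [N _ hN] := dilated_sum_cvg af rr d'0.
have {}hN := hN N (leqnn N); set P := dilated_sum a r N in hN.
have ht : nc (P.[t%:C] - f (r * t)%:C) <= d'.
  by rewrite rmorphM; apply: hN; rewrite nc_real ger0_norm// ltW.
have he x : nc P.[e x] <= nc (f (circle_point r x)) + d'.
  have := hN (e x); rewrite nc_e lexx -circle_pointE => /(_ isT) h.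
  by have := nc_sub_le P.[e x] (f (circle_point r x)); lra.
have h1 : cmean (fun x => nc P.[e x] * K x) <=
   cmean (fun x => nc (f (circle_point r x)) * K x + d' * K x).
  apply: cmean_le => [||x].
  - by apply: continuous_ncM => //; exact: continuous_nc_poly.
  - by apply: continuous_add; [exact: continuous_ncM|exact: continuous_scale].
  by rewrite -mulrDl ler_wpM2r.
have h2 : nc P.[t%:C] <= cmean (fun x => nc P.[e x] * K x) := poly_cauchy_bound P tt.
have h3 := nc_sub_le (f (r * t)%:C) P.[t%:C]; rewrite ncB in h3.
rewrite cmeanD ?(cmeanZ d' Kc) in h1; last 2 first.
- exact: continuous_ncM.
- exact: continuous_scale.
rewrite -/(cmean (fun x => nc (f (circle_point r x)) * K x)).
have -> : d = d' + d' * cmean K.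
  by rewrite -[X in X + _]mulr1 -mulrDr /d' divfK// gt_eqF// ltr_pwDl.
have h4 := le_trans h2 h1; move: h3 ht h4.
move: (nc (f _)) (nc P.[_]) (nc (_ - _)) (cmean _) (d' * cmean K) => u1 u2 u3 u4 u5.
by lra.
Qed.

End cauchy.

(** * Hilbert's inequality *)

Section discrete_hilbert.
Variable R : realType.
Implicit Types (x y : nat -> R) (g h : {poly R[i]}).

Local Notation psum y n := (\sum_(j < n) y j).

(** Elliott's telescoping proof of the square summable case of Hardy's
    inequality for averages. *)
Lemma hardy_average y n :
  \sum_(i < n) (psum y i.+1 / i.+1%:R) ^+ 2 <= 4 * \sum_(i < n) y i ^+ 2.
Proof.
pose A i := psum y i.+1 / i.+1%:R.
have H : \sum_(i < n) (A i ^+ 2 - 2 * (A i * y i)) + (psum y n) ^+ 2 / n%:R <= 0.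
  elim: n => [|n IH]; first by rewrite !big_ord0 expr0n mul0r addr0.
  rewrite big_ord_recr /=; apply: le_trans IH.
  rewrite -addrA lerD2l.
  have n1 : n.+1%:R != 0 :> R by rewrite pnatr_eq0.
  have yn : y n = A n * n.+1%:R - psum y n.
    by rewrite /A divfK// big_ord_recr /= addrAC subrr add0r.
  have -> : psum y n.+1 = A n * n.+1%:R by rewrite /A divfK.
  rewrite yn; set a := A n; set s := psum y n.
  have [n0|n0] := posnP n.
    by rewrite /s n0 big_ord0 expr0n /= mul0r -subr_le0; rewrite (_ : _ - _ = 0)//; field.
  have nn : n%:R != 0 :> R by rewrite pnatr_eq0 -lt0n.
  rewrite -subr_le0 (_ : _ - _ = - ((n%:R * a - s) ^+ 2 / n%:R)).
    by rewrite oppr_le0 divr_ge0 ?sqr_ge0.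
  by rewrite -natr1 in n1 *; field; rewrite n1 nn.
have {}H : \sum_(i < n) (A i ^+ 2 - 2 * (A i * y i)) <= 0.
  by apply: le_trans H; rewrite lerDl divr_ge0 ?sqr_ge0.
have H2 : \sum_(i < n) (A i ^+ 2 - 4 * y i ^+ 2) <=
          2 * \sum_(i < n) (A i ^+ 2 - 2 * (A i * y i)).
  rewrite mulr_sumr; apply: ler_sum => i _.
  rewrite -subr_ge0 (_ : _ - _ = (A i - 2 * y i) ^+ 2) ?sqr_ge0//; ring.
rewrite mulr_sumr -subr_le0 -sumrB; apply: (le_trans H2).
by rewrite pmulr_rle0.
Qed.

Lemma half_hilbert x y n : (forall i, 0 <= x i) -> (forall i, 0 <= y i) ->
  \sum_(i < n) \sum_(j < n | (j <= i)%N) x i * y j / i.+1%:R <=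
  (\sum_(i < n) x i ^+ 2) / 2 + 2 * \sum_(i < n) y i ^+ 2.
Proof.
move=> x0 y0.
have h := hardy_average y n.
apply: (@le_trans _ _ ((\sum_(i < n) x i ^+ 2) / 2 +
   (\sum_(i < n) (psum y i.+1 / i.+1%:R) ^+ 2) / 2)); last by lra.
rewrite !mulr_suml -big_split /=; apply: ler_sum => i _.
have -> : \sum_(j < n | (j <= i)%N) x i * y j / i.+1%:R = x i * (psum y i.+1 / i.+1%:R).
  rewrite (big_ord_widen n y (ltn_ord i)) mulrA mulr_sumr mulr_suml.
  by apply: eq_bigl => j; rewrite ltnS.
set a := _ / _; rewrite -subr_ge0 (_ : _ - _ = (x i - a) ^+ 2 / 2).
  by rewrite divr_ge0 ?sqr_ge0.
by field.
Qed.

(** Hilbert's inequality, with a constant that is not the best possible: each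
    half of the matrix is dominated by an averaging operator. *)
Lemma discrete_hilbert x y n : (forall i, 0 <= x i) -> (forall i, 0 <= y i) ->
  \sum_(i < n) \sum_(j < n) x i * y j / (i + j).+1%:R <=
  5 / 2 * (\sum_(i < n) x i ^+ 2 + \sum_(i < n) y i ^+ 2).
Proof.
move=> x0 y0; have h1 := half_hilbert n x0 y0; have h2 := half_hilbert n y0 x0.
apply: (@le_trans _ _ (
  \sum_(i < n) \sum_(j < n | (j <= i)%N) x i * y j / i.+1%:R +
  \sum_(i < n) \sum_(j < n | (j <= i)%N) y i * x j / i.+1%:R)); last by lra.
rewrite [X in _ + X](exchange_big_dep predT)//= -big_split /=.
apply: ler_sum => i _; rewrite [X in X + _]big_mkcond [X in _ + X]big_mkcond -big_split /=.
apply: ler_sum => j _.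
have le k l : (k <= l)%N -> x i * y j / l.+1%:R <= x i * y j / k.+1%:R.
  by move=> kl; rewrite ler_wpM2l ?mulr_ge0// lef_pV2 ?posrE// ler_nat.
have pos k : 0 <= x i * y j / k.+1%:R by rewrite divr_ge0// mulr_ge0.
rewrite (mulrC (y j)); case: (leqP j i) => ji.
  by apply: ler_wpDr; [case: ifP|apply: le; rewrite leq_addr].
by rewrite (ltnW ji) add0r; apply: le; rewrite leq_addl.
Qed.

(** The weight [1 / (k + 1)] in the coefficient of order [k = i + j] of a product is
    the entry of Hilbert's matrix. *)
Lemma coef_mul_hardy g h M (N := maxn (size g) (size h)) :
  \sum_(k < M) nc (g * h)`_k / k.+1%:R <=
  \sum_(i < N) \sum_(j < N) nc g`_i * nc h`_j / (i + j).+1%:R.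
Proof.
have E k : (g * h)`_k = \sum_(i < N) \sum_(j < N) (g`_i * h`_j) *+ (i + j == k)%N.
  have ex (p : {poly R[i]}) : (size p <= N)%N -> p = \poly_(i < N) p`_i.
    move=> pN; apply/polyP => i; rewrite coef_poly; case: ltnP => // Ni.
    by rewrite nth_default// (leq_trans pN).
  rewrite [in LHS](ex g) ?leq_maxl// [in LHS](ex h) ?leq_maxr// !poly_def.
  rewrite mulr_suml coef_sum; apply: eq_bigr => i _.
  rewrite mulr_sumr coef_sum; apply: eq_bigr => j _.
  rewrite -scalerAl -scalerAr scalerA -exprD coefZ coefXn eq_sym mulr_natr.
  by [].
apply: (@le_trans _ _ (\sum_(k < M) \sum_(i < N) \sum_(j < N)
   (nc g`_i * nc h`_j / (i + j).+1%:R) *+ (i + j == k)%N)).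
  apply: ler_sum => k _; rewrite E.
  apply: (@le_trans _ _ ((\sum_(i < N) \sum_(j < N) nc (g`_i * h`_j *+ (i + j == k)%N)) / k.+1%:R)).
    rewrite ler_pM2r ?invr_gt0//; apply: le_trans (nc_sum _ _ _) _.
    by apply: ler_sum => i _; exact: nc_sum.
  rewrite mulr_suml; apply: ler_sum => i _; rewrite mulr_suml; apply: ler_sum => j _.
  by case: eqP => [->|_]; rewrite ?mulr1n ?mulr0n ?Normc.normcM ?Normc.normc0 ?mul0r.
rewrite exchange_big /=; apply: ler_sum => i _.
rewrite exchange_big /=; apply: ler_sum => j _.
have t0 : 0 <= nc g`_i * nc h`_j / (i + j).+1%:R.
  by rewrite divr_ge0// mulr_ge0// nc_ge0.
have [ij|ij] := ltnP (i + j) M.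
  rewrite (bigD1 (Ordinal ij))//= eqxx mulr1n big1 ?addr0// => k /negbTE kij.
  by rewrite eq_sym -[(k == (i + j)%N :> nat)]/(k == Ordinal ij) kij.
rewrite big1// => k _; case: eqP => // ijk.
by move: ij; rewrite ijk leqNgt ltn_ord.
Qed.

End discrete_hilbert.

(** * Approximate square roots of polynomials on the circle *)

Section square_root_factorization.
Variable R : realType.
Implicit Types (f g h q : {poly R[i]}) (z v w : R[i]).

(** The fixed point of [w |-> (v z + w ^ 2) / 2] is [1 - sqrt (1 - v z)]. *)
Fixpoint sqrt_iter v n : {poly R[i]} :=
  if n is m.+1 then 2^-1 *: (v *: 'X + sqrt_iter v m ^+ 2) else 0.

Fixpoint sqrt_majorant n : R :=
  if n is m.+1 then (1 + sqrt_majorant m ^+ 2) / 2 else 0.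

Lemma sqrt_majorant_bounds n : 0 <= sqrt_majorant n <= 1.
Proof.
elim: n => [|n /andP[h0 h1]] /=; first by rewrite lexx ler01.
have : sqrt_majorant n ^+ 2 <= 1 by rewrite expr_le1.
by have := sqr_ge0 (sqrt_majorant n); lra.
Qed.

Lemma sqrt_majorant_step n :
  sqrt_majorant n.+1 - sqrt_majorant n = (1 - sqrt_majorant n) ^+ 2 / 2.
Proof. by rewrite /=; field. Qed.

(** The increments of the majorant decrease and sum to at most 1. *)
Lemma sqrt_majorant_gap n :
  n.+1%:R * (sqrt_majorant n.+1 - sqrt_majorant n) <= 1.
Proof.
have mono m : sqrt_majorant m.+2 - sqrt_majorant m.+1 <= sqrt_majorant m.+1 - sqrt_majorant m.
  have /andP[a0 a1] := sqrt_majorant_bounds m.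
  have /andP[b0 b1] := sqrt_majorant_bounds m.+1.
  have st : sqrt_majorant m <= sqrt_majorant m.+1.
    by rewrite -subr_ge0 sqrt_majorant_step divr_ge0 ?sqr_ge0.
  rewrite !sqrt_majorant_step ler_pM2r ?invr_gt0// lerXn2r ?nnegrE ?subr_ge0//.
  by rewrite lerD2l lerN2.
have : n.+1%:R * (sqrt_majorant n.+1 - sqrt_majorant n) <= sqrt_majorant n.+1.
  elim: n => [|n IH]; first by rewrite mul1r subr0.
  rewrite -natr1 mulrDl mul1r.
  have : n.+1%:R * (sqrt_majorant n.+2 - sqrt_majorant n.+1) <=
         n.+1%:R * (sqrt_majorant n.+1 - sqrt_majorant n) by rewrite ler_wpM2l.
  by lra.
by have /andP[_ +] := sqrt_majorant_bounds n.+1; lra.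
Qed.

Lemma half_nc : nc (2^-1 : R[i]) = 2^-1.
Proof. by rewrite Normc.normcV nc_nat. Qed.

(** The iteration is dominated termwise by the same iteration at [v = z = 1],
    which is increasing; hence it converges uniformly, to [1 - sqrt(1 - v z)]. *)
Lemma sqrt_iter_majorized v z n : nc v <= 1 -> nc z <= 1 ->
  nc (sqrt_iter v n).[z] <= sqrt_majorant n /\
  nc ((sqrt_iter v n.+1).[z] - (sqrt_iter v n).[z]) <=
    sqrt_majorant n.+1 - sqrt_majorant n.
Proof.
move=> v1 z1; have vz : nc (v * z) <= 1.
  by rewrite Normc.normcM mulr_ile1 ?nc_ge0.
have E m : (sqrt_iter v m.+1).[z] = 2^-1 * (v * z + (sqrt_iter v m).[z] ^+ 2).
  by rewrite /= !hornerE.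
have B m : nc (sqrt_iter v m).[z] <= sqrt_majorant m.
  elim: m => [|m IH]; first by rewrite /= horner0 Normc.normc0.
  rewrite E Normc.normcM half_nc /= mulrC ler_pM2r ?invr_gt0//.
  apply: le_trans (ncD _ _) _; rewrite lerD// ncX.
  by rewrite lerXn2r// nnegrE ?nc_ge0//; case/andP: (sqrt_majorant_bounds m).
split=> //; elim: n => [|n IH].
  rewrite E /= horner0 expr0n /= !addr0 !subr0 Normc.normcM half_nc.
  by rewrite expr0n /= addr0 mulrC ler_pM2r ?invr_gt0.
rewrite [X in nc (X - _)]E [X in nc (_ - X)]E -mulrBr Normc.normcM half_nc.
rewrite (_ : _ - _ = ((sqrt_iter v n.+1).[z] - (sqrt_iter v n).[z]) *
  ((sqrt_iter v n.+1).[z] + (sqrt_iter v n).[z])); last by ring.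
have -> : sqrt_majorant n.+2 - sqrt_majorant n.+1 =
  2^-1 * ((sqrt_majorant n.+1 - sqrt_majorant n) * (sqrt_majorant n.+1 + sqrt_majorant n)).
  have S m : sqrt_majorant m.+1 = (1 + sqrt_majorant m ^+ 2) / 2 by [].
  by rewrite (S n.+1) [X in _ - X]S; field.
rewrite Normc.normcM ler_pM2l ?invr_gt0//; apply: ler_pM => //; try exact: nc_ge0.
by apply: le_trans (ncD _ _) _; exact: lerD.
Qed.

(** The defect of the approximate square root is twice an increment of the
    iteration. *)
Lemma sqrt_approx v (d : R) : nc v <= 1 -> 0 < d -> exists q, forall z, nc z <= 1 ->
  nc (q.[z] ^+ 2 - (1 - v * z)) <= d.
Proof.
move=> v1 d0.
have d2 : 0 < d / 2 by rewrite divr_gt0.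
have [n _ /(_ n (leqnn n)) /= hn] := near_infty_natSinv_lt (PosNum d2).
exists (1 - sqrt_iter v n) => z z1.
have [_ h] := sqrt_iter_majorized n v1 z1.
rewrite hornerD hornerN hornerC.
rewrite (_ : _ - _ = 2 * ((sqrt_iter v n.+1).[z] - (sqrt_iter v n).[z])); last first.
  by rewrite /= !hornerE; field.
rewrite Normc.normcM nc_nat.
have g := sqrt_majorant_gap n.
have : sqrt_majorant n.+1 - sqrt_majorant n <= n.+1%:R^-1.
  by rewrite -[leRHS]mul1r ler_pdivlMr// mulrC.
move=> k; have := le_lt_trans (le_trans h k) hn.
by rewrite ltr_pdivlMr// mulrC => /ltW.
Qed.

(** An approximate factorization on the circle into two factors of modulus at
    most the square root of [|f|]. Unlike an exact square root, it exists for every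
    polynomial and is preserved by products. *)
Definition balanced f := forall d : R, 0 < d -> exists g h, forall z, nc z = 1 ->
  [/\ nc (f.[z] - g.[z] * h.[z]) <= d, nc g.[z] ^+ 2 <= nc f.[z] + d &
      nc h.[z] ^+ 2 <= nc f.[z] + d].

Lemma poly_bounded_on_circle f : exists2 M : R, 0 < M & forall z, nc z = 1 -> nc f.[z] <= M.
Proof.
exists (1 + \sum_(i < size f) nc f`_i).
  by rewrite ltr_pwDl// sumr_ge0// => i _; exact: nc_ge0.
move=> z z1; rewrite horner_coef; apply: le_trans (nc_sum _ _ _) _.
apply: (@le_trans _ _ (\sum_(i < size f) nc f`_i)); last by lra.
by apply: ler_sum => i _; rewrite Normc.normcM ncX z1 expr1n mulr1.
Qed.

Lemma balanced_cst (c : R[i]) : balanced c%:P.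
Proof.
move=> d d0; exists (sqrtc c)%:P, (sqrtc c)%:P => z z1; rewrite !hornerC.
have E : sqrtc c * sqrtc c = c by rewrite -expr2 sqr_sqrtc.
rewrite E subrr Normc.normc0 ltW//; split=> //.
all: by rewrite expr2 -Normc.normcM E lerDl ltW.
Qed.

Lemma balancedM f1 f2 : balanced f1 -> balanced f2 -> balanced (f1 * f2).
Proof.
move=> b1 b2 d d0.
have [M1 M10 hM1] := poly_bounded_on_circle f1.
have [M2 M20 hM2] := poly_bounded_on_circle f2.
pose M := M1 + M2 + 2.
have M0 : 0 < M by rewrite /M; lra.
pose d' := Num.min 1 (d / (2 * M)).
have d'0 : 0 < d' by rewrite /d' lt_min ltr01 divr_gt0// mulr_gt0.
have d'1 : d' <= 1 by rewrite /d' ge_min lexx.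
have d'd : d' * (2 * M) <= d.
  by rewrite -ler_pdivlMr ?mulr_gt0// /d' ge_min lexx orbT.
have [g1 [h1 H1]] := b1 _ d'0; have [g2 [h2 H2]] := b2 _ d'0.
exists (g1 * g2), (h1 * h2) => z z1; rewrite !hornerM.
have [a1 a2 a3] := H1 _ z1; have [e1 e2 e3] := H2 _ z1.
have m1 := hM1 _ z1; have m2 := hM2 _ z1.
have n1 := nc_ge0 f1.[z]; have n2 := nc_ge0 f2.[z].
have sq (x1 x2 : R[i]) : nc x1 ^+ 2 <= nc f1.[z] + d' -> nc x2 ^+ 2 <= nc f2.[z] + d' ->
   nc (x1 * x2) ^+ 2 <= nc (f1.[z] * f2.[z]) + d.
  move=> k1 k2; rewrite !Normc.normcM exprMn.
  apply: (@le_trans _ _ ((nc f1.[z] + d') * (nc f2.[z] + d'))).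
    by apply: ler_pM => //; exact: sqr_ge0.
  rewrite /M in d'd; nra.
split; [|exact: sq|exact: sq].
rewrite (_ : _ - _ = f1.[z] * (f2.[z] - g2.[z] * h2.[z]) +
  (f2.[z] - (f2.[z] - g2.[z] * h2.[z])) * (f1.[z] - g1.[z] * h1.[z])); last by ring.
apply: le_trans (ncD _ _) _; rewrite !Normc.normcM.
have k := ncD f2.[z] (- (f2.[z] - g2.[z] * h2.[z])); rewrite ncN in k.
have p1 : nc f1.[z] * nc (f2.[z] - g2.[z] * h2.[z]) <= M1 * d'.
  by apply: ler_pM => //; exact: nc_ge0.
have p2 : nc (f2.[z] - (f2.[z] - g2.[z] * h2.[z])) * nc (f1.[z] - g1.[z] * h1.[z]) <= (M2 + 1) * d'.
  by apply: ler_pM; rewrite ?nc_ge0//; lra.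
rewrite /M in d'd; nra.
Qed.

Lemma balanced_outer v : nc v <= 1 -> balanced (1 - v *: 'X).
Proof.
move=> v1 d d0; have [q hq] := sqrt_approx v1 d0.
exists q, q => z z1; have {}hq := hq z; rewrite z1 lexx in hq; have {}hq := hq isT.
rewrite !hornerE ncB -expr2.
have k : nc q.[z] ^+ 2 <= nc (1 - v * z) + d.
  by rewrite -ncX; have := nc_sub_le (q.[z] ^+ 2) (1 - v * z); lra.
by split.
Qed.

Lemma conj_reflection w z : nc z = 1 -> nc (z - w) = nc (1 - conjc w * z).
Proof.
move=> z1; have zz : conjc z * z = 1.
  have := nc_sqrE z; rewrite z1 expr1n => h; rewrite mulrC.
  have : Im (z * conjc z) = 0 by case: (z) => a b /=; ring.
  by case: (z * conjc z) h => a b /= -> ->.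
rewrite -[RHS]mul1r -z1 -(nc_conj z) -Normc.normcM.
rewrite -(nc_conj (z - w)); congr nc; rewrite rmorphB /=.
by rewrite mulrBr mulr1 mulrCA zz mulr1.
Qed.

(** A zero inside the disc is moved across the circle, as by a Blaschke factor;
    the geometric sum stands for the inverse of [1 - conj(w) z]. *)
Lemma balanced_inner w : nc w < 1 -> balanced ('X - w%:P).
Proof.
move=> w1 d d0.
have w0 := nc_ge0 w.
pose B := (1 - nc w)^-1.
have B0 : 0 < B by rewrite invr_gt0 subr_gt0.
pose d' := Num.min 1 (d / (4 * (2 * B + 4))).
have d'0 : 0 < d' by rewrite /d' lt_min ltr01 divr_gt0//; lra.
have d'1 : d' <= 1 by rewrite /d' ge_min lexx.
have d'd : d' * (4 * (2 * B + 4)) <= d.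
  by rewrite -ler_pdivlMr; [rewrite /d' ge_min lexx orbT|lra].
have cw : nc (conjc w) <= 1 by rewrite nc_conj ltW.
have [q hq] := sqrt_approx cw d'0.
have := @cvg_expr R (nc w); rewrite ger0_norm// => /(_ w1) /cvgn_near /(_ _ d'0).
case=> N _ /(_ N (leqnn N)); rewrite /= subr0 ger0_norm ?exprn_ge0// => hN.
pose u : {poly R[i]} := \poly_(j < N) (conjc w ^+ j).
exists (('X - w%:P) * u * q), q => z z1.
have {}hq := hq z; rewrite z1 lexx in hq; have {}hq := hq isT.
rewrite !hornerM hornerXsubC.
have uz : u.[z] * (1 - conjc w * z) = 1 - (conjc w * z) ^+ N.
  rewrite /u horner_poly; under eq_bigr do rewrite -exprMn.
  by rewrite mulrC -opprB mulNr -subrX1 opprB.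
have wn : nc ((conjc w * z) ^+ N) <= d'.
  by rewrite ncX Normc.normcM nc_conj z1 mulr1 ltW.
have uB : nc u.[z] <= B.
  rewrite /u horner_poly; apply: le_trans (nc_sum _ _ _) _.
  apply: (@le_trans _ _ (\sum_(i < N) nc w ^+ i)).
    by apply: ler_sum => i _; rewrite Normc.normcM !ncX z1 expr1n mulr1 nc_conj.
  by apply: geom_sum_le; rewrite w0.
have zw := conj_reflection w z1.
have zw2 : nc (z - w) <= 2 by apply: le_trans (ncD _ _) _; rewrite ncN; lra.
have zw0 := nc_ge0 (z - w).
have kq : nc q.[z] ^+ 2 <= nc (z - w) + d'.
  by rewrite zw -ncX; have := nc_sub_le (q.[z] ^+ 2) (1 - conjc w * z); lra.
have du : d' <= d by nra.
have uzw : nc u.[z] * nc (z - w) <= 1 + d'.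
  by rewrite zw -Normc.normcM uz; apply: le_trans (ncD _ _) _; rewrite Normc.normc1 ncN lerD2l.
have u0 := nc_ge0 u.[z].
split; last by lra.
- rewrite (_ : _ - _ = (z - w) * (conjc w * z) ^+ N +
     (z - w) * (u.[z] * ((1 - conjc w * z) - q.[z] ^+ 2))); last first.
    by rewrite (mulrBr u.[z]) uz; ring.
  apply: le_trans (ncD _ _) _; rewrite !Normc.normcM (ncB (1 - _)).
  have p1 : nc (z - w) * nc ((conjc w * z) ^+ N) <= 2 * d' by apply: ler_pM; rewrite ?nc_ge0.
  have p2 : nc u.[z] * nc (q.[z] ^+ 2 - (1 - conjc w * z)) <= B * d' by apply: ler_pM; rewrite ?nc_ge0.
  have p3 : nc (z - w) * (nc u.[z] * nc (q.[z] ^+ 2 - (1 - conjc w * z))) <= 2 * (B * d').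
    by apply: ler_pM; rewrite ?mulr_ge0 ?nc_ge0.
  by nra.
rewrite !Normc.normcM !exprMn -exprMn (mulrC (nc (z - w))).
apply: (@le_trans _ _ ((1 + d') ^+ 2 * (nc (z - w) + d'))).
  apply: ler_pM; rewrite ?sqr_ge0// lerXn2r// nnegrE ?mulr_ge0//; lra.
have : (1 + d') ^+ 2 <= 1 + 3 * d' by nra.
nra.
Qed.

(** Over an algebraically closed field only linear factors remain; those with a
    zero outside the open disc have a square root there. *)
Lemma balanced_poly f : balanced f.
Proof.
have [r ->] := closed_field_poly_normal f.
rewrite -mul_polyC; apply: balancedM; first exact: balanced_cst.
elim: r => [|w r IH]; first by rewrite big_nil -polyC1; exact: balanced_cst.
rewrite big_cons; apply: balancedM IH.
have [w1|w1] := ltP (nc w) 1; first exact: balanced_inner.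
have w0 : w != 0 by apply: contraTneq w1 => ->; rewrite Normc.normc0 -ltNge.
rewrite (_ : 'X - w%:P = (- w)%:P * (1 - w^-1 *: 'X)).
  apply: balancedM; first exact: balanced_cst.
  by apply: balanced_outer; rewrite Normc.normcV invf_le1// (lt_le_trans _ w1).
rewrite mulrBr mulr1 mul_polyC scalerA mulNr mulfV// scaleN1r opprK addrC.
by rewrite polyCN.
Qed.

End square_root_factorization.

(** * Hardy's inequality *)

Section hardy_inequality.
Variable R : realType.
Implicit Types (P : {poly R[i]}) (a : nat -> R[i]) (f : R[i] -> R[i]).

Local Notation e := (circle_point (1 : R)).

Lemma coef_le_cmean P k : nc P`_k <= cmean (fun x => nc P.[e x]).
Proof.
have [kP|kP] := ltnP k (size P); last first.
  rewrite nth_default// Normc.normc0 -[leLHS](@cmean_cst R).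
  apply: cmean_le => [x||x]; [exact: cvg_cst|exact: continuous_nc_poly|exact: nc_ge0].
have := poly_pairing_bound P 'X^k.
rewrite (bigD1 (Ordinal kP))//= big1 => [|i /negbTE ik]; last first.
  by rewrite coefXn -[(i == k :> nat)]/(i == Ordinal kP) ik conjc0 mulr0.
rewrite addr0 coefXn eqxx conjc1 mulr1 => /le_trans; apply.
rewrite le_eqVlt; apply/orP; left; apply/eqP; congr cmean; apply/funext => x.
by rewrite hornerXn ncX nc_e expr1n mulr1.
Qed.

Lemma sum_sqr_coef_le P N : (size P <= N)%N ->
  \sum_(i < N) nc P`_i ^+ 2 <= cmean (fun x => nc P.[e x] ^+ 2).
Proof.
move=> PN; rewrite poly_parseval (big_ord_widen _ (fun i => nc P`_i ^+ 2) PN).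
rewrite [leRHS]big_mkcond /=; apply: ler_sum => i _; case: ltnP => // iP.
by rewrite nth_default// Normc.normc0 expr0n.
Qed.

(** Hardy's inequality for a product of two polynomials is Hilbert's inequality
    for their coefficients; a polynomial is such a product up to a small error,
    with factors of equal modulus on the circle. *)
Lemma hardy_poly P M :
  \sum_(k < M) nc P`_k / k.+1%:R <= 5 * cmean (fun x => nc P.[e x]).
Proof.
apply/ler_addgt0Pr => d d0.
pose d' := d / (M%:R + 5).
have M5 : 0 < M%:R + 5 :> R by rewrite ltr_wpDl.
have d'0 : 0 < d' by rewrite divr_gt0.
have [g [h gh]] := balanced_poly P d'0.
set N := maxn (size g) (size h).
have sq (q : {poly R[i]}) : (size q <= N)%N -> (forall z, nc z = 1 -> nc q.[z] ^+ 2 <= nc P.[z] + d') ->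
    \sum_(i < N) nc q`_i ^+ 2 <= cmean (fun x => nc P.[e x]) + d'.
  move=> qN qd; rewrite -[X in _ + X](@cmean_cst R) -cmeanD; last 2 first.
  - exact: continuous_nc_poly.
  - by move=> x; exact: cvg_cst.
  apply: le_trans (sum_sqr_coef_le qN) _.
  apply: cmean_le => [||x].
  - by apply: (@continuous_ncM R); exact: continuous_nc_poly.
  - by apply: continuous_add; [exact: continuous_nc_poly|move=> x; exact: cvg_cst].
  by apply: qd; exact: nc_e.
have sg := sq g (leq_maxl _ _) (fun z z1 => let: And3 _ k _ := gh z z1 in k).
have sh := sq h (leq_maxr _ _) (fun z z1 => let: And3 _ _ k := gh z z1 in k).
have dk k : nc (P - g * h)`_k <= d'.
  apply: le_trans (coef_le_cmean _ k) _; rewrite -[leRHS](@cmean_cst R).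
  apply: cmean_le => [||x]; [exact: continuous_nc_poly|by move=> x; exact: cvg_cst|].
  by rewrite hornerD hornerN hornerM; have [+ _ _] := gh _ (nc_e x).
have H1 := coef_mul_hardy g h M; rewrite -/N in H1.
have H2 := @discrete_hilbert R (fun i => nc g`_i) (fun i => nc h`_i) N
  (fun=> nc_ge0 _) (fun=> nc_ge0 _).
have H3 : \sum_(k < M) nc P`_k / k.+1%:R <=
    \sum_(k < M) nc (g * h)`_k / k.+1%:R + \sum_(k < M) d'.
  rewrite -big_split /=; apply: ler_sum => k _.
  apply: (@le_trans _ _ ((nc (g * h)`_k + d') / k.+1%:R)).
    rewrite ler_pM2r ?invr_gt0//.
    have := dk k; rewrite coefB; have := nc_sub_le P`_k (g * h)`_k; lra.
  rewrite mulrDl lerD2l ler_pdivrMr// -[leLHS]mulr1 ler_pM2l//.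
  by rewrite ler1n.
rewrite sumr_const card_ord -mulr_natr in H3.
have dE : d = d' * M%:R + 5 * d' by rewrite /d'; field; rewrite gt_eqF.
have H4 := le_trans H1 H2; rewrite dE; clear -H3 H4 sg sh; lra.
Qed.

Lemma hardy_dilated a f (r : R) M : power_series_in_disc a f -> 0 <= r < 1 ->
  \sum_(k < M) nc (a k) * r ^+ k / k.+1%:R <=
  5 * cmean (fun x => nc (f (circle_point r x))).
Proof.
move=> af rr; have /andP[r0 r1] := rr; apply/ler_addgt0Pr => d d0.
have d5 : 0 < d / 5 by rewrite divr_gt0.
have [N _ hN] := dilated_sum_cvg af rr d5.
have {}hN := hN (maxn N M) (leq_maxl _ _); set P := dilated_sum a r _ in hN.
have fc := continuous_nc_analytic (power_series_analytic af) rr.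
have h1 : cmean (fun x => nc P.[e x]) <= cmean (fun x => nc (f (circle_point r x))) + d / 5.
  rewrite -[X in _ + X](@cmean_cst R) -cmeanD//; last by move=> x; exact: cvg_cst.
  apply: cmean_le => [||x].
  - exact: continuous_nc_poly.
  - by apply: continuous_add => // x; exact: cvg_cst.
  have := hN (e x); rewrite nc_e lexx -circle_pointE => /(_ isT).
  by have := nc_sub_le P.[e x] (f (circle_point r x)); lra.
have h2 := hardy_poly P M.
rewrite (_ : \sum_(k < M) _ = \sum_(k < M) nc P`_k / k.+1%:R); last first.
  apply: eq_bigr => k _; rewrite coef_poly (leq_trans (ltn_ord k)) ?leq_maxr//.
  by rewrite Normc.normcM ncX nc_real ger0_norm.
by lra.
Qed.

(** The dilations tend to the circle; as only [M] coefficients are involved,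
    Bernoulli's inequality for [(1 - y) ^ M] controls what is lost. *)
Lemma hardy_inequality a f (B : R) M : power_series_in_disc a f ->
  (forall r, 0 < r < 1 -> cmean (fun x => nc (f (circle_point r x))) <= B) ->
  \sum_(k < M) nc (a k) / k.+1%:R <= 5 * B.
Proof.
move=> af fB; set S := \sum_(k < M) _.
have S0 : 0 <= S by apply: sumr_ge0 => k _; rewrite divr_ge0 ?nc_ge0.
apply/ler_addgt0Pr => d d0.
pose y := Num.min 2^-1 (d / (M%:R * S + 1)).
have MS : 0 < M%:R * S + 1 by rewrite ltr_wpDl// mulr_ge0.
have y0 : 0 < y by rewrite /y lt_min invr_gt0 ltr0n divr_gt0.
have y1 : y <= 2^-1 by rewrite /y ge_min lexx.
have yd : y * (M%:R * S + 1) <= d by rewrite -ler_pdivlMr// /y ge_min lexx orbT.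
have rr : 0 < 1 - y < 1 by lra.
have r0 : 0 <= 1 - y by lra.
have h1 := fB _ rr.
have rr' : 0 <= 1 - y < 1 by lra.
have h2 := hardy_dilated M af rr'.
have h3 : (1 - y) ^+ M * S <= \sum_(k < M) nc (a k) * (1 - y) ^+ k / k.+1%:R.
  rewrite mulr_sumr; apply: ler_sum => k _; rewrite mulrC mulrAC.
  rewrite ler_wpM2r ?invr_ge0// ler_wpM2l ?nc_ge0//.
  by rewrite ler_wiXn2l ?(ltnW (ltn_ord k))//; lra.
have yy1 : 0 <= y <= 1 by lra.
have h4 : (1 - M%:R * y) * S <= (1 - y) ^+ M * S by rewrite ler_wpM2r ?bernoulli_le.
have yy : y * (M%:R * S + 1) = M%:R * y * S + y by ring.
rewrite yy in yd; rewrite mulrBl mul1r in h4; lra.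
Qed.

End hardy_inequality.

(** * Integrating functions of a distance, scale by scale *)

Section dyadic.
Variable R : realType.
Implicit Types (y d : R).

Lemma dyadic_scale y d : 0 < y -> y <= d ->
  exists j, 2 ^+ j * y <= d < 2 ^+ j.+1 * y.
Proof.
move=> y0 yd.
have ex : exists n, d < 2 ^+ n * y.
  exists (Num.truncn (d / y)).+1; rewrite -ltr_pdivrMr//.
  apply: (lt_trans (truncnS_gt _)).
  by rewrite -natrX ltr_nat ltn_expl.
case: (ex_minnP ex) => n hn hmin; case: n hn hmin => [|j] hn hmin.
  by move: hn; rewrite expr0 mul1r ltNge yd.
exists j; rewrite hn andbT leNgt; apply/negP => /hmin.
by rewrite ltnn.
Qed.

Lemma measurable_inv_ge0 dd (T : measurableType dd) (F : T -> R) :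
  measurable_fun setT F -> (forall x, 0 <= F x) ->
  measurable_fun setT (fun x => (F x)^-1).
Proof.
move=> mF F0; rewrite (_ : (fun x => _) = (fun x => F x `^ (-1))).
  exact: (@measurableT_comp _ _ _ _ _ _ _ _ _ (measurable_powR (-1)) mF).
by apply/funext => x; rewrite powR_inv1.
Qed.

End dyadic.

Section carleson_integrals.
Context dd (T : measurableType dd) (R : realType).
Variables (m : {measure set T -> \bar R}) (D : set T) (d : T -> R).
Hypotheses (mD : measurable D) (md : measurable_fun setT d).
Lemma measurable_sublevel (s : R) : measurable [set x | d x <= s].
Proof.
rewrite (_ : [set x | _] = d @^-1` `]-oo, s]).
  by rewrite -[X in measurable X]setTI; exact: md.
by apply/seteqP; split => x /=; rewrite in_itv.
Qed.

(** Summation over the dyadic scales, by monotone convergence. There are two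
    families of scales because distances below and above a threshold [y] obey
    different bounds in the weighted kernel. *)
Lemma dyadic_integral_mass (F : T -> R) (c1 s1 M1 c2 s2 M2 : nat -> R) (K : R) :
  measurable_fun setT F -> (forall x, 0 <= F x) ->
  (forall j, 0 <= c1 j) -> (forall j, 0 <= c2 j) ->
  (forall j, (m (D `&` [set x | (d x <= s1 j)%R]) <= (M1 j)%:E)%E) ->
  (forall j, (m (D `&` [set x | (d x <= s2 j)%R]) <= (M2 j)%:E)%E) ->
  (forall x, D x -> exists j, (F x <= c1 j /\ d x <= s1 j) \/
                              (F x <= c2 j /\ d x <= s2 j)) ->
  (forall n, \sum_(j < n) (c1 j * M1 j + c2 j * M2 j) <= K) ->
  (\int[m]_(x in D) (F x)%:E <= K%:E)%E.
Proof.
move=> mF F0 c10 c20 m1 m2 hF hK.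
pose G (c s : nat -> R) j x : \bar R := ((c j)%:E * (\1_[set x | d x <= s j] x)%:E)%E.
have mG c s j A : measurable_fun A (G c s j).
  apply/measurable_funeM/measurable_EFinP; apply/measurable_funTS.
  by apply: measurable_indic; exact: measurable_sublevel.
have G0 c s j x : (forall j, 0 <= c j) -> (0 <= G c s j x)%E.
  by move=> c0; rewrite /G -EFinM lee_fin mulr_ge0// indicE.
have iG c s M j : (forall j, 0 <= c j) ->
    (m (D `&` [set x | (d x <= s j)%R]) <= (M j)%:E)%E ->
    (\int[m]_(x in D) G c s j x <= (c j * M j)%:E)%E.
  move=> c0 sM; rewrite ge0_integralZl//; last first.
  - by rewrite lee_fin.
  - apply/measurable_EFinP; apply/measurable_funTS.
    by apply: measurable_indic; exact: measurable_sublevel.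
  rewrite integral_indic//; last exact: measurable_sublevel.
  rewrite EFinM; apply: lee_wpmul2l; first by rewrite lee_fin.
  by rewrite setIC.
pose H j x := (G c1 s1 j x + G c2 s2 j x)%E.
have H0 j x : (0 <= H j x)%E by rewrite /H adde_ge0// G0.
have mH j : measurable_fun D (H j) by apply: emeasurable_funD; exact: mG.
apply: (@le_trans _ _ (\int[m]_(x in D) (\sum_(0 <= j <oo) H j x))%E).
  apply: ge0_le_integral => //.
  - by move=> x _; rewrite lee_fin.
  - by apply/measurable_EFinP; exact: measurable_funTS.
  - by apply: ge0_emeasurable_sum => // j x _ _; exact: H0.
  move=> x Dx; have [j hj] := hF x Dx.
  have h1 : ((F x)%:E <= H j x)%E.
    rewrite /H /G -!EFinM -EFinD lee_fin !indicE.
    case: hj => -[a b].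
      rewrite mem_set//= mulr1; apply: ler_wpDr => //; exact: mulr_ge0.
    have -> : x \in [set x | d x <= s2 j] by rewrite mem_set.
    by rewrite mulr1; apply: ler_wpDl => //; exact: mulr_ge0.
  apply: (le_trans h1); apply: le_trans (nneseries_lim_ge j.+1 _) => //.
  by rewrite big_nat_recr//= leeDr// sume_ge0.
rewrite integral_nneseries//.
apply: lime_le; first by apply: is_cvg_nneseries => n _ _; apply: integral_ge0.
near=> n; rewrite big_mkord.
apply: (@le_trans _ _ (\sum_(j < n) (c1 j * M1 j + c2 j * M2 j)%:E)%E).
  apply: lee_sum => j _; rewrite /H ge0_integralD//; try by move=> x _; exact: G0.
  by rewrite EFinD; apply: leeD; exact: iG.
by rewrite sumEFin lee_fin.
Unshelve. all: by end_near. Qed.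

Variable C : R.
Hypothesis d_ge0 : forall x, 0 <= d x.
Hypothesis d_gt0 : forall x, D x -> 0 < d x.
Hypothesis C_ge0 : 0 <= C.
Hypothesis small : forall s : R, 0 < s ->
  (m (D `&` [set x | (d x <= s)%R]) <= (C * s)%:E)%E.

Lemma dyadic_integral_le (F : T -> R) (c1 s1 c2 s2 : nat -> R) (K : R) :
  measurable_fun setT F -> (forall x, 0 <= F x) ->
  (forall j, 0 <= c1 j) -> (forall j, 0 <= c2 j) ->
  (forall j, 0 < s1 j) -> (forall j, 0 < s2 j) ->
  (forall x, D x -> exists j, (F x <= c1 j /\ d x <= s1 j) \/
                              (F x <= c2 j /\ d x <= s2 j)) ->
  (forall n, \sum_(j < n) (c1 j * s1 j + c2 j * s2 j) <= K) ->
  (\int[m]_(x in D) (F x)%:E <= (C * K)%:E)%E.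
Proof.
move=> mF F0 c10 c20 s10 s20 hF hK.
apply: (@dyadic_integral_mass F c1 s1 (fun j => C * s1 j) c2 s2 (fun j => C * s2 j)) => //.
- by move=> j; exact: small.
- by move=> j; exact: small.
move=> n; rewrite (_ : \sum_(j < n) _ = C * \sum_(j < n) (c1 j * s1 j + c2 j * s2 j)).
  by rewrite ler_wpM2l.
by rewrite mulr_sumr; apply: eq_bigr => j _; ring.
Qed.

Lemma powR_dyadic (y g : R) j : 0 < y -> (2 ^+ j * y) `^ g = (2 `^ g) ^+ j * y `^ g.
Proof.
move=> y0; rewrite powRM ?exprn_ge0 ?(ltW y0)//; congr (_ * _).
by elim: j => [|j IH]; rewrite ?expr0 ?powR1// !exprS powRM ?exprn_ge0// IH.
Qed.

Lemma powR2_lt1 (g : R) : 0 < g -> 0 <= 2 `^ (- g) < 1.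
Proof.
move=> g0; rewrite powR_ge0 /= powRN invf_lt1 ?powR_gt0//.
have {1}-> : 1 = 1 `^ g :> R by rewrite powR1.
 apply: gt0_ltr_powR; rewrite ?nnegrE ?ler0n//.
by rewrite ltr1n.
Qed.

Lemma powRN_le (x y g : R) : 0 <= g -> 0 < x -> x <= y -> y `^ (- g) <= x `^ (- g).
Proof.
move=> g0 x0 xy; have y0 := lt_le_trans x0 xy.
rewrite !powRN lef_pV2 ?posrE ?powR_gt0//.
by rewrite ge0_ler_powR// nnegrE ltW.
Qed.

(** This constant and [weight_const] are geometric sums over the dyadic scales. *)
Definition tail_const (p : R) : R := 2 * (1 - 2 `^ (- (p - 1)))^-1.

Lemma tail_const_ge0 (p : R) : 1 < p -> 0 <= tail_const p.
Proof.
move=> p1; have /andP[_ h] : 0 <= (2 : R) `^ (- (p - 1)) < 1 by apply: powR2_lt1; lra.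
by rewrite /tail_const mulr_ge0// invr_ge0 subr_ge0 ltW.
Qed.

Lemma measurable_powR_shift (y g : R) :
  measurable_fun setT (fun x => (y + d x) `^ g).
Proof.
apply: (@measurableT_comp _ _ _ _ _ _ _ _ _ (measurable_powR g)).
by apply: measurable_funD.
Qed.

Lemma integral_tail (p y : R) : 1 < p -> 0 < y ->
  (\int[m]_(x in D) ((y + d x) `^ (- p))%:E <=
     (C * (tail_const p * y `^ (1 - p)))%:E)%E.
Proof.
move=> p1 y0.
pose c j := (2 ^+ j * y) `^ (- p).
pose s (j : nat) := 2 ^+ j.+1 * y.
have pos j : 0 < 2 ^+ j * y by rewrite mulr_gt0// exprn_gt0.
apply: (@dyadic_integral_le _ c s (fun=> 0) s); rewrite ?powR_ge0//.
- exact: measurable_powR_shift.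
- by move=> x; exact: powR_ge0.
- by move=> j; exact: powR_ge0.
- by move=> j; exact: pos.
- by move=> j; exact: pos.
- move=> x Dx; have dx := d_gt0 Dx.
  have [yd|yd] := leP y (d x).
    have [j /andP[h1 h2]] := dyadic_scale y0 yd; exists j; left.
    by split; [apply: powRN_le => //; lra|exact: ltW].
  exists 0%N; left; split; first by rewrite /c expr0 mul1r; apply: powRN_le => //; lra.
  by rewrite /s expr1; lra.
move=> n.
have -> : \sum_(j < n) (c j * s j + 0 * s j) =
    2 * y `^ (1 - p) * \sum_(j < n) (2 `^ (- (p - 1))) ^+ j.
  rewrite mulr_sumr; apply: eq_bigr => j _; rewrite mul0r addr0 /c /s.
  rewrite exprS -mulrA -[X in _ * (2 * X)]powRr1 ?(ltW (pos _))//.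
  rewrite mulrCA -powRD; last by apply/implyP => _; rewrite gt_eqF.
  by rewrite (_ : - p + 1 = - (p - 1)) ?opprB ?powR_dyadic//; [ring|rewrite addrC].
have := geom_sum_le n (powR2_lt1 (_ : 0 < p - 1)).
rewrite subr_gt0 => /(_ p1) h.
by rewrite /tail_const [leRHS]mulrAC ler_wpM2l// mulr_ge0// powR_ge0.
Qed.

Definition weight_const (g : R) : R :=
  2 `^ g * (1 - 2 `^ (- (1 - g)))^-1 + 2 * (1 - 2 `^ (- g))^-1.

Lemma integral_weight (g y : R) : 0 < g < 1 -> 0 < y ->
  (\int[m]_(x in D) (d x `^ (- g) * (y + d x)^-1)%:E <=
     (C * (weight_const g * y `^ (- g)))%:E)%E.
Proof.
move=> /andP[g0 g1] y0.
pose c1 j := (2 ^+ j.+1 / y) `^ g * y^-1.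
pose s1 (j : nat) := y / 2 ^+ j.
pose c2 j := (2 ^+ j * y) `^ (- g) * (2 ^+ j * y)^-1.
pose s2 (j : nat) := 2 ^+ j.+1 * y.
have pos j : 0 < 2 ^+ j * y by rewrite mulr_gt0// exprn_gt0.
have yd0 x : 0 <= y + d x by rewrite addr_ge0// ltW.
apply: (@dyadic_integral_le _ c1 s1 c2 s2).
- apply: measurable_funM.
    by apply: (@measurableT_comp _ _ _ _ _ _ _ _ _ (measurable_powR (- g))).
  by apply: measurable_inv_ge0 => //; apply: measurable_funD.
- by move=> x; rewrite mulr_ge0 ?powR_ge0 ?invr_ge0.
- by move=> j; rewrite mulr_ge0 ?powR_ge0 ?invr_ge0 ?(ltW y0).
- by move=> j; rewrite mulr_ge0 ?powR_ge0 ?invr_ge0 ?(ltW (pos _)).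
- by move=> j; rewrite divr_gt0// exprn_gt0.
- by move=> j; exact: pos.
- move=> x Dx; have dx := d_gt0 Dx.
  have [yd|yd] := leP y (d x).
    have [j /andP[h1 h2]] := dyadic_scale y0 yd; exists j; right.
    split; last exact: ltW.
    apply: ler_pM; rewrite ?powR_ge0 ?invr_ge0//.
      by apply: powRN_le => //; exact: ltW.
    by rewrite lef_pV2 ?posrE//; lra.
  have [j /andP[h1 h2]] := dyadic_scale dx (ltW yd); exists j; left.
  split; last by rewrite /s1 ler_pdivlMr ?exprn_gt0// mulrC.
  apply: ler_pM; rewrite ?powR_ge0 ?invr_ge0//.
    rewrite -[2 ^+ j.+1 / y]invrK -powR_inv1 ?invr_ge0 ?divr_ge0 ?exprn_ge0 ?(ltW y0)//.
    rewrite -powRrM mulN1r; apply: powRN_le; rewrite ?(ltW g0)//.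
      by rewrite invr_gt0 divr_gt0// exprn_gt0.
    by rewrite invf_div ler_pdivrMr ?exprn_gt0// mulrC ltW.
  by rewrite lef_pV2 ?posrE//; lra.
move=> n.
have -> : \sum_(j < n) (c1 j * s1 j + c2 j * s2 j) =
    2 `^ g * y `^ (- g) * (\sum_(j < n) (2 `^ (- (1 - g))) ^+ j)
    + 2 * y `^ (- g) * \sum_(j < n) (2 `^ (- g)) ^+ j.
  rewrite !mulr_sumr -big_split /=; apply: eq_bigr => j _; congr (_ + _).
    rewrite /c1 /s1 powR_dyadic ?invr_gt0//.
    rewrite -(powR_inv1 (ltW y0)) -powRrM mulN1r powR_inv1 ?(ltW y0)//.
    rewrite opprB powRB; last by apply/implyP => _; rewrite pnatr_eq0.
    rewrite powRr1// expr_div_n exprS.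
    by field; rewrite (gt_eqF y0) ?expf_neq0 ?pnatr_eq0.
  rewrite /c2 /s2 powR_dyadic// exprS.
  by field; rewrite (gt_eqF y0) ?expf_neq0 ?pnatr_eq0.
have h1 := geom_sum_le n (powR2_lt1 (_ : 0 < 1 - g)).
rewrite subr_gt0 in h1; have {}h1 := h1 g1.
have h2 := geom_sum_le n (powR2_lt1 g0).
rewrite /weight_const [leRHS]mulrDl; apply: lerD.
  by rewrite [leRHS]mulrAC ler_wpM2l// mulr_ge0// powR_ge0.
by rewrite [leRHS]mulrAC ler_wpM2l// mulr_ge0// powR_ge0.
Qed.

(** The weight is of the same order on each of the scales between [y] and [S]: the
    integral is at most their number, the logarithm of [S / y]. *)
Lemma integral_log (y S : R) (J : nat) : 0 < y -> (forall x, D x -> d x <= S) ->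
  S <= 2 ^+ J.+1 * y ->
  (\int[m]_(x in D) ((y + d x)^-1)%:E <= (C * (2 * J.+1%:R))%:E)%E.
Proof.
move=> y0 dS SJ.
have pos j : 0 < 2 ^+ j * y by rewrite mulr_gt0// exprn_gt0.
pose c j := if (j < J.+1)%N then (2 ^+ j * y)^-1 else 0.
pose s (j : nat) := 2 ^+ j.+1 * y.
have yd0 x : 0 <= y + d x by rewrite addr_ge0// ltW.
apply: (@dyadic_integral_le _ c s (fun=> 0) s) => //.
- by apply: measurable_inv_ge0 => //; apply: measurable_funD.
- by move=> x; rewrite invr_ge0.
- by move=> j; rewrite /c; case: ifP => // _; rewrite invr_ge0 ltW.
- by move=> j; exact: pos.
- by move=> j; exact: pos.
- move=> x Dx; have dx := d_gt0 Dx; have dSx := dS x Dx.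
  have [yd|yd] := leP y (d x).
    have [j /andP[h1 h2]] := dyadic_scale y0 yd.
    have [jJ|jJ] := ltnP j J.+1.
      exists j; left; rewrite /c jJ; split; last exact: ltW.
      by rewrite lef_pV2 ?posrE//; lra.
    exists J; left; rewrite /c ltnSn; split; last exact: le_trans SJ.
    rewrite lef_pV2 ?posrE//; last by lra.
    apply: (@le_trans _ _ (d x)); last by lra.
    apply: le_trans h1; rewrite ler_pM2r// ler_weXn2l ?ler1n// ltnW//.
  exists 0%N; left; rewrite /c /s expr0 mul1r /= expr1; split; last by lra.
  by rewrite lef_pV2 ?posrE//; lra.
move=> n.
have e j : c j * s j + 0 * s j = 2 * (j < J.+1)%N%:R.
  rewrite mul0r addr0 /c /s; case: ifP => _; last by rewrite mul0r mulr0.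
  by rewrite exprS mulr1 -mulrA mulrCA mulVf ?mulr1// gt_eqF.
under eq_bigr do rewrite e.
rewrite -mulr_sumr ler_pM2l// -natr_sum ler_nat.
have -> : (\sum_(j < n) (j < J.+1) = minn n J.+1)%N.
  elim: n => [|n IH]; first by rewrite big_ord0 min0n.
  rewrite big_ord_recr /= IH; case: ltnP => h.
    by rewrite (minn_idPl h) addn1.
  by rewrite (minn_idPr (leqW h)) addn0.
exact: geq_minr.
Qed.

End carleson_integrals.

(** * Hoelder, Tonelli and Schur's test *)

Lemma lee_poweR (R : realType) (r : R) (x y : \bar R) : 0 <= r ->
  (0 <= x)%E -> (x <= y)%E -> (x `^ r <= y `^ r)%E.
Proof.
move=> r0 x0 xy; have y0 := le_trans x0 xy.
by apply: gt0_ler_poweR => //; rewrite in_itv /= leey andbT.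
Qed.

Section hoelder_on_set.
Context dd (T : measurableType dd) (R : realType).
Variables (m : {measure set T -> \bar R}) (D : set T).
Hypothesis mD : measurable D.
Local Open Scope ereal_scope.

Lemma hoelder_on (f g : T -> R) (p q : R) :
  measurable_fun setT f -> measurable_fun setT g ->
  (forall x, 0 <= f x)%R -> (forall x, 0 <= g x)%R ->
  (0 < p)%R -> (0 < q)%R -> (p^-1 + q^-1 = 1)%R ->
  \int[m]_(x in D) (f x * g x)%:E <=
  (\int[m]_(x in D) (f x `^ p)%:E) `^ p^-1 *
  (\int[m]_(x in D) (g x `^ q)%:E) `^ q^-1.
Proof.
move=> mf mg f0 g0 p0 q0 pq.
pose f' := (f \_ D : T -> R); pose g' := (g \_ D : T -> R).
have mres (h : T -> R) : measurable_fun setT h -> measurable_fun setT (h \_ D : T -> R).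
  by move=> mh; apply/(measurable_restrictT _ mD); exact: measurable_funTS.
have N (h : T -> R) (r : R) : (0 < r)%R -> (forall x, 0 <= h x)%R ->
    'N[m]_r%:E[EFin \o (h \_ D : T -> R)] = (\int[m]_(x in D) (h x `^ r)%:E) `^ r^-1.
  move=> r0 h0.
  have E : \int[m]_x (`|(EFin \o (h \_ D : T -> R)) x| `^ r) = \int[m]_(x in D) (h x `^ r)%:E.
    rewrite [RHS]integral_mkcond; apply: eq_integral => x _.
    have -> : (EFin \o (h \_ D : T -> R)) x = ((h \_ D : T -> R) x)%:E by [].
    rewrite abse_EFin poweR_EFin !patchE; case: ifP => _; last by rewrite normr0 powR0 ?gt_eqF.
    by rewrite ger0_norm.
  by rewrite unlock -E.
have := hoelder m (mres _ mf) (mres _ mg) p0 q0 pq.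
rewrite !N//; apply: le_trans.
rewrite Lnorm1 integral_mkcond le_eqVlt; apply/orP; left; apply/eqP.
apply: eq_integral => x _ /=; rewrite !patchE; case: ifP => _.
  by rewrite ger0_norm// mulr_ge0.
by rewrite mulr0 normr0.
Qed.

End hoelder_on_set.

Section tonelli_on_sets.
Context d1 d2 (T1 : measurableType d1) (T2 : measurableType d2) (R : realType).
Variables (m1 : {sigma_finite_measure set T1 -> \bar R}).
Variables (m2 : {sigma_finite_measure set T2 -> \bar R}).
Variables (D1 : set T1) (D2 : set T2).
Hypotheses (mD1 : measurable D1) (mD2 : measurable D2).
Local Open Scope ereal_scope.

Lemma measurable_partial_integral (F : T1 * T2 -> \bar R) :
  measurable_fun setT F -> (forall z, 0 <= F z) ->
  measurable_fun setT (fun x => \int[m2]_(y in D2) F (x, y)).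
Proof.
move=> mF F0; pose F' := F \_ (setT `*` D2).
have mF' : measurable_fun setT F'.
  have mX : measurable ([set: T1] `*` D2) by exact: measurableX.
  by apply/(measurable_restrictT _ mX); exact: measurable_funTS.
have F'0 z : 0 <= F' z by rewrite /F' patchE; case: ifP.
rewrite (_ : (fun x => _) = fubini_F m2 F').
  exact: measurable_fun_fubini_tonelli_F.
apply/funext => x; rewrite /fubini_F [LHS]integral_mkcond; apply: eq_integral => y _.
rewrite /F' !patchE; congr (if _ then _ else _).
by apply/idP/idP; rewrite !inE /=; [move=> h; split|case].
Qed.

Lemma tonelli_on (F : T1 * T2 -> \bar R) :
  measurable_fun setT F -> (forall z, 0 <= F z) ->
  \int[m1]_(x in D1) \int[m2]_(y in D2) F (x, y) =
  \int[m2]_(y in D2) \int[m1]_(x in D1) F (x, y).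
Proof.
move=> mF F0; pose F' := F \_ (D1 `*` D2).
have mF' : measurable_fun setT F'.
  have mX : measurable (D1 `*` D2) by exact: measurableX.
  by apply/(measurable_restrictT _ mX); exact: measurable_funTS.
have F'0 z : 0 <= F' z by rewrite /F' patchE; case: ifP.
have F'E x y : F' (x, y) = if (x \in D1) && (y \in D2) then F (x, y) else 0.
  rewrite /F' patchE; congr (if _ then _ else _).
  by apply/idP/andP; rewrite !inE.
transitivity (\int[m1]_x \int[m2]_y F' (x, y)).
  rewrite integral_mkcond; apply: eq_integral => x _; rewrite patchE.
  case: ifP => xD; last by under eq_integral do rewrite F'E xD /=; rewrite integral0.
  rewrite integral_mkcond; apply: eq_integral => y _.
  by rewrite F'E xD patchE.
rewrite (fubini_tonelli F' mF' F'0).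
rewrite [RHS]integral_mkcond; apply: eq_integral => y _; rewrite patchE.
case: ifP => yD; last by under eq_integral do rewrite F'E yD andbF; rewrite integral0.
rewrite [RHS]integral_mkcond; apply: eq_integral => x _.
by rewrite F'E yD patchE andbT.
Qed.

End tonelli_on_sets.

Section schur.
Context e1 e2 (T1 : measurableType e1) (T2 : measurableType e2) (R : realType).
Variables (m1 : {sigma_finite_measure set T1 -> \bar R}).
Variables (m2 : {sigma_finite_measure set T2 -> \bar R}).
Variables (D1 : set T1) (D2 : set T2) (d1 : T1 -> R) (d2 : T2 -> R) (C1 C2 : R).
Hypotheses (mD1 : measurable D1) (mD2 : measurable D2).
Hypotheses (md1 : measurable_fun setT d1) (md2 : measurable_fun setT d2).
Hypotheses (d1_ge0 : forall x, 0 <= d1 x) (d2_ge0 : forall y, 0 <= d2 y).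
Hypotheses (d1_gt0 : forall x, D1 x -> 0 < d1 x) (d2_gt0 : forall y, D2 y -> 0 < d2 y).
Hypotheses (C1_ge0 : 0 <= C1) (C2_ge0 : 0 <= C2).
Hypothesis small1 : forall s : R, 0 < s ->
  (m1 (D1 `&` [set x | (d1 x <= s)%R]) <= (C1 * s)%:E)%E.
Hypothesis small2 : forall s : R, 0 < s ->
  (m2 (D2 `&` [set x | (d2 x <= s)%R]) <= (C2 * s)%:E)%E.

Definition schur_const (p : R) : R :=
  (C2 * weight_const p^-1) `^ (p - 1) * (C1 * weight_const (1 - p^-1)).

Lemma weight_const_ge0 (g : R) : 0 < g < 1 -> 0 <= weight_const g.
Proof.
move=> /andP[g0 g1]; rewrite /weight_const.
have /andP[_ h1] := @powR2_lt1 R _ g0.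
have /andP[_ h2] : 0 <= 2 `^ (- (1 - g)) < 1 by apply: powR2_lt1; rewrite subr_gt0.
by rewrite addr_ge0 ?mulr_ge0 ?powR_ge0 ?invr_ge0 ?subr_ge0 ?ltW.
Qed.

(** Schur's test with weights that are powers of the distances; on the two
    measures only the mass of small distances matters. *)
Lemma schur_test (p : R) (h : T2 -> R) : 1 < p ->
  measurable_fun setT h -> (forall y, 0 <= h y) ->
  (\int[m1]_(x in D1)
     ((\int[m2]_(y in D2) (h y * (d1 x + d2 y)^-1)%:E) `^ p) <=
   (schur_const p)%:E * \int[m2]_(y in D2) (h y `^ p)%:E)%E.
Proof.
move=> p1 mh h0.
have p0 : 0 < p by lra.
have pi1 : p^-1 < 1 by rewrite invf_lt1.
have pi0 : 0 < p^-1 by rewrite invr_gt0.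
pose q := (1 - p^-1)^-1.
have q0 : 0 < q by rewrite invr_gt0 subr_gt0.
have qE : q^-1 = 1 - p^-1 by rewrite invrK.
have pq : p^-1 + q^-1 = 1 by rewrite qE; ring.
have pn : p != 0 by rewrite gt_eqF.
have pm1 : p * q^-1 = p - 1 by rewrite qE mulrBr mulr1 divff.
have qi0 : 0 < q^-1 by rewrite invr_gt0.
have qi1 : q^-1 < 1 by rewrite qE; lra.
pose K x y := (d1 x + d2 y)^-1.
have K0 x y : 0 <= K x y by rewrite invr_ge0 addr_ge0.
have mK : measurable_fun setT (fun z : T1 * T2 => K z.1 z.2).
  apply: measurable_inv_ge0 => [|z]; last by rewrite addr_ge0.
  by apply: measurable_funD; apply: measurableT_comp.
pose b := (p * q)^-1.
have bp : b * p = q^-1 by rewrite /b invfM mulrAC mulVf ?mul1r.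
have bq : b * q = p^-1 by rewrite /b invfM -mulrA mulVf ?mulr1// gt_eqF.
pose A x := (\int[m2]_(y in D2) (h y `^ p * d2 y `^ q^-1 * K x y)%:E)%E.
pose W2 := C2 * weight_const p^-1.
have W20 : 0 <= W2 by rewrite mulr_ge0// weight_const_ge0// pi0.
pose W1 := C1 * weight_const q^-1.
have W10 : 0 <= W1 by rewrite mulr_ge0// weight_const_ge0// qi0.
have mKx x : measurable_fun setT (K x).
  by apply: measurable_inv_ge0 => [|z]; [exact: measurable_funD|rewrite addr_ge0].
have mKy y : measurable_fun setT (K^~ y).
  by apply: measurable_inv_ge0 => [|z]; [exact: measurable_funD|rewrite addr_ge0].
have mp dd (T : measurableType dd) (F : T -> R) r : measurable_fun setT F ->
    measurable_fun setT (fun x => F x `^ r).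
  by move=> mF; exact: (@measurableT_comp _ _ _ _ _ _ _ _ _ (measurable_powR r) mF).
have mG : measurable_fun setT (fun z : T1 * T2 => (h z.2 `^ p * d2 z.2 `^ q^-1 * K z.1 z.2)%:E).
  apply/measurable_EFinP; apply: measurable_funM => //; apply: measurable_funM.
    by apply: mp; exact: measurableT_comp.
  by apply: mp; exact: measurableT_comp.
have G0 z : (0 <= (h z.2 `^ p * d2 z.2 `^ q^-1 * K z.1 z.2)%:E)%E.
  by rewrite lee_fin !mulr_ge0 ?powR_ge0.
have A0 x : (0 <= A x)%E.
  by apply: integral_ge0 => y _; exact: (G0 (x, y)).
have mA : measurable_fun setT A := measurable_partial_integral m2 mD2 mG G0.
(* Hoelder with the weight on the inner variable *)
have inner x : D1 x ->
    ((\int[m2]_(y in D2) (h y * K x y)%:E) `^ p <= (W2 `^ (p - 1) * d1 x `^ (- q^-1))%:E * A x)%E.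
  move=> Dx; have dx := d1_gt0 Dx.
  pose F y := h y * d2 y `^ b * K x y `^ p^-1.
  pose G y := d2 y `^ (- b) * K x y `^ q^-1.
  have E : (\int[m2]_(y in D2) (h y * K x y)%:E = \int[m2]_(y in D2) (F y * G y)%:E)%E.
    apply: eq_integral => y; rewrite inE => Dy; have dy := d2_gt0 Dy.
    congr EFin; rewrite /F /G.
    have k1 : d2 y `^ b * d2 y `^ (- b) = 1.
      by rewrite -powRD ?addrN ?powRr0// eqxx gt_eqF.
    have k2 : K x y `^ p^-1 * K x y `^ q^-1 = K x y.
      rewrite -powRD ?pq ?powRr1//; apply/implyP => _.
      by rewrite gt_eqF// invr_gt0 addr_gt0.
    rewrite -{1}k2; transitivity (h y * (d2 y `^ b * d2 y `^ (- b)) *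
      (K x y `^ p^-1 * K x y `^ q^-1)); last by ring.
    by rewrite k1 mulr1.
  have mF : measurable_fun setT F.
    apply: measurable_funM; last exact: mp.
    by apply: measurable_funM => //; exact: mp.
  have mGG : measurable_fun setT G by apply: measurable_funM; exact: mp.
  have F0 y : 0 <= F y by rewrite !mulr_ge0 ?powR_ge0.
  have GG0 y : 0 <= G y by rewrite !mulr_ge0 ?powR_ge0.
  have H := hoelder_on m2 mD2 mF mGG F0 GG0 p0 q0 pq.
  have EF : (\int[m2]_(y in D2) (F y `^ p)%:E = A x)%E.
    apply: eq_integral => y _; congr EFin; rewrite /F !powRM ?mulr_ge0 ?powR_ge0//.
    by rewrite -!powRrM bp mulVf// powRr1.
  have EG : (\int[m2]_(y in D2) (G y `^ q)%:E <= (W2 * d1 x `^ (- p^-1))%:E)%E.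
    have := integral_weight mD2 md2 d2_ge0 d2_gt0 C2_ge0 small2 (_ : 0 < p^-1 < 1) dx.
    rewrite pi0 pi1 mulrA => /(_ isT); apply: le_trans; rewrite le_eqVlt; apply/orP; left.
    apply/eqP; apply: eq_integral => y _; congr EFin; rewrite /G powRM ?powR_ge0//.
    by rewrite -!powRrM mulNr bq mulVf ?powRr1// gt_eqF.
  rewrite E.
  apply: (@le_trans _ _ ((A x `^ p^-1 * (W2 * d1 x `^ (- p^-1))%:E `^ q^-1) `^ p)%E).
    apply: lee_poweR; rewrite ?(ltW p0)//.
      by apply: integral_ge0 => y _; rewrite lee_fin mulr_ge0.
    rewrite -EF; apply: (le_trans H).
    apply: (lee_wpmul2l (poweR_ge0 _ _)).
    apply: lee_poweR; rewrite ?(ltW qi0)//.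
    by apply: integral_ge0 => y _; rewrite lee_fin powR_ge0.
  rewrite poweRM ?poweR_ge0// -!poweRrM mulVf// poweRe1// muleC.
  apply: lee_wpmul2r => //; rewrite poweR_EFin lee_fin (mulrC q^-1) pm1.
  rewrite powRM ?powR_ge0// -powRrM mulNr (mulrC p^-1) mulrBl divff// mul1r -qE.
  exact: lexx.
apply: (@le_trans _ _ (\int[m1]_(x in D1) ((W2 `^ (p - 1))%:E * ((d1 x `^ (- q^-1))%:E * A x)))%E).
  apply: ge0_le_integral => //.
  - by move=> x _; exact: poweR_ge0.
  - apply: measurable_funTS; apply: (@measurableT_comp _ _ _ _ _ _ _ _ _ (measurable_poweR p)).
    apply: (@measurable_partial_integral _ _ _ _ _ m2 D2 mD2 (fun z => (h z.2 * K z.1 z.2)%:E)) => //.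
      apply/measurable_EFinP; apply: measurable_funM => //; exact: measurableT_comp.
    by move=> z; rewrite lee_fin mulr_ge0.
  - apply/measurable_funTS/emeasurable_funM; first exact: measurable_cst.
    by apply: emeasurable_funM => //; apply/measurable_EFinP; exact: mp.
  by move=> x Dx; apply: le_trans (inner x Dx) _; rewrite EFinM muleA.
rewrite ge0_integralZl//; last 3 first.
- by apply/measurable_funTS/emeasurable_funM => //; apply/measurable_EFinP; exact: mp.
- by move=> x _; rewrite mule_ge0// lee_fin powR_ge0.
- by rewrite lee_fin powR_ge0.
rewrite /schur_const -/W2 -qE -/W1 EFinM -muleA.
apply: lee_wpmul2l; first by rewrite lee_fin powR_ge0.
have -> : (\int[m1]_(x in D1) ((d1 x `^ (- q^-1))%:E * A x) =
    \int[m1]_(x in D1) \int[m2]_(y in D2)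
      (h y `^ p * d2 y `^ q^-1 * (d1 x `^ (- q^-1) * K x y))%:E)%E.
  apply: eq_integral => x _; rewrite /A -ge0_integralZl//.
  - by apply: eq_integral => y _; rewrite -EFinM; congr EFin; ring.
  - apply/measurable_EFinP/measurable_funTS; apply: measurable_funM => //.
    by apply: measurable_funM; exact: mp.
  - by move=> y _; exact: (G0 (x, y)).
  - by rewrite lee_fin powR_ge0.
rewrite (@tonelli_on _ _ _ _ _ m1 m2 D1 D2 mD1 mD2 (fun z => (h z.2 `^ p * d2 z.2 `^ q^-1 * (d1 z.1 `^ (- q^-1) * K z.1 z.2))%:E))//; last 2 first.
- apply/measurable_EFinP; apply: measurable_funM.
    by apply: measurable_funM; apply: mp; exact: measurableT_comp.
  by apply: measurable_funM => //; apply: mp; exact: measurableT_comp.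
- by move=> z; rewrite lee_fin !mulr_ge0 ?powR_ge0.
rewrite -ge0_integralZl//; last 2 first.
- by apply/measurable_EFinP/measurable_funTS; exact: mp.
- by move=> y _; rewrite lee_fin powR_ge0.
apply: ge0_le_integral => //.
- by move=> y _; apply: integral_ge0 => x _; rewrite lee_fin !mulr_ge0 ?powR_ge0.
- apply: measurable_funTS.
  apply: (@measurable_partial_integral _ _ _ _ _ m1 D1 mD1 (fun z => (h z.1 `^ p * d2 z.1 `^ q^-1 * (d1 z.2 `^ (- q^-1) * K z.2 z.1))%:E)) => //.
    apply/measurable_EFinP; apply: measurable_funM.
      by apply: measurable_funM; apply: mp; exact: measurableT_comp.
    apply: measurable_funM; first by apply: mp; exact: measurableT_comp.
    apply: measurable_inv_ge0 => [|z]; last by rewrite addr_ge0.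
    by apply: measurable_funD; apply: measurableT_comp.
  by move=> z; rewrite lee_fin !mulr_ge0 ?powR_ge0.
- apply/measurable_funTS/emeasurable_funM; first exact: measurable_cst.
  by apply/measurable_EFinP; exact: mp.
move=> y Dy; have dy := d2_gt0 Dy.
under eq_integral do rewrite EFinM /=.
rewrite ge0_integralZl//; last 3 first.
- by apply/measurable_EFinP/measurable_funTS; apply: measurable_funM => //; exact: mp.
- by move=> x _; rewrite lee_fin mulr_ge0 ?powR_ge0.
- by rewrite lee_fin mulr_ge0 ?powR_ge0.
have := integral_weight mD1 md1 d1_ge0 d1_gt0 C1_ge0 small1 (_ : 0 < q^-1 < 1) dy.
rewrite qi0 qi1 mulrA -/W1 => /(_ isT) H.
apply: (@le_trans _ _ ((h y `^ p * d2 y `^ q^-1)%:E * (W1 * d2 y `^ (- q^-1))%:E)%E).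
  apply: lee_wpmul2l; first by rewrite lee_fin mulr_ge0 ?powR_ge0.
  apply: le_trans H; rewrite le_eqVlt; apply/orP; left; apply/eqP.
  by apply: eq_integral => x _; rewrite /K addrC.
rewrite -!EFinM lee_fin.
have k1 : d2 y `^ q^-1 * d2 y `^ (- q^-1) = 1.
  by rewrite -powRD ?addrN ?powRr0// eqxx gt_eqF.
rewrite [leLHS](_ : _ = W1 * h y `^ p * (d2 y `^ q^-1 * d2 y `^ (- q^-1))); last by ring.
by rewrite k1 mulr1.
Qed.

End schur.

(** * Chords of the circle *)

Section arc_measure.
Variable R : realType.
Local Notation e := (circle_point (1 : R)).
Local Notation arc := (`]0%R, (2 * pi)%R[%classic : set (measurableTypeR R)).

(** A crude form of Jordan's inequality. *)
Lemma sin_ge_linear (y : R) : 0 <= y <= pi / 2 -> cos 1 / 2 * y <= sin y.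
Proof.
have c1 : 0 < cos (1 : R) := cos1_gt0 R.
have /andP[p2 p2'] := (pihalf_02_cos_pihalf R).1.
have p1 := pihalf_ge1 R.
have ph : pi / 2 <= pi :> R by have := pi_ge0 R; lra.
have small (x : R) : 0 <= x <= 1 -> cos 1 * x <= sin x.
  move=> /andP[]; rewrite le_eqVlt => /predU1P[<- _|x0 x1]; first by rewrite mulr0 sin0.
  have [|c] := @MVT R sin cos 0 x x0 (fun x _ => is_derive_sin x).
    by apply: continuous_subspaceT; exact: continuous_sin.
  rewrite in_itv /= => /andP[c0 cx]; rewrite sin0 !subr0 => ->.
  rewrite ler_pM2r//; apply: ltW; rewrite ltr_cos ?in_itv /=; lra.
move=> /andP[y0 y1]; have [le1|gt1] := leP y 1.
  apply: le_trans (small y _); rewrite ?y0//.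
  by rewrite ler_wpM2r//; lra.
apply: (@le_trans _ _ (sin 1)).
  have := small 1; rewrite ler01 lexx mulr1 => /(_ isT).
  apply: le_trans; rewrite -mulrA ler_piMr ?(ltW c1)//; lra.
by apply: ltW; rewrite ltr_sin ?in_itv /=; lra.
Qed.

Lemma chord_sin (x : R) : chord x ^+ 2 = (2 * sin (x / 2)) ^+ 2.
Proof.
rewrite /chord nc_sqr /circle_point /= !mul1r sub0r sqrrN.
have hx : x = x / 2 + x / 2 by rewrite -splitr.
have E1 : cos x = cos (x / 2) ^+ 2 - sin (x / 2) ^+ 2.
  by rewrite {1}hx cosD !expr2.
have E2 : sin x = 2 * (sin (x / 2) * cos (x / 2)).
  by rewrite {1}hx sinD; ring.
have h := cos2Dsin2 (x / 2).
rewrite E1 E2; set c := cos _ in h *; set s := sin _ in h *.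
have -> : c ^+ 2 = 1 - s ^+ 2 by rewrite -h addrK.
rewrite exprMn (exprMn _ s c) (_ : c ^+ 2 = 1 - s ^+ 2); last by rewrite -h addrK.
by ring.
Qed.

Lemma chord_ge (x : R) : 0 <= x <= pi -> cos 1 / 2 * x <= chord x.
Proof.
move=> /andP[x0 x1].
have H : cos 1 / 2 * (x / 2) <= sin (x / 2).
  by apply: sin_ge_linear; rewrite divr_ge0//= ler_pM2r ?invr_gt0.
have c1 : 0 < cos (1 : R) := cos1_gt0 R.
have h0 : 0 <= cos 1 / 2 * (x / 2) by rewrite !mulr_ge0// ltW.
rewrite -(@ler_sqr R) ?nnegrE ?chord_ge0//; last by rewrite !mulr_ge0// ltW.
have s0 := le_trans h0 H.
rewrite chord_sin lerXn2r ?nnegrE//; [|exact: mulr_ge0|by lra].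
by rewrite !mulr_ge0// ltW.
Qed.

Lemma chord_reflect (x : R) : chord (2 * pi - x) = chord x.
Proof.
rewrite /chord circle_pointD -[X in e X]mul1r (circle_point_period R 1) mul1r.
rewrite -conj_circle_point -(nc_conj (1 - e x)); congr nc.
by rewrite rmorphB /= oppr0.
Qed.

Lemma chord_gt0 (x : R) : 0 < x < 2 * pi -> 0 < chord x.
Proof.
have c1 : 0 < cos (1 : R) := cos1_gt0 R.
move=> /andP[x0 x1]; have [xp|xp] := leP x pi.
  apply: lt_le_trans (chord_ge _); last by rewrite ltW.
  by rewrite !mulr_gt0.
rewrite -chord_reflect; apply: lt_le_trans (chord_ge _); last by lra.
by rewrite !mulr_gt0// subr_gt0.
Qed.

Definition arc_const : R := 4 / cos 1.

Lemma arc_const_ge0 : 0 <= arc_const.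
Proof. by rewrite divr_ge0// ltW// cos1_gt0. Qed.

Lemma measurable_chord : measurable_fun setT (@chord R : measurableTypeR R -> R).
Proof.
apply: continuous_measurable_fun => x; apply: ccont_nc; apply: ccontD; first exact: ccont_cst.
rewrite (_ : (fun y => _) = fun y => (- 1) * e y); last by apply/funext => y; rewrite mulN1r.
by apply: ccontM; [exact: ccont_cst|exact: ccont_e].
Qed.

Lemma arc_small (s : R) : 0 < s ->
  (lebesgue_measure (arc `&` [set x | (chord x <= s)%R]) <= (arc_const * s)%:E)%E.
Proof.
move=> s0; have c1 : 0 < cos (1 : R) := cos1_gt0 R.
pose t := 2 / cos 1 * s.
have t0 : 0 < t by rewrite /t mulr_gt0// divr_gt0.
have mA : measurable (arc `&` [set x | (chord x <= s)%R]).
  apply: measurableI; first exact: measurable_itv.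
  exact: measurable_sublevel measurable_chord s.
pose A : set (measurableTypeR R) := `[0, t]%classic.
pose B : set (measurableTypeR R) := `[2 * pi - t, 2 * pi]%classic.
have small (x : R) : 0 <= x <= pi -> chord x <= s -> x <= t.
  move=> xp xs; have := le_trans (chord_ge xp) xs.
  by move=> h; rewrite (_ : t = 2 * s / cos 1) ?ler_pdivlMr//; [lra|rewrite /t mulrAC].
apply: (@le_trans _ _ (lebesgue_measure (A `|` B))).
  apply: le_measure; rewrite ?inE//.
    by apply: measurableU; exact: measurable_itv.
  move=> x [/=]; rewrite !in_itv /= => /andP[x0 x1] xs.
  have [xp|xp] := leP x pi.
    by left; rewrite /A /= in_itv /= (ltW x0) small// xp ltW.
  right; rewrite /B /= in_itv /= (ltW x1) andbT.
  have := small (2 * pi - x); rewrite chord_reflect => /(_ _ xs); lra.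
apply: le_trans (measureU2 _ _ _) _; try exact: measurable_itv.
have EA : lebesgue_measure A = t%:E.
  by rewrite /A lebesgue_measure_itv /= lte_fin t0 sube0.
have EB : lebesgue_measure B = t%:E.
  rewrite /B lebesgue_measure_itv /= lte_fin gtrBl t0 -EFinD; congr EFin; ring.
apply: (@le_trans _ _ (t%:E + t%:E)%E).
  by apply: leeD; [rewrite -EA; exact: lexx|rewrite -EB; exact: lexx].
rewrite -EFinD lee_fin /t /arc_const le_eqVlt; apply/orP; left; apply/eqP; ring.
Qed.

End arc_measure.

(** * Hardy norms *)

Section hardy_means.
Variable R : realType.
Implicit Types (f : R[i] -> R[i]) (p r n : R).
Local Notation e := (circle_point (1 : R)).
Local Notation arc := (`]0%R, (2 * pi)%R[%classic : set (measurableTypeR R)).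
Local Notation leb := (@lebesgue_measure R).

Definition trace f r (x : R) : R := nc (f (circle_point r x)).

Lemma trace_ge0 f r x : 0 <= trace f r x. Proof. exact: nc_ge0. Qed.

Lemma measurable_trace f r : analytic_in_disc f -> 0 <= r < 1 ->
  measurable_fun setT (trace f r : measurableTypeR R -> R).
Proof. by move=> fa rr; apply: continuous_measurable_fun; exact: continuous_nc_analytic. Qed.

Lemma measurable_powR_comp dd (T : measurableType dd) (F : T -> R) p :
  measurable_fun setT F -> measurable_fun setT (fun x => F x `^ p).
Proof. by move=> mF; exact: (@measurableT_comp _ _ _ _ _ _ _ _ _ (measurable_powR p) mF). Qed.

Lemma circ_arc_integral (F : measurableTypeR R -> R) : measurable_fun setT F ->
  (\int[leb]_(x in `[0%R, (2 * pi)%R]) (F x)%:E = \int[leb]_(x in arc) (F x)%:E)%E.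
Proof.
move=> mF; apply: (@integral_itv_bndoo R 0 (2 * pi) (EFin \o F) true false).
by apply/measurable_EFinP; exact: measurable_funTS.
Qed.

Lemma integral_mean_arc p r f : analytic_in_disc f -> 0 <= r < 1 ->
  integral_mean p r f =
  (((2 * pi)^-1%:E * \int[leb]_(x in arc) (trace f r x `^ p)%:E) `^ p^-1)%E.
Proof.
move=> fa rr; rewrite /integral_mean; congr (poweR (_ * _) _)%E.
by rewrite -circ_arc_integral//; apply: measurable_powR_comp; exact: measurable_trace.
Qed.

Lemma cmean_arc (F : R -> R) : continuous F ->
  (cmean F)%:E = ((2 * pi)^-1%:E * \int[leb]_(x in arc) (F x)%:E)%E.
Proof.
move=> Fc; rewrite cmeanE//; congr (_ * _)%E.
by apply: circ_arc_integral; exact: continuous_measurable_fun.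
Qed.

Lemma arc_integral_ge0 (F : R -> R) : (forall x, 0 <= F x) ->
  (0 <= \int[leb]_(x in arc) (F x)%:E)%E.
Proof. by move=> F0; apply: integral_ge0 => x _; rewrite lee_fin. Qed.

Lemma hardy_norm_ge0 p f : (0 <= hardy_norm p f)%E.
Proof.
apply: le_ereal_sup_tmp; exists (integral_mean p 2^-1 f); last exact: poweR_ge0.
exists 2^-1 => //=; rewrite in_itv /= invr_gt0 ltr0n /=.
by rewrite invf_lt1// ltr1n.
Qed.

Lemma trace_power_le p n r f : 0 < p -> analytic_in_disc f -> 0 < r < 1 ->
  (hardy_norm p f <= n%:E)%E ->
  (\int[leb]_(x in arc) (trace f r x `^ p)%:E <= (2 * pi * n `^ p)%:E)%E.
Proof.
move=> p0 fa /andP[r0 r1] fn.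
have rr : 0 <= r < 1 by rewrite ltW.
have h : (integral_mean p r f <= n%:E)%E.
  apply: le_trans fn; apply: ereal_sup_ubound; exists r => //=.
  by rewrite in_itv /= r0.
rewrite integral_mean_arc// in h.
set I := (\int[_]_(_ in _) _)%E in h *.
have I0 : (0 <= I)%E by apply: arc_integral_ge0 => x; exact: powR_ge0.
have X0 : (0 <= (2 * pi)^-1%:E * I)%E by rewrite mule_ge0// lee_fin invr_ge0 ltW// pi2_gt0.
have := lee_poweR (ltW p0) (poweR_ge0 _ _) h.
rewrite -poweRrM mulVf ?gt_eqF// poweRe1// poweR_EFin => h'.
rewrite EFinM muleC -lee_pdivrMr ?pi2_gt0//.
by rewrite muleC.
Qed.

Lemma hardy_norm_le p (B : R) f : 0 < p -> 0 <= B -> analytic_in_disc f ->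
  (forall r, 0 < r < 1 ->
    (\int[leb]_(x in arc) (trace f r x `^ p)%:E <= (2 * pi * B `^ p)%:E)%E) ->
  (hardy_norm p f <= B%:E)%E.
Proof.
move=> p0 B0 fa h; apply: ge_ereal_sup => y [r /= + <-]; rewrite in_itv /= => /andP[r0 r1].
have rr : 0 <= r < 1 by rewrite ltW.
rewrite integral_mean_arc//.
have := h r; rewrite r0 r1 => /(_ isT) {}h.
rewrite -[leRHS](poweRe1 (_ : 0 <= B%:E)%E) ?lee_fin//.
rewrite -[X in (_ <= _ `^ X)%E](@mulfV _ p) ?gt_eqF// poweRrM poweR_EFin.
apply: lee_poweR.
- by rewrite invr_ge0 ltW.
- rewrite mule_ge0// ?lee_fin ?invr_ge0 ?(ltW (pi2_gt0 R))//.
  by apply: arc_integral_ge0 => x; exact: powR_ge0.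
by rewrite muleC lee_pdivrMr ?pi2_gt0// -EFinM (mulrC (B `^ p)).
Qed.

(** Hoelder's inequality, for the normalized measure of the circle. *)
Lemma cmean_trace_le p n r f : 1 <= p -> 0 <= n -> analytic_in_disc f -> 0 < r < 1 ->
  (hardy_norm p f <= n%:E)%E -> cmean (trace f r) <= n.
Proof.
move=> p1 n0 fa rr fn.
have p0 : 0 < p by lra.
have rr' : 0 <= r < 1 by case/andP: rr => /ltW -> ->.
have H := trace_power_le p0 fa rr fn.
have tc : continuous (trace f r) by exact: continuous_nc_analytic.
rewrite -lee_fin cmean_arc//.
rewrite muleC lee_pdivrMr ?pi2_gt0//.
move: p1; rewrite le_eqVlt => /predU1P[p1|p1].
  move: H; rewrite -p1 (powRr1 n0) -EFinM (mulrC n) => H; apply: le_trans H.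
  rewrite le_eqVlt; apply/orP; left; apply/eqP; apply: eq_integral => x _.
  by rewrite powRr1// trace_ge0.
pose q := (1 - p^-1)^-1.
have pi1 : p^-1 < 1 by rewrite invf_lt1.
have q0 : 0 < q by rewrite invr_gt0 subr_gt0.
have pq : p^-1 + q^-1 = 1 by rewrite /q invrK; ring.
have mt := measurable_trace fa rr'.
have marc : measurable arc by exact: measurable_itv.
have := @hoelder_on _ _ R leb arc marc (trace f r) (cst 1) p q mt (measurable_cst _)
  (fun x => trace_ge0 _ _ x) (fun=> ler01) p0 q0 pq.
under eq_integral do rewrite mulr1.
move=> /le_trans; apply.
under [X in (_ * X `^ _)%E]eq_integral do rewrite /= powR1.
have aL : lebesgue_measure arc = (2 * pi)%:E.
  by rewrite lebesgue_measure_itv /= lte_fin pi2_gt0 sube0.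
have E1 : (\int[leb]_(_ in arc) 1 = (2 * pi)%:E)%E by rewrite integral_cst// mul1e -aL.
rewrite E1.
apply: (@le_trans _ _ (((2 * pi * n `^ p)%:E `^ p^-1) * (2 * pi)%:E `^ q^-1)%E).
  apply: lee_wpmul2r; first exact: poweR_ge0.
  apply: lee_poweR => //; first by rewrite invr_ge0 ltW.
  by apply: arc_integral_ge0 => x; exact: powR_ge0.
rewrite !poweR_EFin -EFinM lee_fin powRM ?powR_ge0 ?(ltW (pi2_gt0 R))//.
rewrite -powRrM mulfV ?gt_eqF// powRr1// mulrAC -powRD; last first.
  by rewrite pq oner_eq0.
by rewrite pq powRr1 ?(ltW (pi2_gt0 R))// mulrC.
Qed.

Lemma measurable_radial f : analytic_in_disc f ->
  measurable_fun setT ((fun t => nc (f t%:C)) \_ `[0%R, 1%R[ : measurableTypeR R -> R).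
Proof.
move=> fa; have mI : measurable (`[0%R, 1%R[%classic : set (measurableTypeR R)).
  exact: measurable_itv.
apply/(measurable_restrictT _ mI); apply: subspace_continuous_measurable_fun => //.
apply: continuous_in_subspaceT => x; rewrite inE /= in_itv /= => /andP[x0 x1].
apply: ccont_nc; apply: ccont_analytic => //; last exact: ccont_real.
by rewrite /unit_disc /mkset nc_real ger0_norm.
Qed.

End hardy_means.

(** * Moments and Carleson measures on the radius *)

Section measure_on_radius.
Variable R : realType.
Variable mu : {finite_measure set (measurableTypeR R) -> \bar R}.
Local Notation I01 := (`[0%R, 1%R[%classic : set (measurableTypeR R)).

(** The absolute value makes the distance nonnegative on the whole line. *)
Definition gap (t : measurableTypeR R) : R := `|1 - t|.

Lemma gap_ge0 t : 0 <= gap t. Proof. exact: normr_ge0. Qed.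

Lemma gapE t : I01 t -> gap t = 1 - t.
Proof. by rewrite /= in_itv /= => /andP[t0 t1]; rewrite /gap ger0_norm// subr_ge0 ltW. Qed.

Lemma gap_gt0 t : I01 t -> 0 < gap t.
Proof. by move=> h; rewrite gapE//; move: h; rewrite /= in_itv /= subr_gt0 => /andP[]. Qed.

Lemma measurable_I01 : measurable I01. Proof. exact: measurable_itv. Qed.

Lemma measurable_gap : measurable_fun setT gap.
Proof.
apply: continuous_measurable_fun => t; apply: cvg_norm.
by apply: continuousB; [exact: cvg_cst|exact: cvg_id].
Qed.

Lemma sublevel_gap (s : R) : 0 <= s <= 1 ->
  I01 `&` [set t | gap t <= s] = `[1 - s, 1[%classic.
Proof.
move=> /andP[s0 s1]; apply/seteqP; split => t /=; rewrite !in_itv /=.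
  by move=> [/andP[t0 t1]]; rewrite gapE /= ?in_itv /= ?t0 ?t1// => h; lra.
move=> /andP[ts t1]; have t0 : 0 <= t by lra.
by split; rewrite ?t0 ?t1// gapE /= ?in_itv /= ?t0 ?t1//; lra.
Qed.

Lemma carleson_small (C : R) : 0 <= C ->
  (forall t : R, 0 <= t < 1 -> (mu `[t, 1%R[%classic <= (C * (1 - t))%:E)%E) ->
  forall s : R, 0 < s -> (mu (I01 `&` [set t | (gap t <= s)%R]) <= (C * s)%:E)%E.
Proof.
move=> C0 hC s s0; have [s1|s1] := leP s 1.
  rewrite sublevel_gap ?s1 ?(ltW s0)//; have := hC (1 - s).
  by rewrite opprB addrCA subrr addr0; apply; lra.
apply: (@le_trans _ _ (mu I01)).
  apply: le_measure; rewrite ?inE//.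
  apply: measurableI; first exact: measurable_I01.
  exact: measurable_sublevel measurable_gap s.
have := hC 0; rewrite subr0 mulr1 lexx ltr01 => /(_ isT) /le_trans; apply.
by rewrite lee_fin ler_peMr// ltW.
Qed.

Lemma bounded_integrable (F : measurableTypeR R -> R) (B : R) :
  measurable_fun I01 F -> (forall t, I01 t -> `|F t| <= B) ->
  mu.-integrable I01 (EFin \o F).
Proof.
move=> mF FB; apply: (@le_integrable _ _ _ mu I01 measurable_I01 _ (EFin \o cst B)).
- exact/measurable_EFinP.
- move=> t It; rewrite /= lee_fin; apply: (le_trans (FB t It)); exact: ler_norm.
by apply: finite_measure_integrable_cst; exact: measurable_I01.
Qed.

Lemma measurable_pow n : measurable_fun I01 (fun t : measurableTypeR R => t ^+ n).
Proof. by apply: measurable_funTS; exact: measurable_funX. Qed.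

Lemma pow_integrable n : mu.-integrable I01 (EFin \o (fun t : R => t ^+ n)).
Proof.
apply: (@bounded_integrable _ 1); first exact: measurable_pow.
move=> t; rewrite /= in_itv /= => /andP[t0 t1].
by rewrite ger0_norm ?exprn_ge0// exprn_ile1// ltW.
Qed.

Lemma momentE n : ((moment mu n)%:E = \int[mu]_(t in I01) (t ^+ n)%:E)%E.
Proof.
rewrite /moment /Rintegral fineK//.
exact: (integrable_fin_num measurable_I01 (pow_integrable n)).
Qed.

Lemma moment_ge0 n : 0 <= moment mu n.
Proof.
rewrite -lee_fin momentE; apply: integral_ge0 => t; rewrite /= in_itv /= => /andP[t0 _].
by rewrite lee_fin exprn_ge0.
Qed.

Lemma moment_decr n k : moment mu (n + k) <= moment mu k.
Proof.
rewrite -lee_fin !momentE; apply: ge0_le_integral; first exact: measurable_I01.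
- by move=> t; rewrite /= in_itv /= => /andP[t0 _]; rewrite lee_fin exprn_ge0.
- by apply/measurable_EFinP; exact: measurable_pow.
- by apply/measurable_EFinP; exact: measurable_pow.
move=> t; rewrite /= in_itv /= => /andP[t0 t1]; rewrite lee_fin exprD.
by rewrite ler_piMl ?exprn_ge0// exprn_ile1// ltW.
Qed.

Lemma moment_ge (r : R) n : 0 <= r < 1 ->
  r ^+ n * fine (mu `[r, 1%R[%classic) <= moment mu n.
Proof.
move=> /andP[r0 r1]; have mr : measurable (`[r, 1%R[%classic : set (measurableTypeR R)).
  exact: measurable_itv.
have rfin : (mu `[r, 1%R[%classic) \is a fin_num by exact: fin_num_measure.
rewrite -lee_fin EFinM fineK// momentE.
rewrite -integral_cst//; apply: (@le_trans _ _ (\int[mu]_(t in `[r, 1%R[%classic) (t ^+ n)%:E)%E).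
  apply: ge0_le_integral => //.
  - by move=> t _; rewrite lee_fin exprn_ge0.
  - by apply/measurable_EFinP/measurable_funTS; exact: measurable_funX.
  move=> t; rewrite /= in_itv /= => /andP[rt t1]; rewrite lee_fin lerXn2r ?nnegrE//.
  exact: le_trans rt.
apply: ge0_subset_integral => //.
- by apply/measurable_EFinP; exact: measurable_pow.
- by move=> t; rewrite /= in_itv /= => /andP[t0 _]; rewrite lee_fin exprn_ge0.
by move=> t; rewrite /= !in_itv /= => /andP[rt ->]; rewrite (le_trans r0 rt).
Qed.

(** A lower Riemann sum of [t ^ k] on the dyadic partition of the radius. *)
Lemma dyadic_power_sum k n :
  \sum_(j < n) 2^-1 ^+ j * (1 - 2^-1 ^+ j.+1) ^+ k <= 4 / k.+1%:R :> R.
Proof.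
pose t j : R := 1 - 2^-1 ^+ j.+1.
have h0 j : 0 <= 2^-1 ^+ j :> R by rewrite exprn_ge0// invr_ge0.
have h1 j : 2^-1 ^+ j <= 1 :> R by rewrite exprn_ile1// ?invr_ge0// invf_le1// ler1n.
have tS j : t j.+1 - t j = 2^-1 ^+ j / 4 by rewrite /t !exprS; field.
have t0 j : 0 <= t j by rewrite /t subr_ge0.
have step (x y : R) : 0 <= x -> x <= y ->
    k.+1%:R * ((y - x) * x ^+ k) <= y ^+ k.+1 - x ^+ k.+1.
  move=> x0 xy; have y0 := le_trans x0 xy.
  rewrite subrXX mulrCA ler_wpM2l ?subr_ge0//.
  rewrite mulr_natl -[X in _ *+ X]card_ord -sumr_const; apply: ler_sum => i _.
  rewrite -{1}(subnK (ltnSE (ltn_ord i))) exprD ler_wpM2r ?exprn_ge0//.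
  by rewrite /= lerXn2r.
have H : k.+1%:R * \sum_(j < n) (t j.+1 - t j) * t j ^+ k <= t n ^+ k.+1.
  elim: n => [|n IH]; first by rewrite big_ord0 mulr0 exprn_ge0.
  rewrite big_ord_recr /= mulrDr.
  have tt : t n <= t n.+1 by rewrite -subr_ge0 tS divr_ge0.
  by have := step _ _ (t0 n) tt; lra.
have tn1 : t n ^+ k.+1 <= 1 by rewrite exprn_ile1// /t gerBl.
rewrite ler_pdivlMr// mulrC.
rewrite (_ : \sum_(j < n) _ = 4 * \sum_(j < n) (t j.+1 - t j) * t j ^+ k); first by lra.
by rewrite mulr_sumr; apply: eq_bigr => j _; rewrite tS; field.
Qed.

(** Integration of [t ^ k] against a weight that grows like the number of
    dyadic scales, for a measure whose mass decays accordingly. *)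
Lemma weighted_moment_le (L : measurableTypeR R -> R) (l M : nat -> R) (K : R) k :
  measurable_fun setT L -> (forall t, 0 <= L t) -> (forall j, 0 <= l j) ->
  (forall j, (mu (I01 `&` [set t | (gap t <= 2^-1 ^+ j)%R]) <= (M j)%:E)%E) ->
  (forall j t, I01 t -> 2^-1 ^+ j.+1 <= gap t -> L t <= l j) ->
  (forall j, l j * M j <= K * 2^-1 ^+ j) -> 0 <= K ->
  (\int[mu]_(t in I01) (L t * t ^+ k)%:E <= (K * (4 / k.+1%:R))%:E)%E.
Proof.
move=> mL L0 l0 hM hL lM K0.
have -> : (\int[mu]_(t in I01) (L t * t ^+ k)%:E = \int[mu]_(t in I01) (L t * `|t| ^+ k)%:E)%E.
  apply: eq_integral => t; rewrite inE /= in_itv /= => /andP[t0 _].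
  by rewrite ger0_norm.
have h0 j : 0 <= 2^-1 ^+ j :> R by rewrite exprn_ge0// invr_ge0.
have h1 j : 2^-1 ^+ j <= 1 :> R by rewrite exprn_ile1// ?invr_ge0// invf_le1// ler1n.
apply: (@dyadic_integral_mass _ _ R mu I01 gap measurable_I01 measurable_gap _
  (fun j => l j * (1 - 2^-1 ^+ j.+1) ^+ k) (fun j => 2^-1 ^+ j) M
  (fun=> 0) (fun j => 2^-1 ^+ j) M).
- apply: measurable_funM => //; apply: measurable_funX.
  exact: (measurableT_comp (@normr_measurable R setT)).
- by move=> t; rewrite mulr_ge0// exprn_ge0.
- by move=> j; rewrite mulr_ge0// exprn_ge0// subr_ge0.
- by [].
- exact: hM.
- exact: hM.
- move=> t It; have g0 := gap_gt0 It.
  have t01 : 0 <= t < 1 by move: It; rewrite /= in_itv.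
  have g1 : gap t <= 1 by rewrite gapE//; lra.
  have [j /andP[a1 a2]] := dyadic_scale g0 g1.
  have p2 i : 0 < 2 ^+ i :> R by rewrite exprn_gt0.
  have b1 : gap t <= 2^-1 ^+ j by rewrite exprVn -[leRHS]mul1r ler_pdivlMr// mulrC.
  have b2 : 2^-1 ^+ j.+1 <= gap t.
    by rewrite exprVn -[leLHS]mul1r ler_pdivrMr// mulrC ltW.
  exists j; left; split => //; apply: ler_pM; rewrite ?exprn_ge0//; first exact: hL.
  case/andP: t01 => t0 t1; rewrite ger0_norm// lerXn2r ?nnegrE//.
    by rewrite subr_ge0.
  by move: b2; rewrite gapE//; lra.
move=> n; apply: (@le_trans _ _ (\sum_(j < n) K * (2^-1 ^+ j * (1 - 2^-1 ^+ j.+1) ^+ k))).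
  apply: ler_sum => j _; rewrite mul0r addr0 mulrAC mulrA.
  by rewrite ler_wpM2r// exprn_ge0// subr_ge0.
by rewrite -mulr_sumr ler_wpM2l// dyadic_power_sum.
Qed.

Lemma carleson_moment_le (C : R) k : 0 <= C ->
  (forall t : R, 0 <= t < 1 -> (mu `[t, 1%R[%classic <= (C * (1 - t))%:E)%E) ->
  moment mu k <= C * (4 / k.+1%:R).
Proof.
move=> C0 hC; rewrite -lee_fin momentE.
have := @weighted_moment_le (cst 1) (fun=> 1) (fun j => C * 2^-1 ^+ j) C k.
under eq_integral do rewrite mul1r.
apply => //.
- by move=> j; apply: carleson_small => //; rewrite exprn_gt0// invr_gt0.
- by move=> j; rewrite mul1r.
Qed.

End measure_on_radius.
Arguments measurable_I01 {R}.

(** * The image of a power series under the Hankel matrix *)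

Section hankel_image.
Variable R : realType.
Variable mu : {finite_measure set (measurableTypeR R) -> \bar R}.
Local Notation I01 := (`[0%R, 1%R[%classic : set (measurableTypeR R)).
Implicit Types (a b : nat -> R[i]) (f g : R[i] -> R[i]).

Lemma moment_sum_integral (I : Type) (r : seq I) (c : I -> R) (m : I -> nat) :
  mu.-integrable I01 (EFin \o (fun t : R => \sum_(i <- r) c i * t ^+ m i)) /\
  \int[mu]_(t in I01) (\sum_(i <- r) c i * t ^+ m i) =
  \sum_(i <- r) c i * moment mu (m i).
Proof.
elim: r => [|i r [IH1 IH2]].
  rewrite big_nil (_ : (fun t : R => _) = fun=> 0); last first.
    by apply/funext => t; rewrite big_nil.
  split; last by rewrite Rintegral_cst//= mul0r.
  by apply: finite_measure_integrable_cst; exact: measurable_I01.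
have ii : mu.-integrable I01 (EFin \o (fun t : R => c i * t ^+ m i)).
  have h := integrableZl (@measurable_I01 R) (c i) (pow_integrable mu (m i)).
  by move: h; congr (_.-integrable _ _); apply/funext => t; rewrite /= EFinM.
rewrite big_cons (_ : (fun t : R => _) = (fun t => c i * t ^+ m i) \+
  (fun t : R => \sum_(j <- r) c j * t ^+ m j)); last first.
  by apply/funext => t; rewrite big_cons.
split.
  have h := integrableD (@measurable_I01 R) ii IH1.
  by move: h; congr (_.-integrable _ _).
rewrite RintegralD//; congr (_ + _) => //.
by rewrite RintegralZl//; exact: pow_integrable.
Qed.

Lemma ccont_measurable (G : R -> R[i]) : (forall x, I01 x -> ccont_at G x) ->
  measurable_fun I01 (fun t : measurableTypeR R => nc (G t)).
Proof.
move=> Gc; apply: subspace_continuous_measurable_fun; first exact: measurable_I01.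
by apply: continuous_in_subspaceT => x; rewrite inE => Ix; apply: ccont_nc; exact: Gc.
Qed.

(** The triangle inequality for the integral of a complex polynomial over [mu];
    rotating the sum onto its modulus reduces it to the real case. *)
Lemma moment_sum_bound (I : Type) (r : seq I) (c : I -> R[i]) (m : I -> nat) :
  ((nc (\sum_(i <- r) c i * (moment mu (m i))%:C))%:E <=
   \int[mu]_(t in I01) (nc (\sum_(i <- r) c i * t%:C ^+ m i))%:E)%E.
Proof.
set S := \sum_(i <- r) _.
have [u u1 uS] := unimodular_rotation S.
have Re_lin (x : I -> R) : Re (u * \sum_(i <- r) c i * (x i)%:C) =
    \sum_(i <- r) Re (u * c i) * x i.
  rewrite mulr_sumr raddf_sum; apply: eq_bigr => i _.
  by rewrite mulrA [LHS]ReM /= mulr0 subr0.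
have -> : nc S = Re (u * S) by rewrite uS.
rewrite Re_lin.
have [i1 <-] := moment_sum_integral r (fun i => Re (u * c i)) m.
rewrite /Rintegral fineK; last by apply: integrable_fin_num => //; exact: measurable_I01.
apply: (@le_trans _ _ (\int[mu]_(t in I01) `|(\sum_(i <- r) Re (u * c i) * t ^+ m i)%:E|)%E).
  apply: le_trans (lee_abs _) _.
  apply: le_abse_integral; first exact: measurable_I01.
  by have /integrableP[] := i1.
apply: ge0_le_integral; first exact: measurable_I01.
- by move=> t _; exact: abse_ge0.
- by apply: measurableT_comp => //; have /integrableP[] := i1.
- apply/measurable_EFinP; apply: ccont_measurable => x _.
  by apply: ccont_sum => i; apply: ccontM; [exact: ccont_cst|apply: ccontX; exact: ccont_real].
move=> t _; rewrite abse_EFin lee_fin.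
have E : \sum_(i <- r) c i * t%:C ^+ m i = \sum_(i <- r) c i * (t ^+ m i)%:C.
  by apply: eq_bigr => i _; rewrite rmorphXn.
rewrite E -Re_lin; apply: le_trans (absRe_le_nc _) _.
by rewrite Normc.normcM u1 mul1r.
Qed.

Section image.
Variables (a : nat -> R[i]) (S : R).
Hypothesis aS : forall M, \sum_(k < M) nc (a k) * moment mu k <= S.

Lemma hankel_coefficients_ex :
  exists b, hankel_coefficients mu a b /\ forall n, nc (b n) <= S.
Proof.
have bd n M : \sum_(k < M) nc ((moment mu (n + k))%:C * a k) <= S.
  apply: le_trans (aS M); apply: ler_sum => k _.
  rewrite Normc.normcM nc_real ger0_norm ?moment_ge0// mulrC.
  by rewrite ler_wpM2l ?nc_ge0// moment_decr.
have [b hb] := choice (fun n =>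
  @abs_series_cvg R (fun k => (moment mu (n + k))%:C * a k) S (bd n)).
exists b; split=> // n; apply: (cvg_nc_le (hb n)) => M.
by rewrite /series /= big_mkord; apply: le_trans (nc_sum _ _ _) (bd n M).
Qed.

Lemma bounded_power_series b : (forall n, nc (b n) <= S) ->
  exists g, power_series_in_disc b g.
Proof.
move=> bS; have S0 : 0 <= S by apply: le_trans (bS 0%N); exact: nc_ge0.
suff ex z : exists w : R[i], unit_disc z ->
    series (fun k => b k * z ^+ k) @ \oo --> (w : R[i]^o).
  by have [g hg] := choice ex; exists g => z; exact: hg.
have [zd|zd] := pselect (unit_disc z); last by exists 0.
have [|w hw] := @abs_series_cvg _ (fun k => b k * z ^+ k) (S * (1 - nc z)^-1).
  move=> n; apply: (@le_trans _ _ (S * \sum_(k < n) nc z ^+ k)); last first.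
    by rewrite ler_wpM2l// geom_sum_le// nc_ge0.
  rewrite mulr_sumr; apply: ler_sum => k _.
  by rewrite Normc.normcM ncX ler_wpM2r// exprn_ge0// nc_ge0.
by exists w.
Qed.

Lemma abs_sum_integral_le (W : measurableTypeR R -> R) :
  measurable_fun I01 W -> (forall t, I01 t -> 0 <= W t) ->
  (\int[mu]_(t in I01) \sum_(0 <= k <oo) ((nc (a k) * t ^+ k) * W t)%:E =
   \sum_(0 <= k <oo) (nc (a k))%:E * \int[mu]_(t in I01) (W t * t ^+ k)%:E)%E.
Proof.
move=> mW W0; rewrite integral_nneseries; first last.
- move=> k t It; rewrite lee_fin mulr_ge0 ?W0// mulr_ge0 ?nc_ge0// exprn_ge0//.
  by move: It; rewrite /= in_itv /= => /andP[].
- move=> k; apply/measurable_EFinP; apply: measurable_funM => //.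
  by apply: measurable_funM => //; exact: measurable_pow.
- exact: measurable_I01.
apply: eq_eseriesr => k _; rewrite -ge0_integralZl//; first last.
- by rewrite lee_fin nc_ge0.
- move=> t It; rewrite lee_fin mulr_ge0 ?W0// exprn_ge0//.
  by move: It; rewrite /= in_itv /= => /andP[].
- by apply/measurable_EFinP; apply: measurable_funM => //; exact: measurable_pow.
by apply: eq_integral => t _; rewrite -EFinM; congr EFin; ring.
Qed.

Lemma abs_sum_moment_le :
  (\sum_(0 <= k <oo) (nc (a k))%:E * (moment mu k)%:E <= S%:E)%E.
Proof.
apply: lime_le.
  by apply: is_cvg_nneseries => k _ _; rewrite -EFinM lee_fin mulr_ge0 ?nc_ge0 ?moment_ge0.
apply: nearW => n; rewrite big_mkord.
under eq_bigr do rewrite -EFinM.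
by rewrite sumEFin lee_fin.
Qed.

Lemma cvg_EFin_nc u (l : R[i]) : u @ \oo --> (l : R[i]^o) ->
  (fun n => (nc (u n))%:E) @ \oo --> (nc l)%:E.
Proof. by move/cvg_nc => h; apply: cvg_EFin; [exact: nearW|exact: h]. Qed.

Lemma kernel_pos (t : R) z : I01 t -> unit_disc z -> 1 - nc z <= nc (1 - t%:C * z).
Proof.
rewrite /= in_itv /= => /andP[t0 t1] zd.
apply: le_trans (nc_sub_le _ _); rewrite Normc.normc1 Normc.normcM nc_real.
by rewrite ger0_norm// lerD2l lerN2 ler_piMl ?nc_ge0// ltW.
Qed.

Lemma measurable_kernel z : unit_disc z ->
  measurable_fun I01 (fun t : measurableTypeR R => 2 / nc (1 - t%:C * z)).
Proof.
move=> zd; apply: measurable_funM => //.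
have m1 : measurable_fun setT (fun t : measurableTypeR R => nc (1 - t%:C * z)).
  apply: continuous_measurable_fun => t; apply: ccont_nc; apply: ccontD.
    exact: ccont_cst.
  rewrite (_ : (fun y => _) = fun y => y%:C * (- z)); last first.
    by apply/funext => y; rewrite mulrN.
  by apply: ccontM; [exact: ccont_real|exact: ccont_cst].
by apply: measurable_funTS; apply: measurable_inv_ge0 => // t; exact: nc_ge0.
Qed.

(** The image function is the integral of [f t / (1 - t z)]. The order of
    summation and integration is exchanged for polynomials only; the limits are
    taken afterwards, by dominated convergence. *)
Lemma hankel_pointwise_bound f b g : power_series_in_disc a f ->
  hankel_coefficients mu a b -> power_series_in_disc b g ->
  forall z, unit_disc z ->
  ((nc (g z))%:E <= \int[mu]_(t in I01) (nc (f t%:C) * (2 / nc (1 - t%:C * z)))%:E)%E.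
Proof.
move=> af hb bg z zd.
set W := fun t : R => 2 / nc (1 - t%:C * z).
have z1 : nc z < 1 := zd.
have W0 t : 0 <= W t by rewrite divr_ge0 ?nc_ge0.
have mW : measurable_fun I01 W by exact: measurable_kernel.
pose B := 2 / (1 - nc z).
have WB t : I01 t -> W t <= B.
  move=> It; rewrite ler_pM2l// lef_pV2 ?posrE ?subr_gt0//; first exact: kernel_pos.
  by apply: lt_le_trans (kernel_pos It zd); rewrite subr_gt0.
have B0 : 0 <= B by rewrite divr_ge0// subr_ge0 ltW.
have term0 k t : I01 t -> 0 <= nc (a k) * t ^+ k * B.
  rewrite /= in_itv /= => /andP[t0 t1]; apply: mulr_ge0 => //.
  by apply: mulr_ge0; [exact: nc_ge0|exact: exprn_ge0].
pose s K t : R[i] := series (fun k => a k * t%:C ^+ k) K.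
have ms K : measurable_fun I01 (fun t : measurableTypeR R => nc (s K t)).
  apply: ccont_measurable => x _; rewrite /s /series /=.
  by apply: ccont_sum => k; apply: ccontM; [exact: ccont_cst|apply: ccontX; exact: ccont_real].
have fd (t : R) : I01 t -> unit_disc t%:C.
  rewrite /= in_itv /= => /andP[t0 t1].
  by rewrite /unit_disc /mkset nc_real ger0_norm.
have mf : measurable_fun I01 (fun t : measurableTypeR R => nc (f t%:C)).
  apply: ccont_measurable => x Ix; apply: ccont_analytic; last exact: ccont_real.
    exact: power_series_analytic af.
  exact: fd.
have lim : (fun K => \int[mu]_(t in I01) (nc (s K t) * W t)%:E)%E @ \oo -->
    (\int[mu]_(t in I01) (nc (f t%:C) * W t)%:E)%E.
  pose G (t : measurableTypeR R) : \bar R := (\sum_(0 <= k <oo) ((nc (a k) * t ^+ k) * B)%:E)%E.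
  have [] := @dominated_convergence _ _ _ mu I01 measurable_I01
    (fun K (t : measurableTypeR R) => (nc (s K t) * W t)%:E)
    (fun t : measurableTypeR R => (nc (f t%:C) * W t)%:E) G.
  - by move=> K; apply/measurable_EFinP; exact: measurable_funM.
  - by apply/measurable_EFinP; exact: measurable_funM.
  - apply: aeW => t It.
    under eq_fun do rewrite EFinM.
    by rewrite EFinM; apply: cvgeZr => //; apply: cvg_EFin_nc; exact: (af _ (fd _ It)).
  - apply/integrableP; split.
      apply: ge0_emeasurable_sum => [k t It _|k _].
        by rewrite lee_fin term0.
      apply/measurable_EFinP; apply: measurable_funM => //.
      by apply: measurable_funM => //; exact: measurable_pow.
    have G0 t : I01 t -> (0 <= G t)%E.
      by move=> It; apply: nneseries_ge0 => k _ _; rewrite lee_fin term0.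
    under eq_integral => t /[!inE] It do rewrite gee0_abs ?G0//.
    rewrite /G (abs_sum_integral_le (W := fun=> B))//.
    apply: (@le_lt_trans _ _ (B%:E * S%:E)%E); last by rewrite -EFinM ltry.
    apply: le_trans (lee_wpmul2l _ abs_sum_moment_le); rewrite ?lee_fin//.
    rewrite -nneseriesZl; last first.
      by move=> k _; rewrite -EFinM lee_fin mulr_ge0 ?nc_ge0 ?moment_ge0.
    apply: lee_nneseries => k _.
      rewrite mule_ge0 ?lee_fin ?nc_ge0//; apply: integral_ge0 => t It.
      by rewrite lee_fin mulr_ge0// exprn_ge0//; move: It; rewrite /= in_itv /= => /andP[].
    rewrite le_eqVlt; apply/orP; left; apply/eqP.
    under eq_integral do rewrite EFinM.
    rewrite ge0_integralZl//; first by rewrite momentE muleCA.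
    - by apply/measurable_EFinP; exact: measurable_pow.
    - by move=> t; rewrite /= in_itv /= => /andP[t0 _]; rewrite lee_fin exprn_ge0.
  - apply: aeW => t K It; rewrite gee0_abs; last first.
      by rewrite lee_fin; apply: mulr_ge0; [exact: nc_ge0|exact: W0].
    apply: (@le_trans _ _ (\sum_(k < K) (nc (a k) * t ^+ k * B)%:E)%E).
      rewrite sumEFin lee_fin -mulr_suml; apply: ler_pM; rewrite ?nc_ge0 ?WB//.
      rewrite /s /series /= big_mkord; apply: le_trans (nc_sum _ _ _) _.
      apply: ler_sum => k _; rewrite Normc.normcM ncX nc_real ger0_norm//.
      by move: It; rewrite /= in_itv /= => /andP[].
    rewrite -(big_mkord xpredT (fun k => (nc (a k) * t ^+ k * B)%:E)).
    by apply: nneseries_lim_ge => k _ _; rewrite lee_fin term0.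
  by [].
have partial N : ((nc (series (fun n => b n * z ^+ n) N))%:E <=
    \int[mu]_(t in I01) (nc (f t%:C) * W t)%:E)%E.
  have cT : (fun K => \sum_(n < N) series (fun k => (moment mu (n + k))%:C * a k) K * z ^+ n)
      @ \oo --> (\sum_(n < N) b n * z ^+ n : R[i]^o).
    elim: N => [|N IH].
      apply/cvgC_near => d d0; apply: nearW => K.
      by rewrite !big_ord0 subrr Normc.normc0.
    have hN := hb N.
    apply/cvgC_near => d d0.
    have /cvgC_near IH' := IH; have /cvgC_near hN' := hN.
    have d2 : 0 < d / 2 by rewrite divr_gt0.
    apply: filterS2 (IH' _ d2) (hN' _ d2) => K h1 h2; rewrite !big_ord_recr /=.
    rewrite opprD addrACA; apply: le_lt_trans (ncD _ _) _.
    rewrite (splitr d); apply: ltrD => //; rewrite -mulrBl Normc.normcM.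
    apply: le_lt_trans h2; rewrite ler_piMr ?nc_ge0// ncX.
    by rewrite exprn_ile1 ?nc_ge0// ltW.
  rewrite [series _ N]/series /= big_mkord.
  apply: (lee_cvg_to (cvg_EFin_nc cT) lim); apply: nearW => K.
  pose c (nk : 'I_N * 'I_K) := a nk.2 * z ^+ nk.1.
  have -> : \sum_(n < N) series (fun k => (moment mu (n + k))%:C * a k) K * z ^+ n =
     \sum_nk c nk * (moment mu (nk.1 + nk.2))%:C.
    rewrite -(pair_bigA _ (fun (n : 'I_N) (k : 'I_K) => c (n, k) * (moment mu (n + k))%:C)) /=.
    apply: eq_bigr => n _; rewrite /series /= big_mkord mulr_suml.
    by apply: eq_bigr => k _; rewrite /c /=; ring.
  apply: le_trans (moment_sum_bound _ c (fun nk => nk.1 + nk.2)%N) _.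
  have E (t : R) : \sum_nk c nk * t%:C ^+ (nk.1 + nk.2) =
      (\sum_(n < N) (t%:C * z) ^+ n) * s K t.
    rewrite -(pair_bigA _ (fun (n : 'I_N) (k : 'I_K) => c (n, k) * t%:C ^+ (n + k))) /=.
    rewrite mulr_suml; apply: eq_bigr => n _.
    rewrite /s /series /= big_mkord mulr_sumr; apply: eq_bigr => k _.
    by rewrite /c /= exprD exprMn; ring.
  apply: ge0_le_integral; first exact: measurable_I01.
  - by move=> t _; rewrite lee_fin nc_ge0.
  - apply/measurable_EFinP; apply: ccont_measurable => x _.
    by apply: ccont_sum => i; apply: ccontM; [exact: ccont_cst|apply: ccontX; exact: ccont_real].
  - by apply/measurable_EFinP; exact: measurable_funM.
  move=> t It; rewrite lee_fin E Normc.normcM mulrC ler_wpM2l ?nc_ge0//.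
  have tz : nc (t%:C * z) < 1.
    move: (It); rewrite /= in_itv /= => /andP[t0 t1].
    rewrite Normc.normcM nc_real ger0_norm//; apply: le_lt_trans z1.
    by rewrite ler_piMl ?nc_ge0// ltW.
  apply: geom_kernel_le; first exact: ltW.
  by apply: contraTneq tz => ->; rewrite Normc.normc1 ltxx.
by apply: (cvge_to_le (cvg_EFin_nc (bg z zd))); apply: nearW.
Qed.

End image.
End hankel_image.

(** * The radial Carleson embedding *)

Section sufficiency.
Variable R : realType.
Variable mu : {finite_measure set (measurableTypeR R) -> \bar R}.
Local Notation I01 := (`[0%R, 1%R[%classic : set (measurableTypeR R)).
Local Notation arc := (`]0%R, (2 * pi)%R[%classic : set (measurableTypeR R)).
Local Notation leb := (@lebesgue_measure R).
Local Notation e := (circle_point (1 : R)).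
Implicit Types (a b : nat -> R[i]) (f g : R[i] -> R[i]).

(** Extended by 0, so that it is measurable on the whole line. *)
Definition radial f : measurableTypeR R -> R := (fun t => nc (f t%:C)) \_ `[0%R, 1%R[.

Lemma radialE f t : I01 t -> radial f t = nc (f t%:C).
Proof. by move=> It; rewrite /radial patchE mem_set. Qed.

Lemma radial_ge0 f t : 0 <= radial f t.
Proof. by rewrite /radial patchE; case: ifP => // _; exact: nc_ge0. Qed.

Lemma measurable_arc : measurable arc. Proof. exact: measurable_itv. Qed.

Lemma arc_chord_gt0 (x : measurableTypeR R) : arc x -> 0 < chord x.
Proof. by rewrite /= in_itv /= => h; exact: chord_gt0. Qed.

Lemma chord_le2 (x : R) : chord x <= 2.
Proof. by apply: le_trans (ncD _ _) _; rewrite ncN nc_e Normc.normc1. Qed.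

Lemma kernel_le_dist (t s x : R) : I01 t -> 0 <= s <= t ->
  2 / nc (1 - s%:C * e x) <= 6 * (gap t + chord x)^-1.
Proof.
move=> It /andP[s0 st]; have t01 : 0 <= t < 1 by move: It; rewrite /= in_itv.
have ss : 0 <= s <= 1 by lra.
have h := kernel_dist_ge x ss; have g0 := gap_gt0 It.
have c0 := chord_ge0 x; have h1 := kernel_dist_ge1 x ss.
have n0 : 0 < nc (1 - s%:C * e x) by apply: lt_le_trans h1; lra.
rewrite ler_pdivrMr// mulrAC ler_pdivlMr; last by lra.
by rewrite gapE//; lra.
Qed.

Lemma cvg_powR (u : nat -> R) (l p : R) : 0 < p -> (forall j, 0 <= u j) ->
  u @ \oo --> l -> (fun j => u j `^ p) @ \oo --> l `^ p.
Proof.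
move=> p0 u0 ul; have l0 : 0 <= l.
  rewrite -(cvg_lim (@Rhausdorff R) ul); apply: limr_ge; last exact: nearW.
  by apply/cvg_ex; exists l.
move: l0; rewrite le_eqVlt => /predU1P[l0|l0].
  rewrite -l0 powR0 ?gt_eqF//; apply/cvgn_near => d d0.
  have /cvgn_near/(_ (d `^ p^-1)) := ul; rewrite -l0 powR_gt0// => /(_ isT).
  apply: filterS => j; rewrite !subr0 !ger0_norm ?powR_ge0// => h.
  rewrite -[ltRHS](powRr1 (ltW d0)) -[X in _ < _ `^ X](@mulVf _ p) ?gt_eqF// powRrM.
  by apply: gt0_ltr_powR; rewrite ?nnegrE ?powR_ge0.
have pc : {for l, continuous (fun x : R => x `^ p)}.
  apply: differentiable_continuous; apply/derivable1_diffP.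
  by apply: derivable_powR; rewrite in_itv /= l0.
exact: (continuous_cvg _ pc ul).
Qed.

Lemma limn_einf_le (u : nat -> \bar R) (M : \bar R) :
  (forall j, (u j <= M)%E) -> (limn_einf u <= M)%E.
Proof.
move=> uM; rewrite limn_einf_lim; apply: lime_le; first exact: is_cvg_einfs.
apply: nearW => j; apply: le_trans (uM j); apply: ereal_inf_lbound.
by exists j => /=.
Qed.

Section carleson_embedding.
Variables (C : R).
Hypothesis C0 : 0 <= C.
Hypothesis hC : forall t : R, 0 <= t < 1 -> (mu `[t, 1%R[%classic <= (C * (1 - t))%:E)%E.

(** Cauchy's formula bounds the values on the radius by an integral operator with
    kernel [1 / (gap + chord)], to which Schur's test applies. It is used for the
    dilations of [f], and Fatou's lemma removes them. *)
Lemma radial_embedding (p : R) : 1 < p -> exists2 K : R, 0 <= K &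
  forall f a n, power_series_in_disc a f -> 0 <= n -> (hardy_norm p f <= n%:E)%E ->
  (\int[mu]_(t in I01) (radial f t `^ p)%:E <= (K * n `^ p)%:E)%E.
Proof.
move=> p1; have p0 : 0 < p by lra.
pose sc := @schur_const R C (arc_const R) p.
have sc0 : 0 <= sc.
  have h1 : 0 < p^-1 < 1 by rewrite invr_gt0 p0 invf_lt1.
  have h2 : 0 < 1 - p^-1 < 1 by lra.
  by rewrite mulr_ge0 ?powR_ge0// mulr_ge0// weight_const_ge0.
pose K := (6 * (2 * pi)^-1) `^ p * (sc * (2 * pi)).
have pp := pi2_gt0 R.
have K0 : 0 <= K by apply: mulr_ge0; [exact: powR_ge0|exact: mulr_ge0 sc0 (ltW pp)].
exists K => //.
move=> f a n af n0 fn.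
have fa := power_series_analytic af.
have mI := @measurable_I01 R.
have fd (s t : R) : 0 < s < 1 -> I01 t -> unit_disc (s * t)%:C.
  move=> /andP[s0 s1]; rewrite /= in_itv /= => /andP[t0 t1].
  rewrite /unit_disc /mkset nc_real ger0_norm ?mulr_ge0 ?(ltW s0)//.
  by apply: le_lt_trans t1; rewrite ler_piMl// ltW.
have mh s : 0 < s < 1 ->
    measurable_fun I01 (fun t : measurableTypeR R => nc (f (s * t)%:C)).
  move=> ss; apply: ccont_measurable => t It.
  apply: (@ccont_analytic R f (fun y => (s * y)%:C) t fa (fd _ _ ss It)).
  rewrite (_ : (fun y => _) = fun y => s%:C * y%:C); last by apply/funext => y; rewrite rmorphM.
  by apply: ccontM; [exact: ccont_cst|exact: ccont_real].
have bound s : 0 < s < 1 ->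
    (\int[mu]_(t in I01) (nc (f (s * t)%:C) `^ p)%:E <= (K * n `^ p)%:E)%E.
  move=> ss; have ss' : 0 <= s < 1 by case/andP: ss => /ltW -> ->.
  have mt := measurable_trace fa ss'.
  have H := @schur_test _ _ _ _ R mu leb I01 arc (@gap R) (@chord R : measurableTypeR R -> R) C
    (arc_const R) mI (@measurable_arc) (@measurable_gap R) (@measurable_chord R)
    (@gap_ge0 R) (@chord_ge0 R) (@gap_gt0 R) arc_chord_gt0 C0 (arc_const_ge0 R)
    (carleson_small C0 hC) (@arc_small R) p (trace f s) p1 mt (trace_ge0 f s).
  have mtK t : measurable_fun setT (fun x : measurableTypeR R => trace f s x * (gap t + chord x)^-1).
    apply: measurable_funM => //.
    apply: measurable_inv_ge0 => [|z]; last by rewrite addr_ge0 ?gap_ge0 ?chord_ge0.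
    by apply: measurable_funD => //; exact: measurable_chord.
  have mIK : measurable_fun setT (fun t : measurableTypeR R =>
      (\int[leb]_(x in arc) (trace f s x * (gap t + chord x)^-1)%:E)%E).
    apply: (@measurable_partial_integral _ _ _ _ _ leb arc measurable_arc
       (fun z => (trace f s z.2 * (gap z.1 + chord z.2)^-1)%:E)) => //.
      apply/measurable_EFinP; apply: measurable_funM; first exact: measurableT_comp.
      apply: measurable_inv_ge0 => [|z]; last by rewrite addr_ge0 ?gap_ge0 ?chord_ge0.
      apply: measurable_funD; apply: measurableT_comp => //.
        exact: measurable_gap.
      exact: measurable_chord.
    by move=> z; rewrite lee_fin mulr_ge0 ?trace_ge0// invr_ge0 addr_ge0 ?gap_ge0 ?chord_ge0.
  apply: (@le_trans _ _ (\int[mu]_(t in I01) (((6 * (2 * pi)^-1) `^ p)%:E *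
     (\int[leb]_(x in arc) (trace f s x * (gap t + chord x)^-1)%:E) `^ p))%E); last first.
    rewrite ge0_integralZl//; first last.
    - by rewrite lee_fin powR_ge0.
    - by move=> t _; exact: poweR_ge0.
    - by apply: measurable_funTS; exact: (@measurableT_comp _ _ _ _ _ _ _ _ _ (measurable_poweR p) mIK).
    rewrite /K -mulrA EFinM; apply: lee_wpmul2l; first by rewrite lee_fin powR_ge0.
    apply: (le_trans H); rewrite -(mulrA sc) [leRHS]EFinM; apply: lee_wpmul2l; first by rewrite lee_fin.
    by apply: trace_power_le.
  apply: ge0_le_integral => //.
  - by move=> t _; rewrite lee_fin powR_ge0.
  - apply/measurable_EFinP.
    exact: (@measurableT_comp _ _ _ _ _ _ _ _ _ (measurable_powR p) (mh s ss)).
  - apply/measurable_funTS/emeasurable_funM; first exact: measurable_cst.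
    exact: (@measurableT_comp _ _ _ _ _ _ _ _ _ (measurable_poweR p) mIK).
  move=> t It; have t01 : 0 <= t < 1 by move: It; rewrite /= in_itv.
  have t00 : 0 <= t <= t by case/andP: t01 => ->; rewrite lexx.
  rewrite -!poweR_EFin -poweRM; first last.
  - by apply: integral_ge0 => x _; rewrite lee_fin mulr_ge0 ?trace_ge0// invr_ge0 addr_ge0 ?gap_ge0 ?chord_ge0.
  - by rewrite lee_fin divr_ge0// ltW.
  apply: lee_poweR; rewrite ?(ltW p0) ?lee_fin ?nc_ge0//.
  have tc : continuous (trace f s) by exact: continuous_nc_analytic.
  have kc : continuous (fun x => 2 * (nc (1 - t%:C * e x))^-1).
    by apply: continuous_scale; exact: continuous_kernel.
  apply: (@le_trans _ _ (cmean (fun x => trace f s x * (2 * (nc (1 - t%:C * e x))^-1)))%:E).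
    by rewrite lee_fin; exact: (@cauchy_bound R a f s t af ss' t01).
  rewrite cmean_arc; last exact: continuous_ncM.
  rewrite (mulrC 6) [in leRHS]EFinM -[leRHS]muleA.
  apply: lee_wpmul2l; first by rewrite lee_fin invr_ge0 ltW.
  rewrite -ge0_integralZl//; first last.
  - by move=> x _; rewrite lee_fin mulr_ge0 ?trace_ge0// invr_ge0 addr_ge0 ?gap_ge0 ?chord_ge0.
  - by apply/measurable_EFinP/measurable_funTS; exact: mtK.
  apply: ge0_le_integral => //.
  - by move=> x _; rewrite lee_fin mulr_ge0 ?trace_ge0// divr_ge0// nc_ge0.
  - apply/measurable_EFinP/measurable_funTS.
    exact: (continuous_measurable_fun (continuous_ncM tc kc)).
  - by apply/measurable_funeM/measurable_EFinP/measurable_funTS; exact: mtK.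
  move=> x _; rewrite -EFinM lee_fin [leRHS]mulrCA ler_wpM2l ?trace_ge0//.
  exact: kernel_le_dist.
pose s j : R := 1 - 2^-1 ^+ j.+1.
have s01 j : 0 < s j < 1.
  have h0 : 0 < 2^-1 ^+ j.+1 :> R by rewrite exprn_gt0// invr_gt0.
  have h1 : 2^-1 ^+ j.+1 < 1 :> R by rewrite exprn_ilt1// ?invr_ge0// invf_lt1// ltr1n.
  by rewrite /s; lra.
have sl : s @ \oo --> (1 : R).
  have h2 : 0 <= 2^-1 :> R by rewrite invr_ge0.
  apply/cvgn_near => d d0.
  have := @cvg_expr R 2^-1; rewrite ger0_norm// invf_lt1// ltr1n => /(_ isT).
  move=> /cvgn_near/(_ _ d0); apply: filterS => j; rewrite subr0 => h.
  rewrite /s addrAC subrr sub0r normrN; apply: le_lt_trans h.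
  rewrite !ger0_norm ?exprn_ge0// exprS ler_piMl ?exprn_ge0// invf_le1//.
  by rewrite ler1n.
have H := @fatou _ _ _ mu I01 mI (fun j t => (nc (f (s j * t)%:C) `^ p)%:E).
have E : (\int[mu]_(t in I01) (radial f t `^ p)%:E =
  \int[mu]_(t in I01) limn_einf (fun j => (nc (f (s j * t)%:C) `^ p)%:E))%E.
  apply: eq_integral => t; rewrite inE => It; rewrite radialE//.
  suff cv : (fun j => (nc (f (s j * t)%:C) `^ p)%:E) @ \oo --> (nc (f t%:C) `^ p)%:E.
    by rewrite (cvg_limn_einf_sup cv).1.
  apply: cvg_EFin; first exact: nearW.
  apply: cvg_powR => //; first by move=> j; exact: nc_ge0.
  have td : unit_disc t%:C.
    move: It; rewrite /= in_itv /= => /andP[t0 t1].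
    by rewrite /unit_disc /mkset nc_real ger0_norm.
  have sc1 : ccont_at (fun y => f (y * t)%:C) 1.
    apply: (@ccont_analytic R f (fun y => (y * t)%:C) 1 fa); rewrite ?mul1r//.
    rewrite (_ : (fun y => _) = fun y => y%:C * t%:C); last by apply/funext => y; rewrite rmorphM.
    by apply: ccontM; [exact: ccont_real|exact: ccont_cst].
  have := continuous_cvg _ (ccont_nc sc1) sl; rewrite mul1r; exact.
rewrite E; apply: le_trans (H _ _) _.
- move=> j; apply/measurable_EFinP.
  exact: (@measurableT_comp _ _ _ _ _ _ _ _ _ (measurable_powR p) (mh _ (s01 j))).
- by move=> j t _; rewrite lee_fin powR_ge0.
by apply: limn_einf_le => j; exact: bound.
Qed.

End carleson_embedding.

End sufficiency.
Arguments measurable_arc {R}.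

(** * From Carleson conditions to bounded operators *)

Section bounded_operator.
Variable R : realType.
Variable mu : {finite_measure set (measurableTypeR R) -> \bar R}.
Local Notation I01 := (`[0%R, 1%R[%classic : set (measurableTypeR R)).
Local Notation arc := (`]0%R, (2 * pi)%R[%classic : set (measurableTypeR R)).
Local Notation leb := (@lebesgue_measure R).
Local Notation e := (circle_point (1 : R)).
Implicit Types (a b : nat -> R[i]) (f g : R[i] -> R[i]).

(** A Carleson measure has moments of order [1 / (k + 1)], so by Hardy's inequality
    every row of the Hankel matrix converges absolutely on [f]. *)
Lemma hankel_image_ex (p c n : R) f a : 1 <= p -> 0 <= c ->
  (forall k, moment mu k <= c * k.+1%:R^-1) ->
  power_series_in_disc a f -> 0 <= n -> (hardy_norm p f <= n%:E)%E ->
  exists g, hankel_image mu a g /\ forall r x, 0 < r < 1 ->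
    ((trace g r x)%:E <=
     6%:E * \int[mu]_(t in I01) (radial f t * (chord x + gap t)^-1)%:E)%E.
Proof.
move=> p1 c0 mc af n0 fn.
have fa := power_series_analytic af.
have hd M : \sum_(k < M) nc (a k) / k.+1%:R <= 5 * n.
  apply: (hardy_inequality M af) => r rr.
  exact: (cmean_trace_le p1 n0 fa rr fn).
have aS M : \sum_(k < M) nc (a k) * moment mu k <= c * (5 * n).
  apply: (@le_trans _ _ (c * \sum_(k < M) nc (a k) / k.+1%:R)); last first.
    by rewrite ler_wpM2l.
  rewrite mulr_sumr; apply: ler_sum => k _.
  by rewrite mulrCA ler_wpM2l ?nc_ge0.
have [b [hb bS]] := hankel_coefficients_ex aS.
have [g bg] := bounded_power_series bS.
exists g; split.
  by split; [exact: power_series_analytic bg|exists b].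
move=> r x rr; have rr' : 0 <= r < 1 by case/andP: rr => /ltW -> ->.
have zd := circle_point_disc x rr'.
apply: le_trans (hankel_pointwise_bound aS af hb bg zd) _.
have mr : measurable_fun setT (radial f) := measurable_radial fa.
have mg := @measurable_gap R.
have mK : measurable_fun setT (fun t => radial f t * (chord x + gap t)^-1).
  apply: measurable_funM => //; apply: measurable_inv_ge0 => [|t].
    by apply: measurable_funD.
  by rewrite addr_ge0 ?gap_ge0 ?chord_ge0.
have K0 t : 0 <= radial f t * (chord x + gap t)^-1.
  by rewrite mulr_ge0 ?radial_ge0// invr_ge0 addr_ge0 ?gap_ge0 ?chord_ge0.
rewrite -ge0_integralZl//; first last.
- by move=> t _; rewrite lee_fin; exact: K0.
- by apply/measurable_EFinP/measurable_funTS.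
apply: ge0_le_integral; first exact: measurable_I01.
- by move=> t _; rewrite lee_fin mulr_ge0 ?divr_ge0 ?nc_ge0.
- apply/measurable_EFinP; apply: measurable_funM; last exact: measurable_kernel.
  apply: ccont_measurable => t; rewrite /= in_itv /= => /andP[t0 t1].
  apply: ccont_analytic => //; last exact: ccont_real.
  by rewrite /unit_disc /mkset nc_real ger0_norm.
- by apply/measurable_funeM/measurable_EFinP/measurable_funTS.
move=> t It; rewrite -EFinM lee_fin radialE// [leRHS]mulrCA ler_wpM2l ?nc_ge0//.
have t01 : 0 <= t < 1 by move: It; rewrite /= in_itv.
have -> : t%:C * circle_point r x = (t * r)%:C * e x.
  by rewrite circle_pointE mulrA rmorphM.
case/andP: rr => r0 r1; case/andP: t01 => t0 t1.
rewrite (addrC (chord x)); apply: (@kernel_le_dist R t (t * r) x It).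
by rewrite mulr_ge0 ?(ltW r0)//= ler_piMr// ltW.
Qed.

Lemma hankel_bounded_of_trace (p Q : R) : 0 < p -> 0 <= Q ->
  (forall f a n, power_series_in_disc a f -> 0 <= n -> (hardy_norm p f <= n%:E)%E ->
    exists g, hankel_image mu a g /\ forall r, 0 < r < 1 ->
    (\int[leb]_(x in arc) (trace g r x `^ p)%:E <= (Q * n `^ p)%:E)%E) ->
  hankel_bounded_on_hardy mu p.
Proof.
move=> p0 Q0 H; have pp := pi2_gt0 R.
have [C C0 CE] : exists2 C, 0 <= C & C `^ p = Q / (2 * pi).
  exists ((Q / (2 * pi)) `^ p^-1); first exact: powR_ge0.
  by rewrite -powRrM mulVf ?gt_eqF// powRr1// divr_ge0// ltW.
exists C => f a [fa fn] af.
have nE : (hardy_norm p f = (fine (hardy_norm p f))%:E)%E.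
  by rewrite fineK// ge0_fin_numE// hardy_norm_ge0.
have n0 : 0 <= fine (hardy_norm p f) by rewrite -lee_fin -nE hardy_norm_ge0.
move: (fine _) nE n0 => n nE n0.
have [|g [ig gb]] := H f a n af n0; first by rewrite nE.
have ga : analytic_in_disc g by case: ig.
have gn : (hardy_norm p g <= (C * n)%:E)%E.
  apply: (hardy_norm_le p0 (mulr_ge0 C0 n0) ga) => r rr.
  apply: le_trans (gb r rr) _; rewrite lee_fin powRM// CE.
  by rewrite mulrA (mulrC (2 * pi)) divfK// gt_eqF.
exists g; split; first exact: ig.
  by split; [exact: ga|exact: le_lt_trans gn (ltry _)].
by rewrite nE; exact: gn.
Qed.

Lemma carleson_hankel_bounded (p : R) : 1 < p -> carleson_measure mu ->
  hankel_bounded_on_hardy mu p.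
Proof.
move=> p1 [C C0 hC]; have p0 : 0 < p by lra.
have C0' := ltW C0.
have [K K0 hK] := radial_embedding C0' hC p1.
pose sc := @schur_const R (arc_const R) C p.
have sc0 : 0 <= sc.
  have h1 : 0 < p^-1 < 1 by rewrite invr_gt0 p0 invf_lt1.
  have h2 : 0 < 1 - p^-1 < 1 by lra.
  by rewrite mulr_ge0 ?powR_ge0// mulr_ge0 ?arc_const_ge0// weight_const_ge0.
pose Q := 6 `^ p * (sc * K).
apply: (@hankel_bounded_of_trace p Q) => //.
  by apply: mulr_ge0; [exact: powR_ge0|exact: mulr_ge0].
move=> f a n af n0 fn; have fa := power_series_analytic af.
have mC k : moment mu k <= C * 4 * k.+1%:R^-1.
  by rewrite -mulrA; exact: carleson_moment_le.
have [g [ig gb]] := hankel_image_ex (ltW p1) (mulr_ge0 C0' (ler0n R 4)) mC af n0 fn.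
exists g; split; first exact: ig.
move=> r rr.
have mr : measurable_fun setT (radial f) := measurable_radial fa.
have H := @schur_test _ _ _ _ R leb mu arc I01 (@chord R : measurableTypeR R -> R) (@gap R)
    (arc_const R) C measurable_arc measurable_I01 (@measurable_chord R) (@measurable_gap R)
    (@chord_ge0 R) (@gap_ge0 R) (@arc_chord_gt0 R) (@gap_gt0 R) (arc_const_ge0 R) C0'
    (@arc_small R) (carleson_small C0' hC) p (radial f) p1 mr (radial_ge0 f).
set J := fun x : measurableTypeR R =>
  (\int[mu]_(t in I01) (radial f t * (chord x + gap t)^-1)%:E)%E in gb.
have J0 x : (0 <= J x)%E.
  apply: integral_ge0 => t _; rewrite lee_fin mulr_ge0 ?radial_ge0//.
  by rewrite invr_ge0 addr_ge0 ?gap_ge0 ?chord_ge0.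
have mJ : measurable_fun setT J.
  apply: (@measurable_partial_integral _ _ _ _ _ mu I01 measurable_I01
       (fun z => (radial f z.2 * (chord z.1 + gap z.2)^-1)%:E)) => //.
    apply/measurable_EFinP; apply: measurable_funM; first exact: measurableT_comp.
    apply: measurable_inv_ge0 => [|z]; last by rewrite addr_ge0 ?gap_ge0 ?chord_ge0.
    apply: measurable_funD; apply: measurableT_comp => //.
      exact: measurable_chord.
    exact: measurable_gap.
  by move=> z; rewrite lee_fin mulr_ge0 ?radial_ge0// invr_ge0 addr_ge0 ?gap_ge0 ?chord_ge0.
have mJp : measurable_fun setT (fun x => (J x `^ p)%E).
  exact: (@measurableT_comp _ _ _ _ _ _ _ _ _ (measurable_poweR p) mJ).
have rr' : 0 <= r < 1 by case/andP: rr => /ltW -> ->.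
have ga : analytic_in_disc g by case: ig.
apply: (@le_trans _ _ (\int[leb]_(x in arc) ((6 `^ p)%:E * J x `^ p))%E).
  apply: ge0_le_integral; first exact: measurable_arc.
  - by move=> x _; rewrite lee_fin powR_ge0.
  - apply/measurable_EFinP/measurable_funTS; apply: measurable_powR_comp.
    exact: measurable_trace.
  - exact/measurable_funeM/measurable_funTS.
  move=> x _; rewrite -!poweR_EFin -poweRM//.
  by apply: lee_poweR; rewrite ?(ltW p0) ?lee_fin ?trace_ge0//; exact: gb.
rewrite ge0_integralZl//; first last.
- by move=> x _; exact: poweR_ge0.
- exact: measurable_funTS.
rewrite /Q -(mulrA (6 `^ p)) [leRHS]EFinM; apply: lee_wpmul2l; first by rewrite lee_fin powR_ge0.
apply: (le_trans H); rewrite -(mulrA sc) [leRHS]EFinM; apply: lee_wpmul2l; first by rewrite lee_fin.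
exact: hK af n0 fn.
Qed.

(** The number [j + 1] of dyadic scales is comparable to the logarithm of the inverse
    distance. *)
Lemma log_carleson_small : log_carleson_measure mu 1 1 ->
  exists2 M : R, 0 <= M & forall j,
    (mu (I01 `&` [set t | (gap t <= 2^-1 ^+ j)%R]) <= (M * 2^-1 ^+ j / j.+1%:R)%:E)%E.
Proof.
move=> [C C0 hC]; have ln2 : 0 < ln 2 :> R by rewrite ln_gt0// ltr1n.
have fin (A : set (measurableTypeR R)) : measurable A -> mu A = (fine (mu A))%:E.
  by move=> mA; rewrite fineK//; exact: fin_num_measure.
have m0 (A : set (measurableTypeR R)) : 0 <= fine (mu A) by exact: fine_ge0.
(* the logarithm vanishes at the scale [j = 0], where the total mass serves *)
have M0 : 0 <= 2 * C / ln 2 by rewrite divr_ge0 ?mulr_ge0 ?ltW.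
exists (fine (mu I01) + 2 * C / ln 2); first by rewrite addr_ge0.
case=> [|j].
  rewrite expr0 mulr1 divr1; apply: (@le_trans _ _ (mu I01)).
    apply: le_measure; rewrite ?inE//.
    apply: measurableI; first exact: measurable_I01.
    exact: measurable_sublevel (@measurable_gap R) 1.
  by rewrite fin ?lee_fin ?lerDl//; exact: measurable_I01.
set s : R := 2^-1 ^+ j.+1.
have s0 : 0 < s by rewrite exprn_gt0// invr_gt0.
have s1 : s <= 1 by rewrite exprn_ile1// ?invr_ge0// invf_le1// ler1n.
rewrite sublevel_gap ?s1 ?(ltW s0)//; have := hC (1 - s).
rewrite opprB addrCA subrr addr0 [_ `^ _ in X in (_ <= X)%E](powRr1 (ltW s0)).
have -> : ln s^-1 = j.+1%:R * ln 2 :> R by rewrite /s -exprVn invrK lnXn// mulr_natl.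
rewrite powRr1 ?mulr_ge0 ?(ltW ln2)//.
have mI : measurable (`[1 - s, 1[%classic : set (measurableTypeR R)) by exact: measurable_itv.
rewrite fin// -EFinM !lee_fin => H.
have {}H : fine (mu `[1 - s, 1[%classic) * (j.+1%:R * ln 2) <= C * s by apply: H; lra.
have j0 : 0 < j.+2%:R :> R by rewrite ltr0n.
have j1 : 0 < j.+1%:R :> R by rewrite ltr0n.
rewrite ler_pdivlMr//; apply: (@le_trans _ _ (2 * C / ln 2 * s)); last first.
  by rewrite ler_wpM2r ?(ltW s0)// lerDr.
rewrite mulrAC ler_pdivlMr//.
have jj : j.+2%:R <= 2 * j.+1%:R :> R by rewrite -natrM ler_nat mul2n -addnn addSn addnS !ltnS leq_addr.
apply: (@le_trans _ _ (fine (mu `[1 - s, 1[%classic) * (2 * j.+1%:R) * ln 2)).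
  by rewrite ler_wpM2r ?(ltW ln2)// ler_wpM2l.
by lra.
Qed.

Definition arc_potential (t : measurableTypeR R) : R :=
  fine (\int[leb]_(x in arc) ((gap t + chord x)^-1)%:E)%E.

(** The potential grows like the logarithm of the distance to the circle, which
    the extra logarithm in the measure compensates. *)
Lemma arc_potential_le (t : measurableTypeR R) j : I01 t -> 2^-1 ^+ j.+1 <= gap t ->
  (\int[leb]_(x in arc) ((gap t + chord x)^-1)%:E <=
   (arc_const R * (2 * j.+3%:R))%:E)%E.
Proof.
move=> It tj; have g0 := gap_gt0 It.
apply: (@integral_log _ _ R leb arc (@chord R : measurableTypeR R -> R) measurable_arc
  (@measurable_chord R) (arc_const R) (@chord_ge0 R) (@arc_chord_gt0 R) (arc_const_ge0 R)
  (@arc_small R) (gap t) 2 j.+2 g0).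
  by move=> x _; exact: chord_le2.
have p2 : 0 < 2 ^+ j.+1 :> R by rewrite exprn_gt0.
move: tj; rewrite exprVn -[leLHS]mul1r ler_pdivrMr// => tj.
by rewrite !(exprS _ j.+2) (exprS _ j.+1); nra.
Qed.

Lemma arc_potentialE t : I01 t ->
  (\int[leb]_(x in arc) ((gap t + chord x)^-1)%:E)%E = (arc_potential t)%:E.
Proof.
move=> It; have g0 := gap_gt0 It.
have g1 : gap t <= 1.
  by rewrite gapE//; move: It; rewrite /= in_itv /= => /andP[t0 t1]; lra.
have [j /andP[_ a2]] := dyadic_scale g0 g1.
have tj : 2^-1 ^+ j.+1 <= gap t.
  by rewrite exprVn -[leLHS]mul1r ler_pdivrMr ?exprn_gt0// mulrC ltW.
rewrite /arc_potential fineK// ge0_fin_numE.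
  exact: le_lt_trans (arc_potential_le It tj) (ltry _).
by apply: arc_integral_ge0 => x; rewrite invr_ge0 addr_ge0 ?gap_ge0 ?chord_ge0.
Qed.

Lemma arc_potential_ge0 t : 0 <= arc_potential t.
Proof.
by apply/fine_ge0/arc_integral_ge0 => x; rewrite invr_ge0 addr_ge0 ?gap_ge0 ?chord_ge0.
Qed.

Lemma measurable_dist_kernel : measurable_fun setT
  (fun z : measurableTypeR R * measurableTypeR R => (gap z.1 + chord z.2)^-1).
Proof.
apply: measurable_inv_ge0 => [|z]; last by rewrite addr_ge0 ?gap_ge0 ?chord_ge0.
apply: measurable_funD; apply: measurableT_comp => //.
  exact: measurable_gap.
exact: measurable_chord.
Qed.

Lemma measurable_arc_potential : measurable_fun setT arc_potential.
Proof.
apply: (measurableT_comp (@fine_measurable R setT measurableT)).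
apply: (@measurable_partial_integral _ _ _ _ _ leb arc measurable_arc
       (fun z => ((gap z.1 + chord z.2)^-1)%:E)) => [|z].
  by apply/measurable_EFinP; exact: measurable_dist_kernel.
by rewrite lee_fin invr_ge0 addr_ge0 ?gap_ge0 ?chord_ge0.
Qed.

(** The [j + 3] scales seen by the potential cancel the [j + 1] in the mass of [mu]. *)
Lemma log_carleson_moment_le (M : R) k : 0 <= M ->
  (forall j, (mu (I01 `&` [set t | (gap t <= 2^-1 ^+ j)%R]) <=
              (M * 2^-1 ^+ j / j.+1%:R)%:E)%E) ->
  (\int[mu]_(t in I01) (arc_potential t * t ^+ k)%:E <=
   (6 * arc_const R * M * (4 / k.+1%:R))%:E)%E.
Proof.
move=> M0 hM; have A0 := arc_const_ge0 R.
apply: (@weighted_moment_le R mu _ (fun j => arc_const R * (2 * j.+3%:R))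
   (fun j => M * 2^-1 ^+ j / j.+1%:R)) => //.
- exact: measurable_arc_potential.
- exact: arc_potential_ge0.
- by move=> j; rewrite mulr_ge0// mulr_ge0.
- move=> j t It tj; rewrite -lee_fin -arc_potentialE//; exact: arc_potential_le.
- move=> j; have j1 : 0 < j.+1%:R :> R by rewrite ltr0n.
  rewrite mulrA ler_pdivrMr//.
  have jj : j.+3%:R <= 3 * j.+1%:R :> R.
    by rewrite -3!natr1; have := ler0n R j; lra.
  have s0 : 0 <= 2^-1 ^+ j :> R by rewrite exprn_ge0// invr_ge0.
  have X0 : 0 <= arc_const R * (2 * (M * 2^-1 ^+ j)).
    by rewrite mulr_ge0// mulr_ge0// mulr_ge0.
  rewrite [leLHS](_ : _ = arc_const R * (2 * (M * 2^-1 ^+ j)) * j.+3%:R); last by ring.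
  rewrite [leRHS](_ : _ = arc_const R * (2 * (M * 2^-1 ^+ j)) * (3 * j.+1%:R)); last by ring.
  by rewrite ler_wpM2l.
- by rewrite mulr_ge0// mulr_ge0.
Qed.

(** Tonelli turns the mean of [g] into an integral of [f] against the potential,
    and the power series of [f] turns this into the sum of Hardy's inequality. *)
Lemma log_carleson_hankel_bounded : log_carleson_measure mu 1 1 ->
  hankel_bounded_on_hardy mu 1.
Proof.
move=> hL; have [M M0 hM] := log_carleson_small hL.
have A0 := arc_const_ge0 R.
have K0 : 0 <= 6 * arc_const R * M by rewrite mulr_ge0// mulr_ge0.
have mk k : moment mu k <= M * 4 * k.+1%:R^-1.
  rewrite -mulrA -lee_fin momentE.
  have := @weighted_moment_le R mu (cst 1) (fun=> 1)
    (fun j => M * 2^-1 ^+ j / j.+1%:R) M k.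
  under eq_integral do rewrite mul1r.
  apply => // j; rewrite mul1r ler_pdivrMr ?ltr0n//.
  by rewrite ler_peMr ?ler1n// mulr_ge0// exprn_ge0// invr_ge0.
have Q0 : 0 <= 6 * (6 * arc_const R * M * 4 * 5) by rewrite mulr_ge0// mulr_ge0// mulr_ge0.
apply: (hankel_bounded_of_trace ltr01 Q0) => f a n af n0 fn.
have [g [ig gb]] := hankel_image_ex (lexx 1) (mulr_ge0 M0 (ler0n R 4)) mk af n0 fn.
exists g; split; first exact: ig.
move=> r rr; have rr' : 0 <= r < 1 by case/andP: rr => /ltW -> ->.
have fa := power_series_analytic af.
have ga : analytic_in_disc g by case: ig.
have mr : measurable_fun setT (radial f) := measurable_radial fa.
have D0 (x t : measurableTypeR R) : 0 <= (chord x + gap t)^-1.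
  by rewrite invr_ge0 addr_ge0 ?gap_ge0 ?chord_ge0.
pose F (z : measurableTypeR R * measurableTypeR R) : \bar R :=
  (radial f z.2 * (chord z.1 + gap z.2)^-1)%:E.
have F0 z : (0 <= F z)%E by rewrite lee_fin mulr_ge0 ?radial_ge0.
have mF : measurable_fun setT F.
  apply/measurable_EFinP; apply: measurable_funM; first exact: measurableT_comp.
  apply: measurable_inv_ge0 => [|z]; last by rewrite addr_ge0 ?gap_ge0 ?chord_ge0.
  apply: measurable_funD; apply: measurableT_comp => //.
    exact: measurable_chord.
  exact: measurable_gap.
have mJ := measurable_partial_integral mu measurable_I01 mF F0.
apply: (@le_trans _ _ (\int[leb]_(x in arc) (6%:E * \int[mu]_(t in I01) F (x, t)))%E).
  apply: ge0_le_integral; first exact: measurable_arc.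
  - by move=> x _; rewrite lee_fin powR_ge0.
  - apply/measurable_EFinP/measurable_funTS; apply: measurable_powR_comp.
    exact: measurable_trace.
  - exact/measurable_funeM/measurable_funTS.
  by move=> x _; rewrite powRr1 ?trace_ge0//; exact: gb.
rewrite ge0_integralZl//; first last.
- by move=> x _; apply: integral_ge0 => t _; exact: F0.
- exact: measurable_funTS.
rewrite powRr1// -(mulrA 6) EFinM; apply: lee_wpmul2l => //.
rewrite (@tonelli_on _ _ _ _ R leb mu arc I01 measurable_arc measurable_I01 F mF F0).
pose P := arc_potential.
have P0 := arc_potential_ge0.
have E : (\int[mu]_(t in I01) \int[leb]_(x in arc) F (x, t) =
    \int[mu]_(t in I01) (radial f t * P t)%:E)%E.
  apply: eq_integral => t; rewrite inE => It.
  rewrite EFinM /P -arc_potentialE// -ge0_integralZl//; first last.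
  - by rewrite lee_fin radial_ge0.
  - by move=> x _; rewrite lee_fin addrC.
  - apply/measurable_EFinP/measurable_funTS.
    apply: measurable_inv_ge0 => [|z]; last by rewrite addr_ge0 ?gap_ge0 ?chord_ge0.
    by apply: measurable_funD => //; exact: measurable_chord.
  by apply: eq_integral => x _; rewrite -EFinM addrC.
rewrite E.
have term0 k t : I01 t -> (0 <= ((nc (a k) * t ^+ k) * P t)%:E)%E.
  move=> It; rewrite lee_fin mulr_ge0 ?P0// mulr_ge0 ?nc_ge0// exprn_ge0//.
  by move: It; rewrite /= in_itv /= => /andP[].
apply: (@le_trans _ _ (\int[mu]_(t in I01) \sum_(0 <= k <oo) ((nc (a k) * t ^+ k) * P t)%:E)%E).
  apply: ge0_le_integral; first exact: measurable_I01.
  - by move=> t _; rewrite lee_fin mulr_ge0 ?radial_ge0 ?P0.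
  - apply/measurable_EFinP/measurable_funTS; apply: measurable_funM => //.
    exact: measurable_arc_potential.
  - apply: ge0_emeasurable_sum => [k t It _|k _]; first exact: term0.
    apply/measurable_EFinP; apply: measurable_funM; last first.
      exact: measurable_funTS measurable_arc_potential.
    by apply: measurable_funM => //; exact: measurable_pow.
  move=> t It; rewrite radialE//.
  have td : unit_disc t%:C.
    move: (It); rewrite /= in_itv /= => /andP[t0 t1].
    by rewrite /unit_disc /mkset nc_real ger0_norm.
  have cP : (fun n => (nc (series (fun k => a k * t%:C ^+ k) n) * P t)%:E) @ \oo -->
      (nc (f t%:C) * P t)%:E.
    apply: cvg_EFin; first exact: nearW.
    by apply: cvgM; [exact: cvg_nc (af _ td)|exact: cvg_cst].
  apply: (cvge_to_le cP); apply: nearW => N.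
  apply: (@le_trans _ _ (\sum_(k < N) (nc (a k) * t ^+ k * P t)%:E)%E).
    rewrite sumEFin lee_fin -mulr_suml ler_wpM2r ?P0//.
    rewrite /series /= big_mkord; apply: le_trans (nc_sum _ _ _) _.
    apply: ler_sum => k _; rewrite Normc.normcM ncX nc_real ger0_norm//.
    by move: It; rewrite /= in_itv /= => /andP[].
  rewrite -(big_mkord xpredT (fun k => (nc (a k) * t ^+ k * P t)%:E)).
  by apply: nneseries_lim_ge => k _ _; exact: term0.
have mP : measurable_fun I01 P by exact: measurable_funTS measurable_arc_potential.
rewrite (abs_sum_integral_le mu a mP (fun t _ => P0 t)).
apply: lime_le.
  apply: is_cvg_nneseries => k _ _; rewrite mule_ge0 ?lee_fin ?nc_ge0//.
  apply: integral_ge0 => t It; rewrite lee_fin mulr_ge0 ?P0// exprn_ge0//.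
  by move: It; rewrite /= in_itv /= => /andP[].
apply: nearW => N; rewrite big_mkord.
apply: (@le_trans _ _ (\sum_(k < N) (6 * arc_const R * M * 4 * (nc (a k) / k.+1%:R))%:E)%E).
  apply: lee_sum => k _.
  rewrite (_ : 6 * arc_const R * M * 4 * _ =
     nc (a k) * (6 * arc_const R * M * (4 / k.+1%:R))); last by ring.
  rewrite EFinM; apply: lee_wpmul2l; first by rewrite lee_fin nc_ge0.
  exact: log_carleson_moment_le.
rewrite sumEFin lee_fin -mulr_sumr -(mulrA _ 5 n); apply: (ler_wpM2l (mulr_ge0 K0 (ler0n R 4))).
apply: (hardy_inequality N af) => s ss.
exact: (cmean_trace_le (lexx 1) n0 fa ss fn).
Qed.

End bounded_operator.

(** * Test functions *)

Section test_functions.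
Variable R : realType.
Local Notation e := (circle_point (1 : R)).
Local Notation arc := (`]0%R, (2 * pi)%R[%classic : set (measurableTypeR R)).
Local Notation leb := (@lebesgue_measure R).

Lemma geom_square_sum (w : R[i]) N :
  (1 - w) ^+ 2 * \sum_(k < N) k.+1%:R * w ^+ k =
  1 - (w ^+ N + N%:R * w ^+ N * (1 - w)).
Proof.
elim: N => [|N IH]; first by rewrite big_ord0; ring.
rewrite big_ord_recr /= mulrDr IH -[N.+1%:R]natr1 (exprS w N); ring.
Qed.

(** The remainder in [geom_square_sum] is the term of a convergent series. *)
Lemma geom_square_series (w : R[i]) : nc w < 1 ->
  series (fun k => k.+1%:R * w ^+ k) @ \oo --> ((1 - w) ^- 2 : R[i]^o).
Proof.
move=> w1; have w0 := nc_ge0 w.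
have w10 : 1 - w != 0.
  by apply: contraTneq w1 => /eqP; rewrite subr_eq0 => /eqP <-; rewrite Normc.normc1 ltxx.
have d0 : 0 <= nc ((1 - w) ^- 2) := nc_ge0 _.
have ww : 0 <= nc w < 1 by rewrite w0.
have D0 n : 0 <= geom_deriv (nc w) n := geom_deriv_ge0 n w0.
have := cvg_series_cvg_0 (bounded_series_cvg D0 (fun n => geom_deriv_sum_le n ww)).
move=> /cvgn_near h; apply/cvgC_near => d dp.
have k0 : 0 < 3 * nc ((1 - w) ^- 2) + 1 by rewrite ltr_wpDl// mulr_ge0.
have [N _ hN] := h _ (divr_gt0 dp k0).
exists N => // n /= Nn; have := hN n.+1 (leqW Nn).
rewrite subr0 ger0_norm// ltr_pdivlMr// => hn.
have -> : series (fun k => k.+1%:R * w ^+ k) n - (1 - w) ^- 2 =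
    - ((1 - w) ^- 2 * (w ^+ n + n%:R * w ^+ n * (1 - w))).
  have H := geom_square_sum w n; rewrite /series /= big_mkord.
  have -> : w ^+ n + n%:R * w ^+ n * (1 - w) =
      1 - (1 - w) ^+ 2 * \sum_(k < n) k.+1%:R * w ^+ k by rewrite H; ring.
  by field.
rewrite ncN Normc.normcM; apply: le_lt_trans hn.
have W0 : 0 <= nc w ^+ n by rewrite exprn_ge0.
have h1 : nc (w ^+ n + n%:R * w ^+ n * (1 - w)) <= 3 * geom_deriv (nc w) n.+1.
  apply: le_trans (ncD _ _) _; rewrite !Normc.normcM ncX nc_nat.
  have : nc (1 - w) <= 2.
    by apply: le_trans (ncD _ _) _; rewrite ncN Normc.normc1; lra.
  move=> h2; have n0 : 0 <= n%:R * nc w ^+ n by rewrite mulr_ge0.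
  have := ler_wpM2l n0 h2.
  by rewrite /geom_deriv /= -natr1; nra.
apply: le_trans (ler_wpM2l d0 h1) _.
by have := D0 n.+1; nra.
Qed.

(** The square of Cauchy's kernel serves every exponent [1 <= p]: its mean of order
    [p] is dominated by the points nearest to 1, while the mean of order one of the
    kernel itself receives the same amount from every dyadic scale. *)
Definition peak (r : R) (z : R[i]) : R[i] := (1 - r%:C * z) ^- 2.
Definition peak_coef (r : R) (k : nat) : R[i] := (k.+1%:R * r ^+ k)%:C.

Lemma peak_series r : 0 <= r < 1 -> power_series_in_disc (peak_coef r) (peak r).
Proof.
move=> /andP[r0 r1] z zd.
have : nc (r%:C * z) < 1.
  rewrite Normc.normcM nc_real ger0_norm//; apply: le_lt_trans zd.
  by rewrite ler_piMl ?nc_ge0// ltW.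
move=> /geom_square_series; rewrite /peak.
have -> // : (fun k => peak_coef r k * z ^+ k) = (fun k => k.+1%:R * (r%:C * z) ^+ k).
apply/funext => k; rewrite /peak_coef exprMn rmorphM rmorphXn /= rmorph_nat.
by rewrite mulrA.
Qed.

Lemma trace_peak_le r s x : 0 <= r < 1 -> 0 < s < 1 ->
  trace (peak r) s x <= 9 * ((1 - r) + chord x) `^ (- 2).
Proof.
move=> /andP[r0 r1] /andP[s0 s1]; have c0 := chord_ge0 x.
have rs : 0 <= r * s <= r by rewrite mulr_ge0 ?(ltW s0)// ler_piMr// ltW.
have rs1 : 0 <= r * s <= 1 by lra.
have D0 : 0 < 1 - r + chord x by lra.
rewrite powRN (powR_mulrn 2 (ltW D0)) /trace /peak.
have -> : r%:C * circle_point s x = (r * s)%:C * e x.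
  by rewrite circle_pointE mulrA rmorphM.
rewrite -exprVn ncX Normc.normcV.
have h := kernel_dist_ge x rs1; have h1 := kernel_dist_ge1 x rs1.
set N := nc (1 - _) in h h1 *.
have N0 : 0 < N by lra.
have : N^-1 <= 3 * (1 - r + chord x)^-1.
  by rewrite -[leLHS]mul1r ler_pdivrMr// mulrAC ler_pdivlMr//; lra.
move=> h3; apply: le_trans (_ : (3 * (1 - r + chord x)^-1) ^+ 2 <= _).
  by rewrite lerXn2r ?nnegrE ?invr_ge0 ?(ltW N0)// mulr_ge0// invr_ge0 ltW.
by rewrite exprMn exprVn -natrX.
Qed.

(** The exponent is that of [(1 - r + chord) ^ (-2 p)] integrated over the circle. *)
Lemma peak_norm (p : R) : 1 <= p -> exists2 c : R, 0 <= c & forall r, 0 <= r < 1 ->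
  (hardy_norm p (peak r) <= (c * (1 - r) `^ (p^-1 - 2))%:E)%E.
Proof.
move=> p1; have p0 : 0 < p by lra.
have p2 : 1 < 2 * p by lra.
have pp := pi2_gt0 R.
pose T := 9 `^ p * (arc_const R * tail_const (2 * p)).
have T0 : 0 <= T.
  by apply: mulr_ge0; [exact: powR_ge0|apply: mulr_ge0 (arc_const_ge0 R) (tail_const_ge0 p2)].
have [c c0 cE] : exists2 c, 0 <= c & c `^ p = T / (2 * pi).
  exists ((T / (2 * pi)) `^ p^-1); first exact: powR_ge0.
  by rewrite -powRrM mulVf ?gt_eqF// powRr1// divr_ge0// ltW.
exists c => // r rr; have r1 : 0 < 1 - r by case/andP: rr => _; rewrite subr_gt0.
have fa := power_series_analytic (peak_series rr).
apply: (hardy_norm_le p0 (mulr_ge0 c0 (powR_ge0 _ _)) fa) => s ss.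
have ss' : 0 <= s < 1 by case/andP: ss => /ltW -> ->.
pose W (x : measurableTypeR R) : R := (1 - r + chord x) `^ (- (2 * p)).
have mW : measurable_fun setT W.
  by apply: measurable_powR_comp; apply: measurable_funD => //; exact: measurable_chord.
apply: (@le_trans _ _ (\int[leb]_(x in arc) ((9 `^ p)%:E * (W x)%:E))%E).
  apply: ge0_le_integral; first exact: measurable_arc.
  - by move=> x _; rewrite lee_fin powR_ge0.
  - apply/measurable_EFinP/measurable_funTS; apply: measurable_powR_comp.
    exact: measurable_trace.
  - by apply/measurable_funeM/measurable_EFinP/measurable_funTS.
  move=> x _; rewrite -EFinM lee_fin.
  apply: (le_trans (_ : _ <= (9 * (1 - r + chord x) `^ (- 2)) `^ p)).
    apply: ge0_ler_powR; rewrite ?nnegrE ?(ltW p0) ?trace_ge0//.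
      by rewrite mulr_ge0// powR_ge0.
    exact: trace_peak_le.
  by rewrite powRM ?powR_ge0// -powRrM mulNr.
rewrite ge0_integralZl//; first last.
- by move=> x _; rewrite lee_fin powR_ge0.
- by apply/measurable_EFinP/measurable_funTS.
have H := @integral_tail _ _ R leb arc (@chord R : measurableTypeR R -> R) measurable_arc
  (@measurable_chord R) (arc_const R) (@arc_chord_gt0 R) (arc_const_ge0 R)
  (@arc_small R) (2 * p) (1 - r) p2 r1.
apply: (@le_trans _ _ ((9 `^ p)%:E * (arc_const R * (tail_const (2 * p) * (1 - r) `^ (1 - 2 * p)))%:E)%E).
  by apply: lee_wpmul2l; rewrite ?lee_fin ?powR_ge0.
rewrite -EFinM lee_fin powRM ?powR_ge0// cE -powRrM.
have -> : (p^-1 - 2) * p = 1 - 2 * p by rewrite mulrBl mulVf ?gt_eqF.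
rewrite [leRHS](_ : _ = T * (1 - r) `^ (1 - 2 * p)).
  by rewrite /T !mulrA.
by rewrite mulrA (mulrC (2 * pi)) divfK// gt_eqF.
Qed.

(** Hoelder's inequality in Cauchy's formula: the kernel has norm of order
    [(1 - s) ^ (-1 / p)] for the dual exponent. *)
Lemma hardy_growth (p : R) : 1 < p -> exists2 c : R, 0 <= c &
  forall g b n r s, power_series_in_disc b g -> 0 <= n -> (hardy_norm p g <= n%:E)%E ->
  0 < r < 1 -> 0 <= s < 1 -> nc (g (r * s)%:C) <= c * n * (1 - s) `^ (- p^-1).
Proof.
move=> p1; have p0 : 0 < p by lra.
have pp := pi2_gt0 R.
have pi1 : p^-1 < 1 by rewrite invf_lt1.
have pi0 : 0 < p^-1 by rewrite invr_gt0.
pose q := (1 - p^-1)^-1.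
have q1 : 1 < q by rewrite invf_gt1 ?subr_gt0//; lra.
have q0 : 0 < q by lra.
have qE : q^-1 = 1 - p^-1 by rewrite /q invrK.
have pq : p^-1 + q^-1 = 1 by rewrite qE; ring.
pose T := 6 `^ q * (arc_const R * tail_const q).
have T0 : 0 <= T.
  by apply: mulr_ge0; [exact: powR_ge0|apply: mulr_ge0 (arc_const_ge0 R) (tail_const_ge0 q1)].
pose c := (2 * pi)^-1 * ((2 * pi) `^ p^-1 * T `^ q^-1).
have c0 : 0 <= c.
  apply: mulr_ge0; first by rewrite invr_ge0 ltW.
  by apply: mulr_ge0; exact: powR_ge0.
exists c => // g b n r s bg n0 gn rr ss.
have ga := power_series_analytic bg.
have rr' : 0 <= r < 1 by case/andP: rr => /ltW -> ->.
have s1 : 0 < 1 - s by case/andP: ss => _; rewrite subr_gt0.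
have ss' : 0 <= s <= 1 by case/andP: ss => -> /ltW ->.
have mt := measurable_trace ga rr'.
pose W (x : measurableTypeR R) : R := 6 * (1 - s + chord x)^-1.
have D0 (x : measurableTypeR R) : 0 < 1 - s + chord x by rewrite ltr_pwDl// chord_ge0.
have W0 x : 0 <= W x by rewrite mulr_ge0// invr_ge0 ltW.
have mW : measurable_fun setT W.
  apply: measurable_funM => //; apply: measurable_inv_ge0 => [|x]; last exact: ltW.
  by apply: measurable_funD => //; exact: measurable_chord.
have tc : continuous (trace g r) by exact: continuous_nc_analytic.
have kc : continuous (fun x => 2 * (nc (1 - s%:C * e x))^-1).
  by apply: continuous_scale; exact: continuous_kernel.
have H1 : ((nc (g (r * s)%:C))%:E <=
    (2 * pi)^-1%:E * \int[leb]_(x in arc) (trace g r x * W x)%:E)%E.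
  apply: (@le_trans _ _ (cmean (fun x => trace g r x * (2 * (nc (1 - s%:C * e x))^-1)))%:E).
    by rewrite lee_fin; exact: (@cauchy_bound R b g r s bg rr' ss).
  rewrite cmean_arc; last exact: continuous_ncM.
  apply: lee_wpmul2l; first by rewrite lee_fin invr_ge0 ltW.
  apply: ge0_le_integral; first exact: measurable_arc.
  - by move=> x _; rewrite lee_fin mulr_ge0 ?trace_ge0// divr_ge0// nc_ge0.
  - apply/measurable_EFinP/measurable_funTS.
    exact: (continuous_measurable_fun (continuous_ncM tc kc)).
  - by apply/measurable_EFinP/measurable_funTS; exact: measurable_funM.
  move=> x _; rewrite lee_fin ler_wpM2l ?trace_ge0// /W.
  have h := kernel_dist_ge x ss'; have h1 := kernel_dist_ge1 x ss'.
  have N0 : 0 < nc (1 - s%:C * e x) by apply: lt_le_trans h1.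
  by rewrite ler_pdivrMr// mulrAC ler_pdivlMr//; lra.
have H2 := hoelder_on leb measurable_arc mt mW (fun x => trace_ge0 g r x) W0 p0 q0 pq.
have H3 := trace_power_le p0 ga rr gn.
have H4 : (\int[leb]_(x in arc) (W x `^ q)%:E <= (T * (1 - s) `^ (1 - q))%:E)%E.
  have WE x : W x `^ q = 6 `^ q * (1 - s + chord x) `^ (- q).
    rewrite /W powRM ?invr_ge0 ?(ltW (D0 _))//.
    by rewrite -powR_inv1 ?(ltW (D0 _))// -powRrM mulN1r.
  under eq_integral do rewrite WE EFinM.
  rewrite ge0_integralZl//; first last.
  - by move=> x _; rewrite lee_fin powR_ge0.
  - apply/measurable_EFinP/measurable_funTS; apply: measurable_powR_comp.
    by apply: measurable_funD => //; exact: measurable_chord.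
  have H := @integral_tail _ _ R leb arc (@chord R : measurableTypeR R -> R) measurable_arc
    (@measurable_chord R) (arc_const R) (@arc_chord_gt0 R) (arc_const_ge0 R)
    (@arc_small R) q (1 - s) q1 s1.
  apply: (@le_trans _ _ ((6 `^ q)%:E * (arc_const R * (tail_const q * (1 - s) `^ (1 - q)))%:E)%E).
    by apply: lee_wpmul2l; rewrite ?lee_fin ?powR_ge0.
  by rewrite -EFinM lee_fin /T !mulrA.
rewrite -lee_fin; apply: (le_trans H1).
have E : c * n * (1 - s) `^ (- p^-1) =
    (2 * pi)^-1 * ((2 * pi * n `^ p) `^ p^-1 * (T * (1 - s) `^ (1 - q)) `^ q^-1).
  rewrite (@powRM R _ _ _ (ltW pp) (powR_ge0 n p)) (@powRM R _ _ _ T0 (powR_ge0 _ _)).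
  rewrite -(powRrM n) -(powRrM (1 - s)) mulfV ?gt_eqF// powRr1//.
  have -> : (1 - q) * q^-1 = - p^-1 by rewrite mulrBl mulfV ?gt_eqF// qE; ring.
  by rewrite /c; ring.
rewrite E EFinM; apply: lee_wpmul2l; first by rewrite lee_fin invr_ge0 ltW.
apply: (le_trans H2); rewrite EFinM.
apply: lee_pmul; [exact: poweR_ge0|exact: poweR_ge0| |]; rewrite -poweR_EFin.
  apply: lee_poweR H3; first exact: ltW.
  by apply: arc_integral_ge0 => x; exact: powR_ge0.
apply: lee_poweR H4; first by rewrite invr_ge0 ltW.
by apply: arc_integral_ge0 => x; exact: powR_ge0.
Qed.

End test_functions.

(** * From bounded operators to Carleson conditions *)

Section necessity.
Variable R : realType.
Variable mu : {finite_measure set (measurableTypeR R) -> \bar R}.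
Local Notation mass r := (fine (mu `[r, 1%R[%classic)).

Lemma mass_ge0 (r : R) : 0 <= mass r.
Proof. exact: fine_ge0. Qed.

Lemma massE (r : R) : (mu `[r, 1%R[%classic = (mass r)%:E)%E.
Proof. by rewrite fineK//; apply: fin_num_measure; exact: measurable_itv. Qed.

Lemma sqr_inv_ge (r : R) : 0 <= r < 1 -> (1 - r) ^- 2 / 4 <= (1 - r ^+ 2) ^- 2.
Proof.
move=> /andP[r0 r1]; have d0 : 0 < 1 - r by rewrite subr_gt0.
have h1 : 0 < 1 - r ^+ 2 by nra.
rewrite -invfM lef_pV2 ?posrE ?mulr_gt0 ?exprn_gt0//.
rewrite [leRHS](_ : _ = (2 * (1 - r)) ^+ 2); last by ring.
by rewrite lerXn2r ?nnegrE//; nra.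
Qed.

(** Only the mass of [[r, 1)] is kept in each moment; the series that remains is
    [\sum_k (k + 1) r ^ (2 k) = (1 - r ^ 2) ^ (-2)]. *)
Lemma hankel_peak_coef_ge (r : R) b n : 0 <= r < 1 ->
  hankel_coefficients mu (peak_coef r) b ->
  r ^+ n * (mass r * ((1 - r) ^- 2 / 4)) <= Re (b n).
Proof.
move=> rr hb; have /andP[r0 r1] := rr; have m0 := mass_ge0 r.
apply: (@le_trans _ _ (r ^+ n * mass r * (1 - r ^+ 2) ^- 2)).
  by rewrite -mulrA ler_wpM2l ?exprn_ge0// ler_wpM2l// sqr_inv_ge.
have w1 : nc ((r ^+ 2)%:C : R[i]) < 1.
  by rewrite nc_real ger0_norm ?exprn_ge0// exprn_ilt1.
have h1 := cvg_Re (geom_square_series w1).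
have h2 : (fun K => r ^+ n * mass r * Re (series (fun k => k.+1%:R * (r ^+ 2)%:C ^+ k : R[i]) K))
    @ \oo --> r ^+ n * mass r * Re ((1 - (r ^+ 2)%:C) ^- 2 : R[i]).
  by apply: cvgM; [exact: cvg_cst|exact: h1].
have -> : (1 - r ^+ 2) ^- 2 = Re ((1 - (r ^+ 2)%:C) ^- 2 : R[i]).
  by rewrite -[1 in RHS](rmorph1 (real_complex R)) -rmorphB -rmorphXn -fmorphV.
have h3 := cvg_Re (hb n).
apply: (ler_cvg_to h2 h3); apply: nearW => K.
rewrite !series_Re /series /= !big_mkord mulr_sumr; apply: ler_sum => k _.
have -> : k.+1%:R * (r ^+ 2)%:C ^+ k = (k.+1%:R * (r ^+ 2) ^+ k)%:C :> R[i].
  by rewrite [RHS]rmorphM [X in _ = _ * X]rmorphXn /= rmorph_nat.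
rewrite /= mul0r subr0.
have := moment_ge mu (n + k) rr; rewrite exprD => h.
have k0 : 0 <= k.+1%:R * r ^+ k by rewrite mulr_ge0 ?exprn_ge0.
have := ler_wpM2r k0 h; apply: le_trans; rewrite -exprM mulnC exprM expr2 le_eqVlt.
by apply/orP; left; apply/eqP; ring.
Qed.

Lemma peak_image (p : R) : 1 <= p -> hankel_bounded_on_hardy mu p ->
  exists2 c : R, 0 <= c & forall r : R, 0 <= r < 1 -> exists g b,
    [/\ hankel_coefficients mu (peak_coef r) b, power_series_in_disc b g &
        (hardy_norm p g <= (c * (1 - r) `^ (p^-1 - 2))%:E)%E].
Proof.
move=> p1 [C hC]; have [c c0 hc] := peak_norm p1.
(* the constant of a bounded operator is not assumed nonnegative *)
exists (`|C| * c); first by rewrite mulr_ge0.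
move=> r rr; have pr := peak_series rr; have fn := hc r rr.
have fh : hardy p (peak r).
  by split; [exact: power_series_analytic pr|exact: le_lt_trans fn (ltry _)].
have [g [[ga [b hb bg]] _ gn]] := hC _ _ fh pr.
exists g, b; split => //; apply: (le_trans gn).
apply: (@le_trans _ _ (`|C|%:E * hardy_norm p (peak r))%E).
  by apply: lee_wpmul2r; [exact: hardy_norm_ge0|rewrite lee_fin ler_norm].
by rewrite -mulrA EFinM; apply: lee_wpmul2l fn; rewrite lee_fin.
Qed.

(** At a point near [r] the image of the peak is at least of order
    [mu([r, 1)) (1 - r) ^ (-3)] and at most of order [(1 - r) ^ (-2)]. *)
Lemma hankel_bounded_carleson (p : R) : 1 < p -> hankel_bounded_on_hardy mu p ->
  carleson_measure mu.
Proof.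
move=> p1 hp; have p0 : 0 < p by lra.
have [c c0 hc] := peak_image (ltW p1) hp.
have [d d0 hd] := hardy_growth p1.
exists (12 * (d * c) + 1); first by rewrite ltr_wpDl// mulr_ge0// mulr_ge0.
move=> r rr; have /andP[r0 r1] := rr; have m0 := mass_ge0 r.
have q0 : 0 < 1 - r by rewrite subr_gt0.
have [g [b [hb bg gn]]] := hc r rr.
(* the radius of the circle in [hardy_growth]; positive even when [r = 0] *)
pose s := (1 + r) / 2.
have ss : 0 < s < 1 by rewrite /s; lra.
have rs : r <= s by rewrite /s; lra.
have := hd g b _ s r bg (mulr_ge0 c0 (powR_ge0 _ _)) gn ss rr.
have -> : d * (c * (1 - r) `^ (p^-1 - 2)) * (1 - r) `^ (- p^-1) = d * c * (1 - r) ^- 2.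
  rewrite !mulrA -mulrA -powRD; last by apply/implyP => _; rewrite gt_eqF.
  have -> : p^-1 - 2 + - p^-1 = - 2 by ring.
  by rewrite powRN (powR_mulrn 2 (ltW q0)).
move=> upper.
pose X := mass r * ((1 - r) ^- 2 / 4).
have X0 : 0 <= X by rewrite mulr_ge0// divr_ge0// invr_ge0 exprn_ge0// ltW.
pose w := s * r * r.
have sr0 : 0 <= s * r by rewrite mulr_ge0//; case/andP: ss => /ltW.
have w0 : 0 <= w by rewrite mulr_ge0.
have w1 : w < 1 by rewrite /w; nra.
have wlow : 1 - w <= 3 * (1 - r).
  have : r * r * r <= w by rewrite /w; nra.
  have h : 0 <= (1 - r) * (1 - r) * (r + 2) by rewrite !mulr_ge0 ?(ltW q0) ?addr_ge0.
  have E : 3 * (1 - r) - (1 - r * r * r) = (1 - r) * (1 - r) * (r + 2) by ring.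
  by lra.
have lower : X / (1 - w) <= nc (g (s * r)%:C).
  apply: le_trans (Re_le_nc _).
  have zd : unit_disc ((s * r)%:C : R[i]).
    by rewrite /unit_disc /mkset nc_real ger0_norm//; nra.
  have h1 := cvg_Re (bg _ zd).
  have h2 : series (geometric X w) @ \oo --> X / (1 - w).
    by apply: cvg_geometric_series; rewrite ger0_norm.
  apply: (ler_cvg_to h2 h1); apply: nearW => K.
  rewrite series_Re /series /= !big_mkord; apply: ler_sum => k _.
  rewrite -rmorphXn /= ReM /= mulr0 subr0 /w exprMn.
  have := hankel_peak_coef_ge k rr hb; rewrite -/X => h.
  have := ler_wpM2r (exprn_ge0 k sr0) h; apply: le_trans.
  by rewrite le_eqVlt; apply/orP; left; apply/eqP; ring.
have := le_trans lower upper; rewrite ler_pdivrMr ?subr_gt0// => H.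
have Y0 : 0 <= d * c * (1 - r) ^- 2 by rewrite !mulr_ge0// invr_ge0 exprn_ge0// ltW.
have {}H := le_trans H (ler_wpM2l Y0 wlow).
rewrite massE lee_fin.
have qn : 1 - r != 0 by rewrite gt_eqF.
have q2 : 0 < (1 - r) ^+ 2 by rewrite exprn_gt0.
have := ler_wpM2r (ltW q2) H.
have -> : X * (1 - r) ^+ 2 = mass r / 4 by rewrite /X; field.
have -> : d * c * (1 - r) ^- 2 * (3 * (1 - r)) * (1 - r) ^+ 2 = 3 * (d * c) * (1 - r) by field.
by move=> {}H; nra.
Qed.

Lemma ln_le_harmonic n : ln n.+1%:R <= \sum_(k < n) k.+1%:R^-1 :> R.
Proof.
elim: n => [|n IH]; first by rewrite big_ord0 ln1.
have n0 : 0 < n.+1%:R :> R by rewrite ltr0n.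
rewrite big_ord_recr /=.
have -> : n.+2%:R = n.+1%:R * (1 + n.+1%:R^-1) :> R.
  by rewrite mulrDr mulr1 mulfV ?gt_eqF// natr1.
rewrite lnM ?posrE ?addr_gt0 ?invr_gt0//; apply: lerD => //.
by apply: le_ln1Dx; apply: lt_trans (ltrN10 R) _; rewrite invr_gt0.
Qed.

(** Truncating at the scale [(1 - r)^-1], where [r ^+ k] is still of order one. *)
Lemma ln_le_log_series (r : R) : 0 <= r < 1 ->
  exists N, ln (1 - r)^-1 <= 3 * \sum_(k < N) r ^+ k / k.+1%:R.
Proof.
move=> /andP[r0 r1]; have q0 : 0 < 1 - r by rewrite subr_gt0.
pose M := Num.truncn ((2 * (1 - r))^-1).
have i0 : 0 <= (2 * (1 - r))^-1 by rewrite invr_ge0 mulr_ge0// ltW.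
have M1 : M%:R <= (2 * (1 - r))^-1 by rewrite truncn_le.
have M2 : (2 * (1 - r))^-1 < M.+1%:R by exact: truncnS_gt.
exists M.+1; set S := \sum_(k < _) _.
have S1 : 1 <= S.
  rewrite /S big_ord_recl expr0 divr1 lerDl; apply: sumr_ge0 => i _.
  by rewrite divr_ge0// exprn_ge0.
have half (k : 'I_M.+1) : 2^-1 <= r ^+ k.
  have qq : 0 <= 1 - r <= 1 by lra.
  have := bernoulli_le k qq; rewrite opprB addrCA subrr addr0; apply: le_trans.
  have kM : k%:R <= M%:R :> R by rewrite ler_nat -ltnS.
  have := ler_wpM2r (ltW q0) (le_trans kM M1).
  have -> : (2 * (1 - r))^-1 * (1 - r) = 2^-1 by field; rewrite gt_eqF.
  by lra.
have S2 : 2^-1 * ln M.+1%:R <= S.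
  apply: (@le_trans _ _ (2^-1 * \sum_(k < M.+1) k.+1%:R^-1)).
    rewrite ler_wpM2l ?invr_ge0//; apply: le_trans (ln_le_harmonic _).
    by rewrite ler_ln ?posrE ?ltr0n// ler_nat.
  rewrite mulr_sumr; apply: ler_sum => k _.
  by rewrite ler_wpM2r ?invr_ge0.
have l2 : ln 2 <= 1 :> R.
  by have := @le_ln1Dx R 1; rewrite -natr1; apply; lra.
apply: (@le_trans _ _ (ln (2 * M.+1%:R))).
  rewrite ler_ln ?posrE ?invr_gt0 ?mulr_gt0 ?ltr0n//.
  move: M2; rewrite invfM mulrC => /ltW; lra.
rewrite lnM ?posrE ?ltr0n//.
by lra.
Qed.

(** Hardy's inequality for the image of the peak bounds [mu([r, 1)) (1 - r) ^ (-2)]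
    times a partial sum of the logarithmic series by a multiple of [(1 - r) ^ (-1)]. *)
Lemma hankel_bounded_log_carleson : hankel_bounded_on_hardy mu 1 ->
  log_carleson_measure mu 1 1.
Proof.
move=> hp; have [c c0 hc] := peak_image (lexx 1) hp.
exists (60 * c + 1); first by rewrite ltr_wpDl// mulr_ge0.
move=> r rr; have /andP[r0 r1] := rr; have m0 := mass_ge0 r.
have q0 : 0 < 1 - r by rewrite subr_gt0.
have [g [b [hb bg gn]]] := hc r rr.
have ga := power_series_analytic bg.
have [N hN] := ln_le_log_series rr.
have l0 : 0 <= ln (1 - r)^-1 by rewrite ln_ge0// invf_ge1//; lra.
rewrite (powRr1 l0) (powRr1 (ltW q0)) massE -EFinM lee_fin.
have nE : (1 - r) `^ (1^-1 - 2) = (1 - r)^-1.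
  by rewrite invr1 (_ : 1 - 2 = -1 :> R) ?powR_inv1 ?(ltW q0)//; ring.
rewrite nE in gn.
have B0 : 0 <= c / (1 - r) by rewrite divr_ge0// ltW.
have H : \sum_(k < N) nc (b k) / k.+1%:R <= 5 * (c / (1 - r)).
  apply: (hardy_inequality N bg) => s ss.
  exact: (cmean_trace_le (lexx 1) B0 ga ss gn).
set S := \sum_(k < N) r ^+ k / k.+1%:R in hN.
have low : mass r * ((1 - r) ^- 2 / 4) * S <= 5 * (c / (1 - r)).
  apply: le_trans H; rewrite mulr_sumr; apply: ler_sum => k _.
  rewrite mulrA ler_wpM2r ?invr_ge0// mulrC.
  exact: le_trans (hankel_peak_coef_ge k rr hb) (Re_le_nc _).
have q2 : 0 <= (1 - r) ^+ 2 by rewrite exprn_ge0// ltW.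
have qn : 1 - r != 0 by rewrite gt_eqF.
have := ler_wpM2r q2 low.
have -> : mass r * ((1 - r) ^- 2 / 4) * S * (1 - r) ^+ 2 = mass r * S / 4 by field.
have -> : 5 * (c / (1 - r)) * (1 - r) ^+ 2 = 5 * c * (1 - r) by field.
move=> h; have := ler_wpM2l m0 hN.
by lra.
Qed.

End necessity.

Theorem theorem1p1 (R : realType)
  (mu : {finite_measure set (measurableTypeR R) -> \bar R})
  (mu_supp : mu (~` `[0%R, 1%R[%classic) = 0%E) :
  (hankel_bounded_on_hardy mu 1 <-> log_carleson_measure mu 1 1) /\
  (forall p : R, 1 < p ->
    (hankel_bounded_on_hardy mu p <-> carleson_measure mu)).
Proof.
split.
  by split; [exact: hankel_bounded_log_carleson|exact: log_carleson_hankel_bounded].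
by move=> p p1; split; [exact: hankel_bounded_carleson|exact: carleson_hankel_bounded].
Qed.
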